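(* $\lim_{d\to\infty} p_d' = 1/6$, where $p_d'$ is the critical drift of the non-backtracking frog model on the rooted $d$-ary tree.
   Context: For an integer $d\ge 2$ let $\mathbb T_d$ be the infinite rooted $d$-ary tree (each vertex has $d$ children) with root $\varnothing$. For $p\in(0,1/2)$ put $$p^*=p^*(p,d)=\frac{p(d-1)}{d-(d+1)p},\qquad \hat p=\hat p(p)=\frac{p}{1-p}.$$ The non-backtracking frog model $\mathrm{nbFM}(d,p)$ on $\mathbb T_d$ evolves in discrete time. Initially there is one active particle at $\varnothing$ and one dormant particle at each non-root vertex. When an active particle moves to a site containing a dormant particle, the dormant particle becomes active. Active particles move independently along non-backtracking paths, as follows. The initial particle moves in its first step to a uniformly sampled child of the root. A just activated particle takes its first step towards the root with probability $p^*$, and otherwise away from the root to a uniformly sampled child. For subsequent steps: if the particle's previous step was towards the root, its next step is towards the root with probability $\hat p$, and otherwise it is away from the root to a uniformly sampled child other than the one it just came from; if its previous step was away from the root, all its subsequent steps are away from the root to uniformly sampled children. Any particle that visits the root is killed there and no longer participates. $V_{\mathrm{nbFM}(d,p)}\in\{0,1,\dots\}\cup\{\infty\}$ is the total number of root visits (moves of particles to the root). $\mathrm{nbFM}(d,p)$ is recurrent if $\mathbf P(V_{\mathrm{nbFM}(d,p)}=\infty)=1$. Define $p_d'=\inf\{p\in(0,1/2):\mathrm{nbFM}(d,p)\text{ is recurrent}\}$. *)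

(* Defs.v *)
From mathcomp Require Import all_boot all_order all_algebra.
From mathcomp Require Import all_classical all_reals all_analysis.

Set Implicit Arguments.
Unset Strict Implicit.
Unset Printing Implicit Defensive.

Import Order.TTheory GRing.Theory Num.Theory.
Import numFieldNormedType.Exports.

Local Open Scope classical_set_scope.
Local Open Scope ring_scope.

(* Vertices of the rooted d-ary tree are words over 'I_d, the letter of the
   deepest edge coming first: the root is [::] and the children of v are the
   words i :: v. *)
Notation vertex d := (seq 'I_d).

Definition root_vertex {d : nat} : vertex d := [::].

Definition is_parent (d : nat) (u v : vertex d) : bool :=
  (v != root_vertex) && (u == behead v).

Section NonBacktrackingWalk.
Variables (R : realType) (d : nat) (p : R).

Definition pstar : R := p * (d%:R - 1) / (d%:R - (d%:R + 1) * p).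

Definition phat : R := p / (1 - p).

(* Probability that the first step of the particle started at v leads to w. *)
Definition first_step (v w : vertex d) : R :=
  if v == root_vertex then (if is_parent v w then d%:R^-1 else 0)
  else if is_parent w v then pstar
  else if is_parent v w then (1 - pstar) / d%:R
  else 0.

(* Probability that a particle which has just stepped from t to u moves next
   to w.  A particle killed at the root is encoded as staying there forever. *)
Definition next_step (t u w : vertex d) : R :=
  if u == root_vertex then (w == root_vertex)%:R
  else if is_parent u t then
    if is_parent w u then phat
    else if is_parent u w && (w != t) then (1 - phat) / (d%:R - 1)
    else 0
  else if is_parent t u then (if is_parent u w then d%:R^-1 else 0)
  else 0.

Fixpoint continuation_prob (t u : vertex d) (s : seq (vertex d)) : R :=
  if s is w :: s' then next_step t u w * continuation_prob u w s' else 1.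

(* Probability that the path of the particle started at v begins with v :: s. *)
Definition path_prob (v : vertex d) (s : seq (vertex d)) : R :=
  if s is w :: s' then first_step v w * continuation_prob v w s' else 1.

End NonBacktrackingWalk.

Section FrogPaths.
Variables (R : realType) (d : nat) (p : R).
Variables (disp : measure_display) (Omega : measurableType disp).
Variable P : probability Omega R.

(* X v n is the position, n steps after its activation, of the particle
   initially sitting at v. *)
Variable X : vertex d -> nat -> Omega -> vertex d.

Definition path_sigma (v : vertex d) : set (set Omega) :=
  <<s [set A | exists n u, A = X v n @^-1` [set u]] >>.

Definition independent_paths : Prop :=
  forall (J : seq (vertex d)) (A : vertex d -> set Omega),
    uniq J -> (forall v, v \in J -> path_sigma v (A v)) ->
    P (\bigcap_(v in [set` J]) A v) = (\prod_(v <- J) P (A v))%E.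

Definition is_nbFM : Prop :=
  [/\ forall v n u, measurable (X v n @^-1` [set u]),
      forall v s, P [set w | mkseq (fun n => X v n w) (size s).+1 = v :: s]
                  = (path_prob p v s)%:E
    & independent_paths].

End FrogPaths.

Section FrogDynamics.
Variables (R : realType) (d : nat).
Variable x : vertex d -> nat -> vertex d.

(* age t v = Some a if the particle of v is active at time t, having been
   activated at time t - a (so that it is located at x v a); None if it is
   still dormant. *)
Fixpoint age (t : nat) (v : vertex d) : option nat :=
  if t is t'.+1 then
    if age t' v is Some a then Some a.+1
    else if `[< exists u a, age t' u = Some a /\ x u a.+1 = v >] then Some 0%N
    else None
  else if v == root_vertex then Some 0%N else None.

(* (u, t) is in root_moves if the particle of u moves to the root between the
   times t and t + 1.  Staying at the root once killed is not a move. *)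
Definition root_moves : set (vertex d * nat) :=
  [set m | exists a, [/\ age m.2 m.1 = Some a, x m.1 a <> root_vertex
                       & x m.1 a.+1 = root_vertex]].

Definition root_visits : \bar R := counting root_moves.

End FrogDynamics.

Definition nbFM_recurrent (R : realType) (d : nat) (p : R) : Prop :=
  forall (disp : measure_display) (Omega : measurableType disp)
         (P : probability Omega R) (X : vertex d -> nat -> Omega -> vertex d),
    is_nbFM p P X ->
    P [set w | root_visits R (fun v n => X v n w) = +oo%E] = 1%E.

(* Only meaningful for d >= 2. The infimum of the empty set is 0. *)
Definition critical_drift (R : realType) (d : nat) : R :=
  inf [set p : R | 0 < p < 1 / 2 /\ nbFM_recurrent d p].

(* Main.v *)
Require Import Defs.
From mathcomp Require Import all_boot all_order all_algebra.
From mathcomp Require Import all_classical all_reals all_analysis.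
From mathcomp Require Import ring lra zify.
From mathcomp Require finmap.
From HB Require Import structures.

Set Implicit Arguments.
Unset Strict Implicit.
Unset Printing Implicit Defensive.

Import Order.TTheory GRing.Theory Num.Theory.
Import numFieldNormedType.Exports.

Local Open Scope classical_set_scope.
Local Open Scope ring_scope.

(** Write a = p / (1 - p) for the chance that a frog moving towards the root
goes on doing so; p = 1/6 is a = 1/5.  When d is large almost every step away
from the root meets a dormant frog, so the levels of the frogs look like a
branching random walk: a frog climbs a geometric number of levels of ratio a
and then wakes one frog on each deeper level.  If level h weighs y ^ h with
a < y < 1, the offspring of a frog at level h weigh
(1 - a) y ^ 2 / ((1 - y) (y - a)) times y ^ h.  This factor is smallest at
y = 2 a / (1 + a), where it equals 4 a / (1 - a), and 4 a / (1 - a) < 1 means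
a < 1/5.

Below 1/6 the model is transient for every d >= 2, because a coincidence of
visits can only reduce the number of awakenings.  A frog that visits the root
is joined to the root frog by a chain of distinct frogs, each of which steps
away from the root onto the next one ([awake_chain]).  Distinct frogs are
independent, hence the expected number of chains with k links is at most a
constant times (4 a / (1 - a)) ^ k ([words_sum_le]) and Borel-Cantelli leaves
finitely many visits ([transient]).  For this to refute recurrence the model
has to exist: [nbFM_exists] realises it on the unit interval, nested intervals
being indexed by the steps revealed so far.

Above 1/6 let a particle enter a subtree and follow only the frogs of that
subtree, exploring each child subtree for the first particle that enters it.
The numbers of particles that return from distinct child subtrees are
independent copies of one another, so down to depth n the number of returns has
the law given by the recursion [returns]; [explore] compares it with the actual
frogs by revealing their paths one step at a time.  Let G be the upper limit in
n of the generating functions and g (e) = 1 - G (1 - e) ([defect]).  Two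
inequalities decide the matter.
- Zero-one law: a second child subtree is entered with positive probability, so
  that the limit of g at 0 is 0 or 1 ([defect_zero_one]); if it is 1, the number
  of returns is almost surely infinite.
- Recursion: when only K child subtrees are explored at each vertex, revealing
  the returned particles one after the other yields a supermartingale, hence
  g (de) >= g (e) + (1 - g (e)) (al de + be g (e)) - (1 - a g (de)) ^ K as
  soon as e <= a de + b g (e) ([process_pgf_le], [defect_recursion]); al tends to
  a, and be and b tend to 1 - a as d grows.
If g vanished at 0, put m = g (e) / e and de = (e - b g (e)) / a.  The recursion
shows that the slope at de exceeds m by a fixed amount, because
(1 - a) m ^ 2 - (1 - a) m + a has no real root when a > 1/5 ([slope_step]).
Slopes are bounded by 1 / b, so finitely many steps give a contradiction once K,
and then d, are large ([vanishing_contradiction]).  Hence the model is recurrent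
at each p in ]1/6, 1/2[ for d large ([recurrent_above]). *)

(** * Expectations of counts and the recursion for the number of returns *)

Section Expectations.
Variable R : realFieldType.
Implicit Types (E T : (nat -> R) -> R) (f g : nat -> R) (c : R).

(** The law of a random number is handled through its expectation functional,
which makes the recursions below definitions on functions rather than
statements about random variables. *)
Definition expectation E : Prop :=
  [/\ forall f g, (forall x, f x <= g x) -> E f <= E g,
      forall c f g, E (fun x => c * f x + g x) = c * E f + E g
    & forall c, E (fun=> c) = c].

Lemma expectation_eval x : expectation (fun f => f x).
Proof. by split. Qed.

Lemma expectation_mix c E1 E2 : 0 <= c <= 1 ->
  expectation E1 -> expectation E2 ->
  expectation (fun f => c * E1 f + (1 - c) * E2 f).
Proof.
move=> /andP[c0 c1] [m1 l1 k1] [m2 l2 k2]; split=> [f g fg|c' f g|c'].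
- by rewrite lerD// ler_wpM2l ?m1 ?m2// subr_ge0.
- by rewrite l1 l2; ring.
- by rewrite k1 k2; ring.
Qed.

Lemma expectation_bind T (E : nat -> (nat -> R) -> R) : expectation T ->
  (forall x, expectation (E x)) -> expectation (fun f => T (fun x => E x f)).
Proof.
move=> [mT lT kT] eE; split=> [f g fg|c f g|c].
- by apply: mT => x; have [+ _ _] := eE x; apply.
- rewrite -lT; congr T; apply/funext => x.
  by have [_ + _] := eE x; apply.
- rewrite -[RHS]kT; congr T; apply/funext => x.
  by have [_ _ +] := eE x; apply.
Qed.

Lemma mix_le c x x' y y' : 0 <= c <= 1 -> x <= x' -> y <= y' ->
  c * x + (1 - c) * y <= c * x' + (1 - c) * y'.
Proof. by move=> /andP[c0 c1] xx yy; rewrite lerD// ler_wpM2l// subr_ge0. Qed.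

Lemma expectation_le E f c : expectation E -> (forall x, f x <= c) -> E f <= c.
Proof. by move=> [m _ k] fc; rewrite -[leRHS]k; exact: m. Qed.

Lemma expectation_ge E f c : expectation E -> (forall x, c <= f x) -> c <= E f.
Proof. by move=> [m _ k] fc; rewrite -[leLHS]k; exact: m. Qed.

Lemma expectationM E f c : expectation E -> E (fun x => c * f x) = c * E f.
Proof.
move=> [_ l k]; rewrite -[RHS]addr0 -[in RHS](k 0) -l.
by congr E; apply/funext => x; rewrite addr0.
Qed.

End Expectations.

Section Recursion.
Variables (R : realFieldType) (a pst di : R) (th : nat -> R) (b0 : nat).

(** [k] particles sit at a vertex v and [r] have already gone up to its parent.
In [drain] each particle only chooses between going up, with probability [a],
and being lost. *)
Fixpoint drain (f : nat -> R) (k r : nat) : R :=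
  if k is k'.+1 then a * drain f k' r.+1 + (1 - a) * drain f k' r else f r.

(** As [drain], but a particle that turns away from the root enters with
probability [th j] a child subtree outside the [j] already explored ones, which
sends back a number of particles of law [T].  At most [b] more child subtrees are
explored, so that a constant number of them matters however large the degree. *)
Fixpoint process (T : (nat -> R) -> R) (b j : nat) (f : nat -> R)
    : nat -> nat -> R :=
  if b is b'.+1 then
    fix pr k r := if k is k'.+1 then
      a * pr k' r.+1 + (1 - a) *
        (th j * T (fun x => process T b' j.+1 f (k' + x) r)
         + (1 - th j) * pr k' r)
      else f r
  else drain f.

(** Law of the number of particles that a subtree, explored down to depth [n],
sends to the parent of its top v when a particle enters it.  The entering particle
continues to a first child; the frog of v goes up with probability [pst], and
otherwise enters the same child with probability [di] and another one with
probability [1 - di]. *)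
Fixpoint returns (n : nat) (f : nat -> R) : R :=
  if n is n'.+1 then
    returns n' (fun x => pst * process (returns n') b0.+1 1 f x 1
      + (1 - pst) * (di * process (returns n') b0.+1 1 f x 0
        + (1 - di) * returns n' (fun z =>
            process (returns n') b0 2 f (x + z) 0)))
  else f 0%N.

Lemma processS T b j f k r : process T b.+1 j f k.+1 r =
  a * process T b.+1 j f k r.+1 + (1 - a) *
        (th j * T (fun x => process T b j.+1 f (k + x) r)
         + (1 - th j) * process T b.+1 j f k r).
Proof. by []. Qed.

Lemma process0 T b j f r : process T b j f 0 r = f r.
Proof. by case: b. Qed.

Hypothesis a01 : 0 <= a <= 1.
Hypothesis pst01 : 0 <= pst <= 1.
Hypothesis di01 : 0 <= di <= 1.
Variable th0 : R.
Hypothesis th00 : 0 <= th0.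
Hypothesis th01 : forall j, (1 <= j <= b0.+1)%N -> th0 <= th j <= 1.

Lemma budget_range j b : (0 < j)%N -> (j + b.+1 <= b0.+2)%N ->
  (1 <= j <= b0.+1)%N.
Proof. by move=> j0; lia. Qed.

Lemma expectation_process T : expectation T ->
  forall b j k r, (0 < j)%N -> (j + b <= b0.+2)%N ->
  expectation (fun f => process T b j f k r).
Proof.
move=> eT; elim=> [|b IHb] j k r j0 jb.
  elim: k r => [|k IHk] r; first exact: expectation_eval.
  exact: (expectation_mix a01 (IHk r.+1) (IHk r)).
have /andP[thj0 thj1] := th01 (budget_range j0 jb).
elim: k r => [|k IHk] r; first exact: expectation_eval.
have e x : expectation (fun f => process T b j.+1 f (k + x) r).
  by apply: IHb; lia.
have thj01 : 0 <= th j <= 1 by rewrite (le_trans th00).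
exact: (expectation_mix a01 (IHk r.+1)
  (expectation_mix thj01 (expectation_bind eT e) (IHk r))).
Qed.

Lemma expectation_returns n : expectation (returns n).
Proof.
elim: n => [|n IHn]; first exact: expectation_eval.
have e b j k r : (0 < j)%N -> (j + b <= b0.+2)%N ->
    expectation (fun f => process (returns n) b j f k r).
  exact: expectation_process.
have e2 x : expectation (fun f => returns n (fun z =>
    process (returns n) b0 2 f (x + z) 0)).
  by apply: (expectation_bind IHn) => z; apply: e; lia.
apply: (expectation_bind IHn) => x.
apply: (expectation_mix pst01 (e b0.+1 1%N x 1%N _ _)); [lia|lia|].
by apply: (expectation_mix di01 (e b0.+1 1%N x 0%N _ _) (e2 x)); lia.
Qed.

Definition pgf n (s : R) := returns n (fun x => s ^+ x).

Lemma pgf_bounds n s : 0 <= s <= 1 -> 0 <= pgf n s <= 1.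
Proof.
move=> /andP[s0 s1]; have e := expectation_returns n; apply/andP; split.
  by apply: expectation_ge => // x; rewrite exprn_ge0.
by apply: expectation_le => // x; rewrite exprn_ile1.
Qed.

Lemma pgf_le n s s' : 0 <= s -> s <= s' -> pgf n s <= pgf n s'.
Proof.
move=> s0 ss'; have [m _ _] := expectation_returns n.
by apply: (m) => x; apply: lerXn2r; rewrite ?nnegrE//; lra.
Qed.

(** Convexity of the generating function, in the form used later: the defect
1 - pgf (1 - e) is star-shaped at 0. *)
Lemma pgf_star n t e : 0 <= t <= 1 -> 0 <= e <= 1 ->
  t * (1 - pgf n (1 - e)) <= 1 - pgf n (1 - t * e).
Proof.
move=> /andP[t0 t1] /andP[e0 e1].
have [m l k] := expectation_returns n.
suff : pgf n (1 - t * e) <= t * pgf n (1 - e) + (1 - t) by lra.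
rewrite /pgf -(k (1 - t)) -l; apply: (m) => x.
elim: x => [|x IHx]; first by rewrite !expr0; lra.
have z01 : 0 <= (1 - e) ^+ x <= 1.
  by rewrite exprn_ge0 ?exprn_ile1//=; lra.
rewrite !exprS; set z := (1 - e) ^+ x in IHx z01 *.
have te : 0 <= t * e <= 1 by nra.
have : (1 - t * e) * (1 - t * e) ^+ x <= (1 - t * e) * (t * z + (1 - t)).
  by rewrite ler_wpM2l//; lra.
move/le_trans; apply.
suff : 0 <= t * e * (1 - t) * (1 - z) by lra.
by case/andP: z01 => ? ?; rewrite !mulr_ge0//; lra.
Qed.

Section PgfBounds.
Variables (T : (nat -> R) -> R) (s : R).
Hypothesis eT : expectation T.
Hypothesis s01 : 0 <= s <= 1.
Let G y := T (fun x => y ^+ x).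
Let sg := a * s + 1 - a.

Let sgE : sg = a * s + 1 - a. Proof. by []. Qed.

Lemma sg01 : 0 <= sg <= 1.
Proof.
by have /andP[s0 s1] := s01; have /andP[a0 a1] := a01; rewrite /sg; nra.
Qed.

(** Forgetting everything about the explored subtrees leaves [k] independent
particles, each contributing a factor [s] with probability [a]. *)
Lemma process_drain_le b j k r : (0 < j)%N -> (j + b <= b0.+2)%N ->
  process T b j (GRing.exp s) k r <= s ^+ r * sg ^+ k.
Proof.
have /andP[g0 g1] := sg01; have /andP[s0 s1] := s01; have /andP[a0 a1] := a01.
elim: b j k r => [|b IHb] j k r j0 jb.
  elim: k r => [|k IHk] r /=; first by rewrite mulr1.
  apply: le_trans (mix_le a01 (IHk r.+1) (IHk r)) _.
  by rewrite !exprS {3}/sg; lra.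
have /andP[thj0 thj1] := th01 (budget_range j0 jb).
elim: k r => [|k IHk] r; first by rewrite process0 mulr1.
rewrite processS.
have H1 := IHk r; have := IHk r.+1; rewrite !exprS -mulrA => H2.
set q := s ^+ r * sg ^+ k in H1 H2 *.
have q0 : 0 <= q by rewrite mulr_ge0 ?exprn_ge0.
have H3 : T (fun x => process T b j.+1 (GRing.exp s) (k + x) r) <= q.
  apply: (expectation_le eT) => x.
  have jb' : (j.+1 + b <= b0.+2)%N by rewrite addSnnS.
  apply: le_trans (IHb j.+1 (k + x)%N r isT jb') _.
  rewrite /q ler_wpM2l ?exprn_ge0// exprD.
  by rewrite ler_piMr ?exprn_ge0// exprn_ile1.
have thj01 : 0 <= th j <= 1 by rewrite (le_trans th00).
apply: le_trans (mix_le a01 H2 (mix_le thj01 H3 H1)) _.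
have -> : s ^+ r * (sg * sg ^+ k) = sg * q by rewrite /q; ring.
by rewrite sgE; lra.
Qed.

(** The hypothesis on [y] says that replacing a particle by its result, a factor
[s] for a visit to the parent or [y] to the number of particles that a fresh child
subtree returns, does not increase the expectation: [y ^+ k] is a supermartingale
as long as fewer than the allowed number of children have been explored.  The term
with [G sg ^+ b] pays for the histories that use up this number: draining what each
explored subtree returned gives a factor [G sg] per subtree. *)
Lemma process_pgf_le y b j k r : 0 <= y <= 1 ->
  a * s + (1 - a) * (th0 * G y + (1 - th0)) <= y ->
  (0 < j)%N -> (j + b <= b0.+2)%N ->
  process T b j (GRing.exp s) k r <= s ^+ r * (y ^+ k + sg ^+ k * G sg ^+ b).
Proof.
move=> /andP[y0 y1] Hy.
have /andP[g0 g1] := sg01; have /andP[s0 s1] := s01; have /andP[a0 a1] := a01.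
have Gg0 : 0 <= G sg by apply: expectation_ge => // x; rewrite exprn_ge0.
have Gy1 : G y <= 1 by apply: expectation_le => // x; rewrite exprn_ile1.
elim: b j k r => [|b IHb] j k r j0 jb.
  apply: le_trans (process_drain_le _ _ _ _) _ => //.
  by rewrite ler_wpM2l ?exprn_ge0// mulr1 lerDr exprn_ge0.
have /andP[thj0 thj1] := th01 (budget_range j0 jb).
elim: k r => [|k IHk] r.
  by rewrite process0 mulrDr mulr1 lerDl !mulr_ge0 ?exprn_ge0.
rewrite processS.
have H1 := IHk r; have := IHk r.+1; rewrite !exprS => H2.
set A := s ^+ r * y ^+ k; set B := s ^+ r * (sg ^+ k * G sg ^+ b).
have A0 : 0 <= A by rewrite mulr_ge0 ?exprn_ge0.
have B0 : 0 <= B by rewrite !mulr_ge0 ?exprn_ge0.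
have H3 : T (fun x => process T b j.+1 (GRing.exp s) (k + x) r) <=
    A * G y + B * G sg.
  have [m l _] := eT.
  rewrite -(expectationM (fun x => sg ^+ x) B eT) -l.
  apply: (m) => x.
  have jb' : (j.+1 + b <= b0.+2)%N by rewrite addSnnS.
  apply: le_trans (IHb j.+1 (k + x)%N r isT jb') _.
  by rewrite !exprD /A /B; lra.
have H1' : process T b.+1 j (GRing.exp s) k r <= A + B * G sg.
  by apply: le_trans H1 _; rewrite exprS /A /B; lra.
have H2' : process T b.+1 j (GRing.exp s) k r.+1 <= s * (A + B * G sg).
  by apply: le_trans H2 _; rewrite /A /B; lra.
have thj01 : 0 <= th j <= 1 by rewrite (le_trans th00).
apply: le_trans (mix_le a01 H2' (mix_le thj01 H3 H1')) _.
have H5 : A * (a * s + (1 - a) * (th j * G y + (1 - th j))) <= A * y.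
  rewrite ler_wpM2l// (le_trans _ Hy)// lerD2l ler_wpM2l; [|lra|nra] => //.
suff -> : s ^+ r * (y * y ^+ k + sg * sg ^+ k * (G sg * G sg ^+ b)) =
    A * y + sg * (B * G sg) by rewrite sgE; lra.
by rewrite /A /B; ring.
Qed.

End PgfBounds.

(** Draining both the first child subtree and the one that the frog of the vertex
may enter already shows that two independent copies contribute. *)
Lemma pgf_zero_one n s : 0 <= s <= 1 ->
  pgf n.+1 s <= pgf n (a * s + 1 - a) *
    (pst * s + (1 - pst) * (di + (1 - di) * pgf n (a * s + 1 - a))).
Proof.
move=> s01; set sg := a * s + 1 - a.
have /andP[g0 g1] : 0 <= sg <= 1 by exact: sg01.
have e := expectation_returns n; have [m l _] := e.
have /andP[pg0 pg1] := pgf_bounds n (sg01 s01).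
have /andP[p0 p1] := pst01; have /andP[d0 d1] := di01.
set c := (X in _ <= _ * X).
rewrite mulrC /pgf -(expectationM _ _ e); apply: (m) => x.
have H b j k r := process_drain_le e s01 (b := b) (j := j) k r.
have H1 : process (returns n) b0.+1 1 (GRing.exp s) x 1 <= s * sg ^+ x.
  by have := H b0.+1 1%N x 1%N isT (leqnn _); rewrite expr1.
have H0 : process (returns n) b0.+1 1 (GRing.exp s) x 0 <= sg ^+ x.
  by have := H b0.+1 1%N x 0%N isT (leqnn _); rewrite mul1r.
have H2 : returns n (fun z => process (returns n) b0 2 (GRing.exp s) (x + z) 0)
    <= sg ^+ x * pgf n sg.
  rewrite -(expectationM _ _ e); apply: (m) => z.
  by have := H b0 2%N (x + z)%N 0%N isT (leqnn _); rewrite mul1r exprD.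
apply: le_trans (mix_le pst01 H1 (mix_le di01 H0 H2)) _.
by rewrite /c -/sg; lra.
Qed.

Lemma pgf_recursion n s y : 0 <= s <= 1 -> 0 <= y <= 1 ->
  a * s + (1 - a) * (th0 * pgf n y + (1 - th0)) <= y ->
  pgf n.+1 s <= pgf n y * (pst * s + (1 - pst) * (di + (1 - di) * pgf n y))
    + pgf n (a * s + 1 - a) ^+ b0.+2.
Proof.
move=> s01 y01 Hy; set sg := a * s + 1 - a.
have /andP[g0 g1] : 0 <= sg <= 1 by exact: sg01.
have /andP[s0 s1] := s01.
have e := expectation_returns n; have [m l _] := e.
have /andP[pg0 pg1] : 0 <= pgf n sg <= 1 := pgf_bounds n (sg01 s01).
have /andP[py0 py1] := pgf_bounds n y01.
have /andP[p0 p1] := pst01; have /andP[d0 d1] := di01.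
have H b j k r := process_pgf_le e s01 (b := b) (j := j) k r y01 Hy.
set Gs := pgf n sg in pg0 pg1 *; set Gy := pgf n y in py0 py1 *.
set c := (X in Gy * X).
have q0 : 0 <= Gs ^+ b0.+1 by rewrite exprn_ge0.
apply: (@le_trans _ _ (c * Gy + Gs ^+ b0.+1 * Gs)); last first.
  by rewrite [in leRHS]exprSr mulrC.
rewrite /Gs /Gy /pgf -(expectationM (fun x => sg ^+ x)) // -l -/(pgf n sg) -/Gs -/(pgf n y) -/Gy.
apply: (m) => x.
have H1 : process (returns n) b0.+1 1 (GRing.exp s) x 1 <=
    s * y ^+ x + Gs ^+ b0.+1 * sg ^+ x.
  have := H b0.+1 1%N x 1%N; rewrite expr1 => /(_ isT (leqnn _))/le_trans; apply.
  rewrite mulrDr lerD2l [leRHS]mulrC -/sg -/Gs ler_piMl//.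
  by rewrite mulr_ge0// exprn_ge0.
have H0 : process (returns n) b0.+1 1 (GRing.exp s) x 0 <=
    y ^+ x + Gs ^+ b0.+1 * sg ^+ x.
  by have := H b0.+1 1%N x 0%N isT (leqnn _); rewrite mul1r [sg ^+ x * _]mulrC.
have H2 : returns n (fun z => process (returns n) b0 2 (GRing.exp s) (x + z) 0)
    <= y ^+ x * Gy + Gs ^+ b0.+1 * sg ^+ x.
  have -> : Gs ^+ b0.+1 * sg ^+ x = Gs ^+ b0 * sg ^+ x * Gs by rewrite exprSr; ring.
  rewrite /Gs /Gy /pgf -(expectationM (fun x => sg ^+ x)) // -l -/(pgf n sg) -/Gs.
  apply: (m) => z.
  have := H b0 2%N (x + z)%N 0%N => /(_ isT (leqnn _))/le_trans; apply.
  by rewrite mul1r !exprD; lra.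
set q := Gs ^+ b0.+1 * sg ^+ x in H0 H1 H2 *.
apply: le_trans (mix_le pst01 H1 (mix_le di01 H0 H2)) _.
by rewrite /c; lra.
Qed.

End Recursion.

(** Chance that a particle coming up from one of [j] explored children and turning
back, which it does towards one of the [d - 1] other children, enters an
unexplored one. *)
Definition fresh_rate (R : realFieldType) (d j : nat) : R :=
  (d%:R - j%:R) / (d%:R - 1).

(** * No slow start at zero for supercritical recursions *)

Section SlopeGrowth.
Variables (R : realType) (a c1 : R).
Hypothesis a01 : 0 < a < 1.
Hypothesis c10 : 0 < c1 <= 1.

(** [g] is the defect of the limiting generating function, [al], [be] and [b] are the
rates of its recursion, and [quad] is the strict positivity of the quadratic form
that decides between subcritical and supercritical. *)
Section FixedFunction.
Variables (b al be : R) (K : nat) (g : R -> R).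
Hypothesis b01 : (1 - a) / 2 <= b <= 1.
Hypothesis al01 : a / 2 <= al <= 1.
Hypothesis be01 : 0 <= be <= 1.
Hypothesis quad : forall x e, 0 <= x -> 0 <= e ->
  c1 * e ^+ 2 <= b * x ^+ 2 - x * e * (1 - a - a * be + al * b) + al * e ^+ 2.
Hypothesis g01 : forall e, 0 <= e <= 1 -> 0 <= g e <= 1.
Hypothesis g_mono : forall e e', 0 <= e -> e <= e' -> e' <= 1 -> g e <= g e'.
Hypothesis g_star : forall t e, 0 <= t <= 1 -> 0 <= e <= 1 ->
  t * g e <= g (t * e).
Hypothesis g_lin : forall e, 0 <= e <= 1 -> al * e <= g e.
Hypothesis gH : forall e de, 0 < e <= 1 -> 0 <= de <= 1 ->
  e <= a * de + b * g e ->
  g e + (1 - g e) * (al * de + be * g e) - (1 - a * g de) ^+ K <= g de.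
Hypothesis g_van : forall tau, 0 < tau -> exists de, 0 < de <= 1 /\ g de <= tau.

(** Star-shapedness prevents [g] from dropping by more than a factor 2 when its
argument is halved, so dyadic arguments meet every range [tau / 2, tau]. *)
Lemma dyadic_value tau : 0 < tau -> tau <= g 1 ->
  exists de, 0 < de <= 1 /\ tau / 2 <= g de <= tau.
Proof.
move=> t0 t1; have [d0 [/andP[d00 d01] gd0]] := g_van t0.
have p2 i : 0 < 2^-1 ^+ i :> R by rewrite exprn_gt0.
have p1 i : 2^-1 ^+ i <= 1 :> R by rewrite exprn_ile1//; lra.
have ex : exists i, g (2^-1 ^+ i) <= tau.
  have : @GRing.exp R 2^-1 @ \oo --> 0.
    by apply: cvg_expr; rewrite ger0_norm; lra.
  move=> /cvgrPdist_lt/(_ _ d00)[i _ /(_ i (leqnn i))/=].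
  rewrite sub0r normrN ger0_norm ?ltW// => hi.
  by exists i; apply: le_trans gd0; apply: g_mono => //; exact: ltW.
case: (ex_minnP ex) => -[|i] gi imin.
  exists 1; rewrite ltr01 lexx; split => //; rewrite expr0 in gi.
  by apply/andP; split => //; lra.
exists (2^-1 ^+ i.+1); split; first by rewrite p2 p1.
rewrite gi andbT.
have gi' : tau < g (2^-1 ^+ i).
  by rewrite ltNge; apply/negP => /imin; rewrite ltnn.
have := @g_star 2^-1 (2^-1 ^+ i).
rewrite -exprS p1 (ltW (p2 _)) => H.
have : 2^-1 * g (2^-1 ^+ i) <= g (2^-1 ^+ i.+1) by apply: H => //; lra.
lra.
Qed.

(* Everything happens where g lies between the scales lo and hi: below hi the
   recursion is nearly linear, and at values of order lo the error term
   (1 - a g) ^+ K is negligible. *)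
Variable lo : R.
Hypothesis lo_range : 0 < lo <= a / 2.
Hypothesis gaK : (1 - a * (lo / 2)) ^+ K < lo.

Let g1 : lo <= g 1.
Proof.
have : al * 1 <= g 1 by apply: g_lin; rewrite ler01 lexx.
by case/andP: lo_range => ? ?; case/andP: al01 => ? ?; lra.
Qed.

(** If [g de] were below [lo / 2], the recursion could be applied instead at a larger
argument where [g] is between [lo / 2] and [lo], and there it gives a value above
[lo]. *)
Lemma value_lower e de : 0 < e <= 1 -> 0 <= de <= 1 -> 2 * lo <= g e ->
  e <= a * de + b * g e -> lo / 2 <= g de.
Proof.
move=> e01 /andP[d0 d1] xga ed; rewrite leNgt; apply/negP => gd.
have /andP[hi gaa] := lo_range.
have [d' [/andP[d'0 d'1] /andP[gd'1 gd'2]]] := dyadic_value hi g1.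
have dd' : de <= d'.
  rewrite leNgt; apply/negP => /ltW d'd.
  by have := g_mono (ltW d'0) d'd d1; lra.
have /andP[a0 a1] := a01.
have d'01 : 0 <= d' <= 1 by rewrite d'1 ltW.
have ed' : e <= a * d' + b * g e.
  by apply: le_trans ed _; rewrite lerD2r ler_wpM2l// ltW.
have := gH e01 d'01 ed'.
have /andP[gd0 gd1] := g01 d'01.
have ge01 : 0 <= e <= 1 by case/andP: e01 => /ltW -> ->.
have /andP[ge0 ge1] := g01 ge01.
have /andP[al0 al1] := al01; have /andP[be0 be1] := be01.
have : 0 <= (1 - g e) * (al * d' + be * g e).
  rewrite mulr_ge0//; first lra.
  by rewrite addr_ge0// mulr_ge0//; lra.
have : (1 - a * g d') ^+ K <= (1 - a * (lo / 2)) ^+ K.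
  apply: lerXn2r; rewrite ?nnegrE; try nra.
have := gaK; lra.
Qed.

(** Otherwise [value_lower] would apply to every [de] and keep [g] away from 0. *)
Lemma move_positive e : 0 < e <= 1 -> 2 * lo <= g e -> b * g e < e.
Proof.
move=> e1 xga; rewrite ltNge; apply/negP => eb.
have /andP[ga_0 _] := lo_range; have /andP[a0 _] := a01.
have [d [/andP[d0 d1] gd]] := g_van (divr_gt0 ga_0 (ltr0n R 4)).
have : lo / 2 <= g d.
  apply: (value_lower e1) => //; first by rewrite d1 ltW.
  by apply: le_trans eb _; rewrite lerDr mulr_ge0// ltW.
lra.
Qed.

Variable hi : R.
Hypothesis hi_small : 0 < hi /\ hi * (2 + 2 * a / (1 - a)) <= c1 / 4.
Hypothesis gaK' : (1 - a * (lo / 2)) ^+ K * a <= c1 * lo * (1 - a) / 4.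

Let c2 := c1 / (2 * a).

(** The slope of [g] at [de = (e - b * g e) / a] exceeds its slope at [e] by at least
[c2].  Multiplied by [a * e], the gain is the quadratic form [quad] at [g e] and [e];
half of it absorbs the nonlinear term and the error term.  That [de < e] follows,
since star-shapedness makes slopes decrease with the argument. *)
Lemma slope_step e : 0 < e <= a -> 2 * lo <= g e <= hi ->
  exists de, [/\ 0 < de, de < e, c2 * e <= g de
    & g e / e * de + c2 * e <= g de].
Proof.
move=> /andP[e0 ea] /andP[xga xga'].
have /andP[ga_0 gaa] := lo_range.
have /andP[a0 a1] := a01; have /andP[c0 c1'] := c10.
have /andP[bl b1] := b01; have b0 : 0 < b by lra.
have /andP[al0 al1] := al01; have /andP[be0 be1] := be01.
have e1 : 0 < e <= 1 by lra.
have eb := move_positive e1 xga.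
set x := g e in xga xga' eb *.
have x0 : 0 < x by lra.
pose de := (e - b * x) / a.
have ade : a * de = e - b * x by rewrite /de mulrC divfK// gt_eqF.
have de0 : 0 < de by rewrite divr_gt0// subr_gt0.
have ade' : a * de <= a * 1 by rewrite ade; nra.
have de1 : de <= 1 by rewrite -(ler_pM2l a0).
have de01 : 0 <= de <= 1 by rewrite de1 ltW.
have ed : e <= a * de + b * x by rewrite ade; lra.
have gdl := value_lower e1 de01 xga ed.
have := gH e1 de01 ed; rewrite -/x => gde.
have H1K := gaK; have H2K := gaK'; set eta := (1 - a * (lo / 2)) ^+ K in H1K H2K.
have eta_le : (1 - a * g de) ^+ K <= eta.
  have /andP[gd0 gd1] := g01 de01.
  by apply: lerXn2r; rewrite ?nnegrE; nra.
have q := quad (ltW x0) (ltW e0).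
(* Both error terms are compared with e ^+ 2, the scale of the quadratic gain. *)
have xe : x <= e * (2 / (1 - a)).
  rewrite mulrA ler_pdivlMr; last lra.
  nra.
have err1 : a * e * (x * (al * de + be * x)) <= e ^+ 2 * (c1 / 4).
  have H1 : a * (al * de + be * x) <= e * (1 + 2 * a / (1 - a)).
    apply: (@le_trans _ _ (a * de + a * x)).
      by rewrite mulrDr lerD// ler_wpM2l ?(ltW a0)// ler_piMl// ltW.
    have : a * x <= a * (e * (2 / (1 - a))) by rewrite ler_wpM2l// ltW.
    have -> : a * (e * (2 / (1 - a))) = e * (2 * a / (1 - a)) by ring.
    have : 0 <= b * x by rewrite mulr_ge0// ltW.
    lra.
  have c3 : 0 <= 2 * a / (1 - a) by rewrite divr_ge0//; lra.
  have [_ small] := hi_small; set c4 := 2 * a / (1 - a) in H1 c3 small *.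
  have H2 : x * (a * (al * de + be * x)) <= x * (e * (1 + c4)).
    by rewrite ler_wpM2l// ltW.
  have H3 : x * (1 + c4) <= c1 / 4.
    by apply: le_trans small; nra.
  have : e * (x * (a * (al * de + be * x))) <= e * (x * (e * (1 + c4))).
    by rewrite ler_wpM2l// ltW.
  have : e ^+ 2 * (x * (1 + c4)) <= e ^+ 2 * (c1 / 4).
    by rewrite ler_wpM2l// sqr_ge0.
  lra.
have err2 : a * e * eta <= e ^+ 2 * (c1 / 4).
  have H1 : lo * (1 - a) <= e by nra.
  have : e * (eta * a) <= e * (c1 * lo * (1 - a) / 4).
    exact: (ler_wpM2l (ltW e0) H2K).
  have : e * c1 * (lo * (1 - a)) <= e * c1 * e.
    exact: (ler_wpM2l (mulr_ge0 (ltW e0) (ltW c0)) H1).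
  lra.
have main : x * de + c2 * e ^+ 2 <= e * g de.
  rewrite -(ler_pM2l a0).
  have -> : a * (x * de + c2 * e ^+ 2) = x * (a * de) + c1 / 2 * e ^+ 2.
    by rewrite /c2; field; rewrite gt_eqF.
  have H : a * e * (x + (1 - x) * (al * de + be * x) - eta) <= a * e * g de.
    by apply: (ler_wpM2l (mulr_ge0 (ltW a0) (ltW e0))); lra.
  have -> : a * (e * g de) = a * e * g de by ring.
  apply: le_trans H; rewrite ade.
  have E : a * e * (x + al * de + be * x) = a * e * x * (1 + be) + al * e * (e - b * x).
    by rewrite -ade; ring.
  lra.
have xde : x / e * de + c2 * e <= g de.
  rewrite -(ler_pM2l e0).
  have -> : e * (x / e * de + c2 * e) = x * de + c2 * e ^+ 2.
    by field; rewrite gt_eqF.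
  exact: main.
exists de; split => //; last first.
  by apply: le_trans xde; rewrite lerDr; apply: mulr_ge0; [apply: divr_ge0|]; exact: ltW.
rewrite ltNge; apply/negP => led.
have t01 : 0 <= e / de <= 1.
  by rewrite (divr_ge0 (ltW e0) (ltW de0)) ler_pdivrMr// mul1r.
have := g_star t01 de01; rewrite divfK ?gt_eqF// -/x => H.
have : e * g de <= x * de.
  have -> : e * g de = e / de * g de * de by field; rewrite gt_eqF.
  by rewrite ler_wpM2r// ltW.
have : 0 < c2 * e ^+ 2 by rewrite mulr_gt0 ?exprn_gt0// divr_gt0//; lra.
lra.
Qed.

(** Each step raises the slope by [c2] at the cost of a factor [la] in the value,
so that after [J] steps, a number fixed in advance, the value is still above [2 * lo]. *)
Lemma slope_iter (J : nat) (la : R) : 0 < la <= 1 -> la <= c2 * ((1 - a) / 2) ->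
  2 * lo <= hi / 2 * la ^+ J -> hi <= a ^+ 2 / 2 ->
  forall j, (j <= J)%N -> exists e, [/\ 0 < e <= a,
     hi / 2 * la ^+ j <= g e <= hi & j%:R * c2 * e <= g e].
Proof.
move=> /andP[la0 la1] lac2 gaJ ga'a.
have /andP[a0 a1] := a01; have /andP[c0 c1'] := c10.
have /andP[bl b1] := b01; have /andP[al0 al1] := al01.
have [ga'0 _] := hi_small.
have c20 : 0 < c2 by rewrite divr_gt0//; lra.
have ga'a' : hi <= a * (a / 2) by rewrite mulrA -expr2.
elim=> [_|j IHj jJ].
  have gg1 : hi <= g 1.
    have : al * 1 <= g 1 by apply: g_lin; rewrite ler01 lexx.
    have : 0 <= a * (1 - a) by rewrite mulr_ge0; lra.
    lra.
  have [e [/andP[e0 e1] ge]] := dyadic_value ga'0 gg1.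
  exists e; rewrite e0 expr0 mulr1 !mul0r; split => //; last first.
    by case/andP: ge; lra.
  have : al * e <= g e by apply: g_lin; rewrite e1 ltW.
  case/andP: ge => _ ge.
  have H : a / 2 * e <= al * e by rewrite ler_wpM2r// ltW.
  move=> H'; have : a / 2 * e <= a / 2 * a by lra.
  by rewrite ler_pM2l// divr_gt0.
have [e [/andP[e0 ea] /andP[ge1 ge2] se]] := IHj (ltnW jJ).
have lajJ : hi / 2 * la ^+ J <= hi / 2 * la ^+ j.
  apply: ler_wpM2l; first by rewrite divr_ge0// ltW.
  by apply: ler_wiXn2l (ltnW jJ) => //; exact: ltW.
have ge' : 2 * lo <= g e <= hi by rewrite ge2 andbT; lra.
have ea' : 0 < e <= a by rewrite e0.
have [de [de0 dee gde1 gde2]] := slope_step ea' ge'.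
have e1 : e <= 1 by lra.
exists de; split.
- by rewrite de0; lra.
- apply/andP; split; last by apply: le_trans ge2; apply: g_mono; lra.
  apply: le_trans gde1.
  have H1 : hi / 2 * la ^+ j.+1 <= g e * la.
    by rewrite exprSr mulrA ler_wpM2r// ltW.
  have gee : (1 - a) / 2 * g e <= e.
    apply: (@le_trans _ _ (b * g e)).
      by rewrite ler_wpM2r//; have /andP[] := g01 (e := e) ltac:(lra).
    by apply: ltW; apply: move_positive; lra.
  have H2 : g e * la <= g e * (c2 * ((1 - a) / 2)).
    by rewrite ler_wpM2l//; have /andP[] := g01 (e := e) ltac:(lra).
  have H3 : c2 * ((1 - a) / 2 * g e) <= c2 * e by rewrite ler_wpM2l// ltW.
  lra.
- apply: le_trans gde2.
  have : j%:R * c2 <= g e / e by rewrite ler_pdivlMr.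
  move=> /(ler_wpM2r (ltW de0)) H.
  have : c2 * de <= c2 * e by rewrite ler_wpM2l// ltW.
  by rewrite -natr1; lra.
Qed.

Lemma slope_contradiction (J : nat) (la : R) : 0 < la <= 1 ->
  la <= c2 * ((1 - a) / 2) ->
  2 * lo <= hi / 2 * la ^+ J -> hi <= a ^+ 2 / 2 ->
  1 <= J%:R * la -> False.
Proof.
move=> la01 lac2 gaJ ga'a Jla.
have [e [/andP[e0 ea] /andP[ge1 ge2] se]] := slope_iter la01 lac2 gaJ ga'a (leqnn J).
have /andP[a0 a1] := a01; have /andP[ga_0 gaa] := lo_range.
have /andP[bl b1] := b01.
have ge' : 2 * lo <= g e by lra.
have : b * g e < e by apply: move_positive ge'; lra.
have H1 : 1 <= J%:R * (c2 * ((1 - a) / 2)).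
  by apply: le_trans Jla _; rewrite ler_wpM2l.
have H2 : (1 - a) / 2 * (J%:R * c2 * e) <= (1 - a) / 2 * g e.
  by rewrite ler_wpM2l//; lra.
have H3 : (1 - a) / 2 * g e <= b * g e by rewrite ler_wpM2r//; lra.
have : 1 * e <= J%:R * (c2 * ((1 - a) / 2)) * e by rewrite ler_wpM2r// ltW.
lra.
Qed.

End FixedFunction.

(** All the constants depend on [a] and [c1] only: first [hi], then the number [J] of
steps that makes the slope too large, then [lo], and last the exponent. *)
Lemma vanishing_contradiction : exists b0 : nat, forall b al be (g : R -> R),
  (1 - a) / 2 <= b <= 1 -> a / 2 <= al <= 1 -> 0 <= be <= 1 ->
  (forall x e, 0 <= x -> 0 <= e ->
    c1 * e ^+ 2 <= b * x ^+ 2 - x * e * (1 - a - a * be + al * b) + al * e ^+ 2) ->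
  (forall e, 0 <= e <= 1 -> 0 <= g e <= 1) ->
  (forall e e', 0 <= e -> e <= e' -> e' <= 1 -> g e <= g e') ->
  (forall t e, 0 <= t <= 1 -> 0 <= e <= 1 -> t * g e <= g (t * e)) ->
  (forall e, 0 <= e <= 1 -> al * e <= g e) ->
  (forall e de, 0 < e <= 1 -> 0 <= de <= 1 -> e <= a * de + b * g e ->
    g e + (1 - g e) * (al * de + be * g e) - (1 - a * g de) ^+ b0.+2 <= g de) ->
  ~ (forall tau, 0 < tau -> exists de, 0 < de <= 1 /\ g de <= tau).
Proof.
have /andP[a0 a1] := a01; have /andP[c0 c1'] := c10.
have b0 : 0 < 1 - a by lra.
have q0 : 0 < 2 + 2 * a / (1 - a) by rewrite addr_gt0// divr_gt0//; lra.
pose hi := Num.min (a ^+ 2 / 2) (c1 / 4 / (2 + 2 * a / (1 - a))).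
have ga'0 : 0 < hi by rewrite lt_min !divr_gt0// exprn_gt0.
have ga'a : hi <= a ^+ 2 / 2 by rewrite ge_min lexx.
have ga's : hi * (2 + 2 * a / (1 - a)) <= c1 / 4.
  by rewrite -ler_pdivlMr// ge_min lexx orbT.
pose la := Num.min 1 (c1 / (2 * a) * ((1 - a) / 2)).
have la0 : 0 < la.
  by rewrite lt_min ltr01/= mulr_gt0// divr_gt0// mulr_gt0.
have la1 : la <= 1 by rewrite ge_min lexx.
have lac : la <= c1 / (2 * a) * ((1 - a) / 2) by rewrite ge_min lexx orbT.
have [J Jla] : exists J : nat, 1 <= J%:R * la.
  exists (Num.bound la^-1); rewrite -ler_pdivrMr// div1r.
  by rewrite ltW// archi_boundP// invr_ge0 ltW.
pose lo := hi / 4 * la ^+ J.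
have laJ0 : 0 < la ^+ J by rewrite exprn_gt0.
have laJ1 : la ^+ J <= 1 by rewrite exprn_ile1// ltW.
have ga_0 : 0 < lo by rewrite mulr_gt0// divr_gt0.
have aa : a ^+ 2 <= a by rewrite expr2 ler_piMr// ltW.
have gaa : lo <= a / 2.
  have : hi / 4 * la ^+ J <= hi / 4 * 1 by rewrite ler_wpM2l// divr_ge0// ltW.
  rewrite -/lo; lra.
have [b1 [K1 K2]] : exists b1 : nat, (1 - a * (lo / 2)) ^+ b1.+2 < lo /\
    (1 - a * (lo / 2)) ^+ b1.+2 * a <= c1 * lo * (1 - a) / 4.
  pose tau := Num.min lo (c1 * lo * (1 - a) / 4 / a).
  have tau0 : 0 < tau by rewrite lt_min ga_0 !divr_gt0// !mulr_gt0.
  have ag : 0 < a * (lo / 2) <= 1 / 2.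
    rewrite mulr_gt0 ?divr_gt0//=.
    have : a * (lo / 2) <= 1 * (lo / 2) by rewrite ler_wpM2r// ?divr_ge0// ltW.
    lra.
  have : @GRing.exp R (1 - a * (lo / 2)) @ \oo --> 0.
    by apply: cvg_expr; rewrite ger0_norm; lra.
  move=> /cvgrPdist_lt/(_ _ tau0)[i _ /(_ i.+2)/=].
  rewrite sub0r normrN ger0_norm; last by rewrite exprn_ge0; lra.
  move=> /(_ (leq_trans (leqnSn _) (leqnSn _))).
  rewrite lt_min => /andP[h1 /ltW h2]; exists i; split => //.
  by rewrite -ler_pdivlMr.
exists b1 => b al be g Hb Hal Hbe Hq g01 gm gs gl gH gv.
have lo_range : 0 < lo <= a / 2 by rewrite ga_0.
have la01 : 0 < la <= 1 by rewrite la0.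
have gaJ : 2 * lo <= hi / 2 * la ^+ J by rewrite /lo; lra.
exact: (slope_contradiction Hb Hal Hbe Hq g01 gm gs gl gH gv lo_range K1
  (conj ga'0 ga's) K2 la01 lac gaJ ga'a Jla).
Qed.

End SlopeGrowth.

(** * The limiting generating function of the number of returns *)

Section LimSup.
Variable R : realType.
Implicit Types u v : nat -> R.

Lemma sups_le u n c : (forall m, (n <= m)%N -> u m <= c) -> sups u n <= c.
Proof.
move=> uc; rewrite /sups/=; apply: ge_sup; first by exists (u n); exists n => /=.
by move=> _ [m /= nm <-]; exact: uc.
Qed.

Lemma le_sups u n m c : (forall m, u m <= c) -> (n <= m)%N -> u m <= sups u n.
Proof.
move=> uc nm; rewrite /sups/=; apply: ub_le_sup; last by exists m.
by exists c => _ [k _ <-].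
Qed.

Lemma cvg_power u (l : R) k : u @ \oo --> l -> u n ^+ k @[n --> \oo] --> l ^+ k.
Proof.
move=> ul; elim: k => [|k IHk].
  by under eq_fun do rewrite expr0; rewrite expr0; exact: cvg_cst.
by under eq_fun do rewrite exprS; rewrite exprS; exact: cvgM.
Qed.

(** Whether the generating functions decrease with the depth is not obvious, since
only finitely many children are explored.  Their upper limit inherits the recursion
all the same, because the right-hand sides are monotone. *)
Definition limsup u := inf (range (sups u)).

Lemma sups_cvg u c c' : (forall m, c' <= u m <= c) -> sups u @ \oo --> limsup u.
Proof.
move=> uc; apply: cvg_sups_inf.
  by exists c => _ [k _ <-]; have /andP[] := uc k.
by exists c' => _ [k _ <-]; have /andP[] := uc k.
Qed.

Lemma limsup_le_cvg u v n c c' l : (forall m, c' <= u m <= c) ->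
  (forall k, (n <= k)%N -> sups u k.+1 <= v k) -> v @ \oo --> l -> limsup u <= l.
Proof.
move=> uc uv vl.
have h := sups_cvg uc; rewrite -(cvg_shiftS (sups u)) in h.
rewrite -(cvg_lim _ h)// -(cvg_lim _ vl)//.
apply: ler_lim; [exact: cvgP h|exact: cvgP vl|].
by exists n => // k /= nk; exact: uv.
Qed.

End LimSup.

Section LimitPgf.
Variables (R : realType) (a pst di : R) (th : nat -> R) (b0 : nat) (th0 : R).
Hypothesis a01 : 0 < a < 1.
Hypothesis pst01 : 0 < pst < 1.
Hypothesis di01 : 0 <= di < 1.
Hypothesis th00 : 0 <= th0.
Hypothesis th01 : forall j, (1 <= j <= b0.+1)%N -> th0 <= th j <= 1.

Let a01' : 0 <= a <= 1. Proof. by have /andP[/ltW -> /ltW ->] := a01. Qed.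
Let pst01' : 0 <= pst <= 1. Proof. by have /andP[/ltW -> /ltW ->] := pst01. Qed.
Let di01' : 0 <= di <= 1. Proof. by have /andP[-> /ltW ->] := di01. Qed.

Let F n s := pgf a pst di th b0 n s.
Let F01 n s : 0 <= s <= 1 -> 0 <= F n s <= 1.
Proof. exact: (pgf_bounds a01' pst01' di01' th00 th01). Qed.

Let U s n := sups (F ^~ s) n.
Let L s := limsup (F ^~ s).
Let be := (1 - pst) * (1 - di).

Let FU s n m : 0 <= s <= 1 -> (n <= m)%N -> F m s <= U s n.
Proof.
by move=> s01; apply: le_sups => k; have /andP[_] := F01 k s01; exact.
Qed.

Let UL s : 0 <= s <= 1 -> U s @ \oo --> L s.
Proof. by move=> s01; apply: (@sups_cvg _ _ 1 0) => m; exact: F01. Qed.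

Let U01 s n : 0 <= s <= 1 -> 0 <= U s n <= 1.
Proof.
move=> s01; apply/andP; split.
  by apply: le_trans (FU s01 (leqnn n)); have /andP[] := F01 n s01.
by apply: sups_le => m _; have /andP[] := F01 m s01.
Qed.

Let L01 s : 0 <= s <= 1 -> 0 <= L s <= 1.
Proof.
move=> s01; have h := UL s01; rewrite -(cvg_lim _ h)//; apply/andP; split.
  by apply: limr_ge; [exact: cvgP h|apply: nearW => n; have /andP[] := U01 n s01].
by apply: limr_le; [exact: cvgP h|apply: nearW => n; have /andP[] := U01 n s01].
Qed.

Let limit_le s v l n : 0 <= s <= 1 ->
  (forall k, (n <= k)%N -> forall m, (k < m)%N -> F m s <= v k) -> v @ \oo --> l -> L s <= l.
Proof.
move=> s01 Fv; apply: (@limsup_le_cvg _ _ _ n 1 0) => [m|k nk]; first exact: F01.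
by apply: sups_le => m km; exact: Fv nk _ km.
Qed.

Definition defect (e : R) : R := 1 - L (1 - e).
Local Notation g := defect.

Let flip01 (e : R) : 0 <= e <= 1 -> 0 <= 1 - e <= 1.
Proof. by move=> /andP[? ?]; apply/andP; split; lra. Qed.

Lemma defect01 e : 0 <= e <= 1 -> 0 <= g e <= 1.
Proof. by move=> /flip01/L01/andP[? ?]; rewrite /g; apply/andP; split; lra. Qed.

Lemma defect_le e e' : 0 <= e -> e <= e' -> e' <= 1 -> g e <= g e'.
Proof.
move=> e0 ee' e'1; rewrite lerD2l lerN2.
have e01 : 0 <= 1 - e <= 1 by apply: flip01; rewrite e0 (le_trans ee').
have e'01 : 0 <= 1 - e' <= 1 by apply: flip01; rewrite (le_trans e0).
apply: (@limit_le _ (U (1 - e)) _ 0) => //; last exact: UL.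
move=> k _ m km; apply: le_trans (FU e01 (ltnW km)).
by apply: (pgf_le a01' pst01' di01' th00 th01); lra.
Qed.

Lemma defect_star t e : 0 <= t <= 1 -> 0 <= e <= 1 -> t * g e <= g (t * e).
Proof.
move=> t01 e01; suff : L (1 - t * e) <= t * L (1 - e) + (1 - t) by rewrite /g; lra.
have /andP[t0 t1] := t01; have /andP[e0 e1] := e01.
have te01 : 0 <= 1 - t * e <= 1.
  by apply: flip01; rewrite mulr_ge0//= mulr_ile1.
have s01 := flip01 e01.
apply: (@limit_le _ (fun n => t * U (1 - e) n + (1 - t)) _ 0) => //; last first.
  by apply: cvgD; [apply: cvgMr; exact: UL|exact: cvg_cst].
move=> k _ m km; have := pgf_star a01' pst01' di01' th00 th01 m t01 e01.
have : t * F m (1 - e) <= t * U (1 - e) k.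
  by apply: ler_wpM2l => //; apply: FU => //; exact: ltnW.
by rewrite /F; lra.
Qed.

Let sg_flip (e : R) : a * (1 - e) + 1 - a = 1 - a * e. Proof. by ring. Qed.

Let ae01 (e : R) : 0 <= e <= 1 -> 0 <= a * e <= 1.
Proof.
move=> /andP[e0 e1]; have /andP[a0 a1] := a01'.
by rewrite mulr_ge0//= mulr_ile1.
Qed.

(** The rate [be] is the chance that the frog of the top vertex enters a second
child subtree. *)
Lemma defect_zero_one e : 0 <= e <= 1 ->
  1 - g e <= (1 - g (a * e)) * (1 - be * g (a * e)).
Proof.
move=> e01; have s01 := flip01 e01; have sg01 := flip01 (ae01 e01).
have -> : 1 - g e = L (1 - e) by rewrite /g; ring.
have -> : 1 - g (a * e) = L (1 - a * e) by rewrite /g; ring.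
have -> : 1 - be * g (a * e) = 1 - be + be * L (1 - a * e) by rewrite /g; ring.
have /andP[p0 p1] := pst01'; have /andP[d0 d1] := di01'.
have be0 : 0 <= be by rewrite mulr_ge0 ?subr_ge0.
have be1 : be <= 1 by rewrite mulr_ile1 ?subr_ge0//; lra.
apply: (@limit_le _ (fun n => U (1 - a * e) n * (1 - be + be * U (1 - a * e) n)) _ 0) => //; last first.
  have h := UL sg01; apply: cvgM => //; apply: cvgD; first exact: cvg_cst.
  by apply: cvgMr.
move=> k _ [//|m] km.
have := pgf_zero_one a01' pst01' di01' th00 th01 m s01.
rewrite sg_flip; set G := pgf _ _ _ _ _ _ (1 - a * e); move/le_trans; apply.
have /andP[G0 G1] : 0 <= G <= 1 := F01 m sg01.
have GU : G <= U (1 - a * e) k by exact: FU.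
set V := U _ k in GU *.
have V0 : 0 <= V by lra.
apply: (@le_trans _ _ (G * (1 - be + be * G))); last first.
  by apply: ler_pM => //; [nra|nra].
apply: ler_wpM2l => //.
have -> : 1 - be + be * G = pst * 1 + (1 - pst) * (di + (1 - di) * G).
  by rewrite /be; ring.
by rewrite lerD2r ler_wpM2l//; lra.
Qed.

Lemma defect_lin e : 0 <= e <= 1 -> pst * e <= g e.
Proof.
move=> e01; have s01 := flip01 e01.
suff : L (1 - e) <= 1 - pst * e by rewrite /g; lra.
have /andP[p0 p1] := pst01'; have /andP[d0 d1] := di01'.
apply: (@limit_le _ (fun=> 1 - pst * e) _ 0) => //; last exact: cvg_cst.
move=> k _ [//|m] km.
have := pgf_zero_one a01' pst01' di01' th00 th01 m s01.
have sg01 := flip01 (ae01 e01).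
rewrite sg_flip; set G := pgf _ _ _ _ _ _ (1 - a * e); move/le_trans; apply.
have /andP[G0 G1] : 0 <= G <= 1 := F01 m sg01.
have h1 : di + (1 - di) * G <= 1 by nra.
have h2 : (1 - pst) * (di + (1 - di) * G) <= (1 - pst) * 1.
  by rewrite ler_wpM2l//; lra.
have h3 : 0 <= di + (1 - di) * G by nra.
have h4 : 0 <= (1 - pst) * (di + (1 - di) * G) by rewrite mulr_ge0//; lra.
have h5 : 0 <= pst * (1 - e) by rewrite mulr_ge0//; case/andP: s01.
have : G * (pst * (1 - e) + (1 - pst) * (di + (1 - di) * G)) <=
       1 * (pst * (1 - e) + (1 - pst) * (di + (1 - di) * G)).
  by rewrite ler_wpM2r//; lra.
by lra.
Qed.

(** The strict inequality on [b] leaves room to replace the upper limit by the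
generating functions at finite depth in the supermartingale condition. *)
Lemma defect_recursion b e de : b < (1 - a) * th0 -> 0 < e <= 1 -> 0 <= de <= 1 ->
  e <= a * de + b * g e ->
  g e + (1 - g e) * (pst * de + be * g e) - (1 - a * g de) ^+ b0.+2 <= g de.
Proof.
move=> bb /andP[e0 e1] de01 ed.
have e01 : 0 <= e <= 1 by rewrite e1 ltW.
have ge0 : 0 < g e.
  by apply: lt_le_trans (defect_lin e01); rewrite mulr_gt0//; case/andP: pst01.
have y01 := flip01 e01; have s01 := flip01 de01; have sg01 := flip01 (ae01 de01).
have /andP[p0 p1] := pst01'; have /andP[d0 d1] := di01'; have /andP[a0 a1] := a01'.
have star : a * g de <= g (a * de) by exact: defect_star.
have /andP[ga0 ga1] := defect01 (ae01 de01).
have pw : (1 - g (a * de)) ^+ b0.+2 <= (1 - a * g de) ^+ b0.+2.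
  by apply: lerXn2r; rewrite ?nnegrE; lra.
suff : L (1 - de) <= L (1 - e) * (pst * (1 - de) + (1 - pst) * (di + (1 - di) * L (1 - e)))
    + L (1 - a * de) ^+ b0.+2.
  have -> : L (1 - a * de) = 1 - g (a * de) by rewrite /g; ring.
  have -> : L (1 - e) = 1 - g e by rewrite /g; ring.
  have -> : L (1 - de) = 1 - g de by rewrite /g; ring.
  have -> : pst * (1 - de) + (1 - pst) * (di + (1 - di) * (1 - g e)) =
    1 - (pst * de + be * g e) by rewrite /be; ring.
  by lra.
have Uy := UL y01; have Usg := UL sg01.
have strict : a * (1 - de) + (1 - a) * (th0 * L (1 - e) + (1 - th0)) < 1 - e.
  have : b * g e < (1 - a) * th0 * g e by rewrite ltr_pM2r.
  have -> : L (1 - e) = 1 - g e by rewrite /g; ring.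
  lra.
have [n _ Hn] : \forall n \near \oo,
    a * (1 - de) + (1 - a) * (th0 * U (1 - e) n + (1 - th0)) < 1 - e.
  have cv : a * (1 - de) + (1 - a) * (th0 * U (1 - e) n + (1 - th0)) @[n --> \oo]
      --> a * (1 - de) + (1 - a) * (th0 * L (1 - e) + (1 - th0)).
    apply: cvgD; first exact: cvg_cst.
    by apply: cvgMr; apply: cvgD; [apply: cvgMr|exact: cvg_cst].
  by move/cvgr_lt : cv; exact.
apply: (@limit_le _ (fun n => U (1 - e) n * (pst * (1 - de) + (1 - pst) *
    (di + (1 - di) * U (1 - e) n)) + U (1 - a * de) n ^+ b0.+2) _ n) => //; last first.
  apply: cvgD; last first.
    exact: cvg_power Usg.
  apply: cvgM => //; apply: cvgD; first exact: cvg_cst.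
  apply: cvgMr; apply: cvgD; first exact: cvg_cst.
  by apply: cvgMr.
move=> k nk [//|m] km.
have Fy : F m (1 - e) <= U (1 - e) k by apply: FU.
have Fs : F m (1 - a * de) <= U (1 - a * de) k by apply: FU.
have cond : a * (1 - de) + (1 - a) * (th0 * F m (1 - e) + (1 - th0)) <= 1 - e.
  apply: le_trans (ltW (Hn k nk)); rewrite lerD2l; apply: ler_wpM2l; first lra.
  by rewrite lerD2r ler_wpM2l.
have := pgf_recursion a01' pst01' di01' th00 th01 s01 y01 cond.
rewrite sg_flip => /le_trans; apply.
rewrite -/(F m (1 - e)) -/(F m (1 - a * de)).
have /andP[F0 F1] := F01 m y01; have /andP[F0' F1'] := F01 m sg01.
apply: lerD; last by apply: lerXn2r; rewrite ?nnegrE// (le_trans F0').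
have s0 : 0 <= pst * (1 - de) by rewrite mulr_ge0//; case/andP: s01.
apply: ler_pM => //.
  by rewrite addr_ge0// mulr_ge0 ?subr_ge0// addr_ge0// mulr_ge0// subr_ge0.
by rewrite lerD2l ler_wpM2l ?subr_ge0// lerD2l ler_wpM2l// subr_ge0.
Qed.

(** If [g] does not vanish at 0, the infimum q of [g] on ]0, 1] is positive and
[defect_zero_one] gives q >= q + be q (1 - q), that is q = 1. *)
Lemma defect_dichotomy : 0 < be ->
  ~ (forall tau, 0 < tau -> exists de, 0 < de <= 1 /\ g de <= tau) ->
  forall s eta, 0 <= s < 1 -> 0 < eta -> exists n, F n s <= eta.
Proof.
move=> be0 nvan.
have [tau [tau0 gtau]] : exists tau, 0 < tau /\ forall de, 0 < de <= 1 -> tau < g de.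
  apply: contrapT => H; apply: nvan => tau t0; apply: contrapT => H'; apply: H.
  exists tau; split => // de de01; rewrite ltNge; apply/negP => gd.
  by apply: H'; exists de.
have be1 : be <= 1.
  have /andP[p0 p1] := pst01'; have /andP[d0 d1] := di01'.
  by rewrite mulr_ile1 ?subr_ge0//; lra.
have [q [qt qg qinf]] : exists q, [/\ tau <= q,
    forall de, 0 < de <= 1 -> q <= g de &
    forall c, (forall de, 0 < de <= 1 -> c <= g de) -> c <= q].
  have ne : [set g de | de in [set de | 0 < de <= 1]] !=set0.
    by exists (g 1); exists 1 => //=; rewrite ltr01 lexx.
  exists (inf [set g de | de in [set de | 0 < de <= 1]]); split.
  - by apply: lb_le_inf => // _ [de de01 <-]; exact: ltW (gtau _ de01).
  - move=> de de01; apply: ge_inf; last by exists de.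
    by exists tau => _ [de' de'01 <-]; exact: ltW (gtau _ de'01).
  - by move=> c cg; apply: lb_le_inf => // _ [de de01 <-]; exact: cg.
have gle1 de : 0 < de <= 1 -> g de <= 1.
  by move=> /andP[d0 d1]; have := @defect01 de; rewrite d1 (ltW d0) => /(_ isT)/andP[].
have q1 : q <= 1 by apply: le_trans (qg 1 _) (gle1 1 _); rewrite ltr01 lexx.
have step : q + be * q * (1 - q) <= q.
  apply: qinf => de /andP[d0 d1].
  have de01 : 0 <= de <= 1 by rewrite d1 ltW.
  have /andP[a0 a1] := a01.
  have ad : 0 < a * de <= 1 by rewrite mulr_gt0//= mulr_ile1// ltW.
  have := defect_zero_one de01.
  have h1 := qg _ ad; have h2 := gle1 _ ad.
  set u := g (a * de) in h1 h2 *.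
  have : (1 - u) * (1 - be * u) <= (1 - q) * (1 - be * q).
    apply: ler_pM; [lra| |lra|].
      have : be * u <= 1 * 1 by apply: ler_pM => //; [exact: ltW|lra].
      lra.
    by rewrite lerD2l lerN2 ler_pM2l.
  lra.
have qq : q = 1.
  apply/eqP; rewrite eq_le q1/= leNgt; apply/negP => q1'.
  have : 0 < be * q * (1 - q) by apply: mulr_gt0; [apply: mulr_gt0 => //|]; lra.
  lra.
move=> s eta /andP[s0 s1] eta0.
have s01 : 0 <= s <= 1 by rewrite s0 ltW.
have Ls : L s = 0.
  have := qg (1 - s); rewrite /g qq (_ : 1 - (1 - s) = s); last by ring.
  have /andP[L0 _] := L01 s01.
  by move=> H; have := H ltac:(lra); lra.
have /cvgrPdist_lt/(_ _ eta0)[n _ /(_ n (leqnn n))/=] := UL s01.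
rewrite Ls sub0r normrN => h; exists n.
by apply: le_trans (FU s01 (leqnn n)) (ltW (le_lt_trans (ler_norm _) h)).
Qed.

End LimitPgf.

(** * Divergence of the number of returns in large degree *)

Section LargeDegree.
Variable R : realType.

(** At [al = a] and [b = be = 1 - a] the form is
(1 - a) (x - e / 2) ^ 2 + (5 a - 1) / 4 e ^ 2, and a perturbation of size [k] costs at
most 5 / 2 k (x ^ 2 + e ^ 2). *)
Lemma quad_stable (a b al be k : R) : 1 / 5 < a < 1 -> 0 <= b <= 1 ->
  0 < k -> 5 * k <= 1 - a -> 30 * k <= 5 * a - 1 ->
  `|b - (1 - a)| <= k -> `|al - a| <= k -> `|be - (1 - a)| <= k ->
  forall x e, 0 <= x -> 0 <= e ->
  (5 * a - 1) / 8 * e ^+ 2 <=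
    b * x ^+ 2 - x * e * (1 - a - a * be + al * b) + al * e ^+ 2.
Proof.
move=> /andP[a5 a1] /andP[b0 b1] k0 k1 k2; rewrite !ler_norml.
move=> /andP[t1 t2] /andP[r1 r2] /andP[w1 w2] x e x0 e0.
pose D := a * (b - (1 - a)) + (al - a) * b - a * (be - (1 - a)).
have D1 : D <= 3 * k.
  have h1 : a * (b - (1 - a)) <= a * k by apply: ler_wpM2l => //; lra.
  have h2 : (al - a) * b <= k * b by apply: ler_wpM2r => //; lra.
  have h3 : a * - k <= a * (be - (1 - a)) by apply: ler_wpM2l => //; lra.
  have h4 : a * k <= 1 * k by apply: ler_wpM2r; lra.
  have h5 : k * b <= k * 1 by apply: ler_wpM2l; lra.
  by rewrite /D; lra.
have -> : b * x ^+ 2 - x * e * (1 - a - a * be + al * b) + al * e ^+ 2 =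
  (1 - a) * (x - e / 2) ^+ 2 + (5 * a - 1) / 4 * e ^+ 2
  + (b - (1 - a)) * x ^+ 2 - x * e * D + (al - a) * e ^+ 2.
  by rewrite /D; field.
have xe0 : 0 <= x * e by rewrite mulr_ge0.
have h1 : x * e * D <= x * e * (3 * k) by apply: ler_wpM2l.
have h2 : - k * x ^+ 2 <= (b - (1 - a)) * x ^+ 2.
  by apply: ler_wpM2r; [exact: sqr_ge0|lra].
have h3 : - k * e ^+ 2 <= (al - a) * e ^+ 2.
  by apply: ler_wpM2r; [exact: sqr_ge0|lra].
have h4 : k * (2 * (x * e)) <= k * (x ^+ 2 + e ^+ 2).
  apply: ler_wpM2l; first lra.
  by have := sqr_ge0 (x - e); lra.
have h5 : k * x ^+ 2 <= k * (2 * (x - e / 2) ^+ 2 + e ^+ 2 / 2).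
  apply: ler_wpM2l; first lra.
  by have := sqr_ge0 (x - e); lra.
have h6 : 5 * k * (x - e / 2) ^+ 2 <= (1 - a) * (x - e / 2) ^+ 2.
  by apply: ler_wpM2r; [exact: sqr_ge0|].
have h7 : 30 * k * e ^+ 2 <= (5 * a - 1) * e ^+ 2.
  by apply: ler_wpM2r; [exact: sqr_ge0|].
by lra.
Qed.

Lemma cvg_natV : (d%:R^-1 : R) @[d --> \oo] --> (0 : R).
Proof. by rewrite -(cvg_shiftS (fun d => d%:R^-1 : R)); exact: cvg_harmonic. Qed.

Lemma near_dist (f : nat -> R) (l k : R) : f @ \oo --> l -> 0 < k ->
  \forall d \near \oo, `|f d - l| <= k.
Proof.
move=> fl k0; move/cvgrPdist_le : fl => /(_ _ k0); apply: filterS => d.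
by rewrite distrC.
Qed.

Lemma fresh_rate_cvg j : fresh_rate R d j @[d --> \oo] --> (1 : R).
Proof.
have h : (1 - j%:R * d%:R^-1) / (1 - d%:R^-1) @[d --> \oo] --> ((1 - j%:R * 0) / (1 - 0) : R).
  apply: cvgM.
    by apply: cvgB; [exact: cvg_cst|apply: cvgMr; exact: cvg_natV].
  apply: cvgV; first by rewrite subr0.
  by apply: cvgB; [exact: cvg_cst|exact: cvg_natV].
rewrite mulr0 !subr0 divr1 in h; apply: cvg_trans h; apply: near_eq_cvg.
exists 2 => // d /= d2; rewrite /fresh_rate.
have d0 : (d%:R : R) != 0 by rewrite pnatr_eq0; lia.
have d1 : (d%:R - 1 : R) != 0 by rewrite subr_eq0 pnatr_eq1; lia.
have d3 : (1 - d%:R^-1 : R) != 0.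
  by rewrite subr_eq0 eq_sym invr_eq1 pnatr_eq1; lia.
by field; rewrite d0 d1.
Qed.

Lemma pstar_cvg (p : R) : 0 < p < 1 / 2 -> pstar d p @[d --> \oo] --> phat p.
Proof.
move=> /andP[p0 p2].
have h : p * (1 - d%:R^-1) / (1 - p - p * d%:R^-1) @[d --> \oo]
    --> (p * (1 - 0) / (1 - p - p * 0) : R).
  apply: cvgM.
    by apply: cvgMr; apply: cvgB; [exact: cvg_cst|exact: cvg_natV].
  apply: cvgV; first by rewrite mulr0 subr0; lra.
  by apply: cvgB; [exact: cvg_cst|apply: cvgMr; exact: cvg_natV].
rewrite mulr0 !subr0 mulr1 in h; apply: cvg_trans h; apply: near_eq_cvg.
exists 2 => // d /= d2; rewrite /pstar.
have d0 : (d%:R : R) != 0 by rewrite pnatr_eq0; lia.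
have d2' : (2 : R) <= d%:R by rewrite ler_nat.
have e1 : d%:R - (d%:R + 1) * p != 0 by rewrite gt_eqF//; nra.
have e2 : 1 - p - p / d%:R != 0.
  rewrite (_ : _ - _ = (d%:R - (d%:R + 1) * p) / d%:R); last by field.
  by rewrite mulf_neq0// invr_eq0.
by field; rewrite d0 e1 /=.
Qed.

Lemma pstar_bounds (d : nat) (p : R) : (2 <= d)%N -> 0 < p < 1 / 2 ->
  0 < pstar d p <= phat p.
Proof.
move=> d2 /andP[p0 p2]; rewrite /pstar /phat.
have d2' : (2 : R) <= d%:R by rewrite ler_nat.
have e1 : 0 < d%:R - (d%:R + 1) * p by nra.
apply/andP; split; first by apply: divr_gt0 => //; apply: mulr_gt0; lra.
rewrite ler_pdivrMr// mulrAC ler_pdivlMr; last lra.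
by rewrite -!mulrA ler_pM2l//; nra.
Qed.

Lemma phat_bounds (p : R) : 0 < p < 1 / 2 -> 0 < phat p < 1.
Proof.
move=> /andP[p0 p2]; rewrite /phat divr_gt0/=; [|lra|lra].
by rewrite ltr_pdivrMr; lra.
Qed.

(** The number of explored children is fixed before the degree is sent to infinity,
which makes exploring a fresh child almost certain. *)
Theorem returns_pgf_vanish (p : R) : 1 / 6 < p < 1 / 2 ->
  exists b0 : nat, \forall d \near \oo,
    (forall n, expectation
       (returns (phat p) (pstar d p) d%:R^-1 (fresh_rate R d) b0 n)) /\
    forall s eta, 0 <= s < 1 -> 0 < eta -> exists n,
      pgf (phat p) (pstar d p) d%:R^-1 (fresh_rate R d) b0 n s <= eta.
Proof.
move=> /andP[p6 p2]; have p01 : 0 < p < 1 / 2 by apply/andP; split => //; lra.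
have /andP[a0 a1] := phat_bounds p01; set a := phat p in a0 a1 *.
have a5 : 1 / 5 < a by rewrite /a /phat ltr_pdivlMr; lra.
have a01 : 0 < a < 1 by rewrite a0.
have c10 : 0 < (5 * a - 1) / 8 <= 1 by apply/andP; split; lra.
have [b0 main] := vanishing_contradiction a01 c10.
exists b0.
pose k := Num.min ((1 - a) / 5) ((5 * a - 1) / 30).
have k0 : 0 < k by rewrite lt_min !divr_gt0//; lra.
have k1 : k <= (1 - a) / 5 by rewrite ge_min lexx.
have k2 : k <= (5 * a - 1) / 30 by rewrite ge_min lexx orbT.
pose b d : R := (1 - a) * fresh_rate R d b0.+1 - d%:R^-1.
pose be d : R := (1 - pstar d p) * (1 - d%:R^-1).
have near_al : \forall d \near \oo, `|pstar d p - a| <= k.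
  by apply: near_dist => //; exact: pstar_cvg.
have near_be : \forall d \near \oo, `|be d - (1 - a)| <= k.
  apply: near_dist => //; rewrite -[1 - a]mulr1 -[X in _ * X](subr0 1).
  apply: cvgM; first by apply: cvgB; [exact: cvg_cst|exact: pstar_cvg].
  by apply: cvgB; [exact: cvg_cst|exact: cvg_natV].
have near_b : \forall d \near \oo, `|b d - (1 - a)| <= k.
  apply: near_dist => //; rewrite -[1 - a]mulr1 -[X in _ --> X]subr0.
  apply: cvgB; last exact: cvg_natV.
  by apply: cvgMr; exact: fresh_rate_cvg.
have near_d : \forall d \near \oo, (b0.+2 <= d)%N by exists b0.+2.
have [n _ near_n] := filterI near_d (filterI near_al (filterI near_be near_b)).
exists n => // d /near_n/=[b0d [Hal [Hbe Hb]]].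
have d2 : (2 <= d)%N by exact: leq_trans b0d.
have d2' : (2 : R) <= d%:R by rewrite ler_nat.
have di0 : 0 < (d%:R^-1 : R) by rewrite invr_gt0; lra.
have di1 : (d%:R^-1 : R) < 1 by rewrite invf_lt1; lra.
have di01 : 0 <= (d%:R^-1 : R) < 1 by rewrite ltW.
have /andP[pst0 psta] := pstar_bounds d2 p01.
have pst01 : 0 < pstar d p < 1 by rewrite pst0/= (le_lt_trans psta).
have b0d' : (b0.+2%:R : R) <= d%:R by rewrite ler_nat.
rewrite -natr1 in b0d'.
have dd : 0 < d%:R - 1 :> R by lra.
have th00 : 0 <= fresh_rate R d b0.+1 by apply: divr_ge0; lra.
have th01 j : (1 <= j <= b0.+1)%N -> fresh_rate R d b0.+1 <= fresh_rate R d j <= 1.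
  move=> /andP[j1 j2]; have j1' : (1 : R) <= j%:R by rewrite ler1n.
  have j2' : (j%:R : R) <= b0.+1%:R by rewrite ler_nat.
  rewrite /fresh_rate ler_pdivrMr// divfK ?gt_eqF//.
  by rewrite ler_pdivrMr//; apply/andP; split; lra.
have th1 : fresh_rate R d b0.+1 <= 1.
  by have /andP[] := th01 b0.+1 (ltac:(by rewrite leqnn)).
have bb : b d < (1 - a) * fresh_rate R d b0.+1 by rewrite /b; lra.
have b1 : b d <= 1.
  have : (1 - a) * fresh_rate R d b0.+1 <= 1 * 1 by apply: ler_pM; lra.
  by rewrite /b; lra.
have Hal' := Hal; have Hbe' := Hbe; have Hb' := Hb.
move: Hal' Hbe' Hb'; rewrite !ler_norml => /andP[al1 al2] /andP[be1 be2] /andP[bd1 bd2].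
have be0 : 0 < be d by lra.
have be1' : be d <= 1.
  by rewrite /be; apply: mulr_ile1; lra.
split.
  move=> m; apply: (expectation_returns _ _ _ th00 th01).
  - by rewrite (ltW a0) ltW.
  - by rewrite (ltW pst0) (le_trans psta)// ltW.
  - by rewrite (ltW di0) ltW.
move=> s eta s01 eta0.
apply: (defect_dichotomy a01 pst01 di01 th00 th01 be0) => //.
apply: (main (b d) (pstar d p) (be d)).
- by apply/andP; split => //; lra.
- by apply/andP; split; lra.
- by rewrite be1' ltW.
- apply: (@quad_stable a _ _ _ k) => //; [by rewrite a5|by apply/andP; split => //; lra|lra|lra].
- exact: (defect01 a01 pst01 di01 th00 th01).
- exact: (defect_le a01 pst01 di01 th00 th01).
- exact: (defect_star a01 pst01 di01 th00 th01).
- exact: (defect_lin a01 pst01 di01 th00 th01).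
- by move=> e de; exact: (defect_recursion a01 pst01 di01 th00 th01).
Qed.

End LargeDegree.

(** * Tree geometry, step probabilities and cylinder events *)

Section Tree.
Variable d : nat.
Implicit Types (u v w z : vertex d) (i j : 'I_d).

Lemma is_parent_cons i u : is_parent u (i :: u).
Proof. by rewrite /is_parent/= eqxx. Qed.

Lemma is_parent_consF i u : is_parent (i :: u) u = false.
Proof.
apply/negbTE; rewrite negb_and; apply/orP; right.
by apply/eqP => /(congr1 size); rewrite size_behead /=; lia.
Qed.

Lemma is_parent_consE u w : is_parent u w -> exists i, w = i :: u.
Proof. by case: w => [|i w] // /eqP ->; exists i. Qed.

Lemma suffix_cons_inj i j v z : suffix (i :: v) z -> suffix (j :: v) z -> i = j.
Proof.
move=> /suffixP[a ->] /suffixP[b]; move/(congr1 rev); rewrite !rev_cat !rev_cons.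
rewrite !cat_rcons; move/eqP; rewrite eqseq_cat// => /andP[_ /eqP].
by case.
Qed.

Lemma suffix_behead i v z : suffix (i :: v) z -> suffix v z.
Proof. by move=> /suffixP[a ->]; apply/suffixP; exists (rcons a i); rewrite cat_rcons. Qed.

Lemma suffix_consN i v : ~~ suffix (i :: v) v.
Proof. by apply/negP => /size_suffix/=; rewrite ltnn. Qed.

Definition children u : seq (vertex d) := [seq i :: u | i <- enum 'I_d].

Lemma childrenP u w : reflect (exists i, w = i :: u) (w \in children u).
Proof.
apply: (iffP mapP) => [[i _ ->]|[i ->]]; first by exists i.
by exists i => //; rewrite mem_enum.
Qed.

Lemma children_uniq u : uniq (children u).
Proof. by rewrite map_inj_uniq ?enum_uniq// => i j []. Qed.

Lemma behead_children u : behead u \notin children u.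
Proof. by apply/childrenP => -[i] /(congr1 size)/=; rewrite size_behead; lia. Qed.

Lemma sum_children (V : nmodType) u (F : vertex d -> V) :
  \sum_(w <- children u) F w = \sum_(i < d) F (i :: u).
Proof. by rewrite big_map big_enum. Qed.

End Tree.

Section PathProb.
Variables (R : realType) (d : nat) (p : R).
Implicit Types (u v w : vertex d) (s : seq (vertex d)).

(** Probability of the next position of a frog whose path so far is [v :: s]. *)
Definition step_prob v s w : R :=
  if s is [::] then first_step p v w
  else next_step p (last v (belast v s)) (last v s) w.

Lemma continuation_prob_rcons t u s w : continuation_prob p t u (rcons s w) =
  continuation_prob p t u s * next_step p (last t (belast u s)) (last u s) w.
Proof.
elim: s t u => [|x s IHs] t u /=; first by rewrite mul1r mulr1.
by rewrite IHs mulrA.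
Qed.

Lemma path_prob_rcons v s w :
  path_prob p v (rcons s w) = path_prob p v s * step_prob v s w.
Proof.
case: s => [|x s] /=; first by rewrite mul1r mulr1.
by rewrite continuation_prob_rcons mulrA.
Qed.

Lemma step_prob_ends v s r t u w : v :: s = rcons (rcons r t) u ->
  step_prob v s w = next_step p t u w.
Proof.
case: s => [|x s] /=; first by case: r => [|? [|? ?]].
move=> E; have : rcons (belast v (x :: s)) (last v (x :: s)) = rcons (rcons r t) u.
  by rewrite -lastI.
move=> /rcons_inj[E1 E2]; rewrite /= in E2; rewrite E2 /=.
by move: E1 => /= /(congr1 (last v)); rewrite last_rcons /= => ->.
Qed.

Lemma next_step_down i u j : next_step p u (i :: u) (j :: i :: u) = d%:R^-1.
Proof. by rewrite /next_step/= is_parent_consF is_parent_cons is_parent_cons. Qed.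

Lemma next_step_up_parent i j u : next_step p (i :: j :: u) (j :: u) u = phat p.
Proof. by rewrite /next_step/= !is_parent_cons. Qed.

Lemma next_step_up_child i j k u : next_step p (i :: j :: u) (j :: u) (k :: j :: u) =
  if k == i then 0 else (1 - phat p) / (d%:R - 1).
Proof.
rewrite /next_step/= !is_parent_cons is_parent_consF /= eqseq_cons eqxx andbT.
by case: eqP.
Qed.

Lemma first_step_parent j u : first_step p (j :: u) u = pstar d p.
Proof. by rewrite /first_step/= is_parent_cons. Qed.

Lemma first_step_child i j u :
  first_step p (j :: u) (i :: j :: u) = (1 - pstar d p) / d%:R.
Proof. by rewrite /first_step/= is_parent_consF is_parent_cons. Qed.

Lemma first_step_root i : first_step p [::] ([:: i] : vertex d) = d%:R^-1.
Proof. by []. Qed.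

End PathProb.

Section SplitValues.
Context (R : realType) (disp : measure_display) (Omega : measurableType disp).
Context (P : probability Omega R) (T : eqType).
Local Open Scope ereal_scope.

Lemma measurable_values (Y : Omega -> T) (W : seq T) :
  (forall w, measurable [set x | Y x = w]) -> measurable [set x | Y x \in W].
Proof.
move=> mY; rewrite (_ : [set x | _] = \bigcup_(w in [set` W]) [set x | Y x = w]).
  by apply: fin_bigcup_measurable.
apply/seteqP; split => x /=; first by move=> xW; exists (Y x).
by move=> [w' w'W ->].
Qed.

Lemma split_values (B : set Omega) (Y : Omega -> T) (W : seq T) :
  measurable B -> (forall w, measurable [set x | Y x = w]) -> uniq W ->
  P (B `&` [set x | Y x \in W]) = \sum_(w <- W) P (B `&` [set x | Y x = w]).
Proof.
move=> mB mY; elim: W => [|w W IHW].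
  rewrite big_nil (_ : _ `&` _ = set0) ?measure0// -subset0 => x [_].
  by rewrite /= in_nil.
move=> /= /andP[wW uW]; rewrite big_cons -IHW//.
have mW := measurable_values W mY.
rewrite -measureU; [|exact: measurableI|exact: measurableI|].
  congr (P _); apply/seteqP; split => x /=.
    by move=> [Bx]; rewrite inE => /orP[/eqP|]; [left|right].
  by move=> [[Bx ->]|[Bx xW]]; split => //; rewrite inE ?eqxx// xW orbT.
rewrite -subset0 => x [[_ /= Yx] [_ /= xW]].
by move: wW; rewrite -Yx xW.
Qed.

(** Total probability over the values of a discrete random variable. *)
Lemma split_almost_all (B : set Omega) (Y : Omega -> T) (W : seq T) :
  measurable B -> (forall w, measurable [set x | Y x = w]) -> uniq W ->
  P (~` [set x | Y x \in W]) = 0 ->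
  P B = \sum_(w <- W) P (B `&` [set x | Y x = w]).
Proof.
move=> mB mY uW W0; rewrite -split_values//.
have mW := measurable_values W mY.
have mBD : measurable (B `\` [set x | Y x \in W]) by exact: measurableD.
have BD0 : P (B `\` [set x | Y x \in W]) = 0.
  apply/eqP; rewrite eq_le measure_ge0 andbT -W0.
  by apply: le_measure; rewrite ?inE; [exact: mBD|exact: measurableC|move=> x []].
have {1}-> : B = (B `\` [set x | Y x \in W]) `|` (B `&` [set x | Y x \in W]).
  by rewrite setUC setUIDK.
rewrite measureU//.
- by rewrite [X in X + _]BD0 add0e.
- exact: measurableI.
- by rewrite setDE setIACA setICl setI0.
Qed.

End SplitValues.

Section Cylinders.
Variables (d : nat).
Variables (disp : measure_display) (Omega : measurableType disp).
Variable X : vertex d -> nat -> Omega -> vertex d.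
Hypothesis mX : forall v n u, measurable (X v n @^-1` [set u]).
Implicit Types (u v w z : vertex d) (h : vertex d -> seq (vertex d)).

Definition cylinder (J : seq (vertex d)) h : set Omega :=
  [set x | forall u, u \in J -> mkseq (fun k => X u k x) (size (h u)).+1 = u :: h u].

Lemma cylinderE J h : cylinder J h = \bigcap_(u in [set` J])
  [set x | mkseq (fun k => X u k x) (size (h u)).+1 = u :: h u].
Proof. by []. Qed.

Lemma prefix_sigma v n s :
  path_sigma X v [set x | mkseq (fun k => X v k x) n = s].
Proof.
rewrite /path_sigma; set G := [set A | _].
elim: n s => [|n IHn] s.
  case: (s =P [::]) => [->|sn].
    rewrite (_ : [set x | _] = setT); last by rewrite -subTset.
    exact: (@measurableT _ (g_sigma_algebraType G)).
  rewrite (_ : [set x | _] = set0); last by rewrite -subset0 => x /esym.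
  exact: (@measurable0 _ (g_sigma_algebraType G)).
case: (lastP s) => [|s' w].
  rewrite (_ : [set x | _] = set0); last by rewrite -subset0 => x.
  exact: (@measurable0 _ (g_sigma_algebraType G)).
rewrite (_ : [set x | _] = [set x | mkseq (fun k => X v k x) n = s'] `&`
    [set x | X v n x = w]).
  apply: (@measurableI _ (g_sigma_algebraType G)); first exact: IHn.
  by apply: sub_sigma_algebra; exists n, w.
apply/seteqP; split=> x /=; rewrite mkseqS.
  by move=> /rcons_inj[].
by move=> [-> ->].
Qed.

Lemma path_sigma_measurable v : path_sigma X v `<=` measurable.
Proof.
apply: smallest_sub; first exact: sigma_algebra_measurable.
by move=> A [k [u ->]]; exact: mX.
Qed.

Lemma measurable_prefix v n s :
  measurable [set x | mkseq (fun k => X v k x) n = s].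
Proof.
by apply: (@path_sigma_measurable v); exact: prefix_sigma.
Qed.

Lemma measurable_cylinder J h : measurable (cylinder J h).
Proof.
rewrite cylinderE; apply: fin_bigcap_measurable => // u _.
exact: measurable_prefix.
Qed.

End Cylinders.

Section Probabilities.
Variables (R : realType) (d : nat) (p : R).
Variables (disp : measure_display) (Omega : measurableType disp).
Variables (P : probability Omega R) (X : vertex d -> nat -> Omega -> vertex d).
Hypothesis HX : is_nbFM p P X.
Implicit Types (u v w z : vertex d) (h : vertex d -> seq (vertex d)).

Local Open Scope ereal_scope.

Lemma measurable_position v n u : measurable [set x | X v n x = u].
Proof. by have [mX _ _] := HX; have := mX v n u. Qed.

Let mX : forall v n u, measurable (X v n @^-1` [set u]).
Proof. by have [] := HX. Qed.

Definition weight (J : seq (vertex d)) h : R := (\prod_(u <- J) path_prob p u (h u))%R.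

Lemma probability_cylinder J h : uniq J -> P (cylinder X J h) = (weight J h)%:E.
Proof.
move=> uJ; have [_ cyl ind] := HX; rewrite cylinderE.
rewrite (ind J (fun u => [set x | mkseq (fun k => X u k x) (size (h u)).+1 = u :: h u]) uJ); last first.
  by move=> v vJ; exact: prefix_sigma.
rewrite /weight -prodEFin; apply: eq_bigr => u _; exact: cyl.
Qed.

Lemma weight_ge0 J h : uniq J -> (0 <= weight J h)%R.
Proof. by move=> uJ; rewrite -lee_fin -(probability_cylinder h uJ). Qed.

Lemma start_as v : P [set x | X v 0 x <> v] = 0.
Proof.
have [_ cyl _] := HX.
rewrite (_ : [set x | _] = ~` [set x | X v 0%N x = v])//.
rewrite probability_setC; last exact: measurable_position.
have := cyl v [::]; rewrite /= (_ : [set x | _] = [set x | X v 0%N x = v]).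
  by move=> ->; rewrite subee.
by apply/seteqP; split => x /=; rewrite /mkseq /=; [case|move=> ->].
Qed.

Definition upd h u w : vertex d -> seq (vertex d) :=
  fun z => if z == u then rcons (h z) w else h z.

Lemma cylinder_upd J h u w : u \in J ->
  cylinder X J (upd h u w) = cylinder X J h `&` [set x | X u (size (h u)).+1 x = w].
Proof.
move=> uJ; apply/seteqP; split => x /=.
  move=> H; split.
    move=> z zJ; have := H z zJ; rewrite /upd; case: eqP => // ->.
    by rewrite size_rcons mkseqS -rcons_cons => /rcons_inj/(congr1 fst).
  have := H u uJ; rewrite /upd eqxx size_rcons mkseqS -rcons_cons.
  by move=> /rcons_inj/(congr1 snd).
move=> [H Hw] z zJ; rewrite /upd; case: eqP => [->|_]; last exact: H.
by rewrite size_rcons mkseqS Hw H.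
Qed.

Lemma weight_upd J h u w : uniq J -> u \in J ->
  weight J (upd h u w) = (weight J h * step_prob p u (h u) w)%R.
Proof.
move=> uJ iuJ; rewrite /weight (bigD1_seq u)//= [in RHS](bigD1_seq u)//=.
rewrite /upd eqxx path_prob_rcons -!mulrA; congr (_ * _)%R.
rewrite mulrC; congr (_ * _)%R.
by apply: eq_bigr => z /negbTE ->.
Qed.

(** The steps listed by [h] being known, the conditional probability of [E] is at
most [beta].  The quantification over [J] makes the notion independent of the finite
set of frogs used to express that knowledge. *)
Definition bounded_in (E : set Omega) h (beta : R) : Prop :=
  forall J, uniq J -> (forall u, h u <> [::] -> u \in J) ->
  P (cylinder X J h `&` E) <= (beta * weight J h)%:E.

Lemma bounded_in_nil E beta : bounded_in E (fun=> [::]) beta -> P E <= beta%:E.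
Proof.
move=> /(_ [::] isT); rewrite /weight big_nil mulr1.
rewrite (_ : cylinder X [::] _ = setT) ?setTI; first by apply => u; case.
by apply/seteqP; split => // x _ u.
Qed.

Lemma bounded_in1 E h : measurable E -> bounded_in E h 1.
Proof.
move=> mE J uJ hJ; rewrite mul1r -probability_cylinder//.
by apply: le_measure; rewrite ?inE//; [apply: measurableI => //|]; exact: measurable_cylinder mX _ _.
Qed.

(** One more step of the frog [u] is revealed.  Iterating this lemma turns any
adaptive exploration of the frog paths into a bound on the probability of [E], with
no appeal to conditional expectations. *)
Lemma bounded_in_step E h u (W : seq (vertex d)) (pr f : vertex d -> R) :
  measurable E -> uniq W ->
  (forall w, w \in W -> step_prob p u (h u) w = pr w) ->
  (\sum_(w <- W) pr w = 1)%R ->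
  (forall w, w \in W -> bounded_in E (upd h u w) (f w)) ->
  bounded_in E h (\sum_(w <- W) pr w * f w)%R.
Proof.
move=> mE uW Wpr pr1 Hf.
suff main J : uniq J -> (forall u, h u <> [::] -> u \in J) -> u \in J ->
    P (cylinder X J h `&` E) <= ((\sum_(w <- W) pr w * f w) * weight J h)%:E.
  move=> J uJ hJ; have [uJ'|uJ'] := boolP (u \in J); first exact: main.
  (* Adding u to J costs the null event that the frog u does not start at u. *)
  have hu : h u = [::] by apply: contrapT => /hJ; rewrite (negbTE uJ').
  have := main (u :: J); rewrite /= uJ' uJ /= => /(_ isT).
  rewrite (_ : weight (u :: J) h = weight J h); last first.
    by rewrite /weight big_cons hu /= mul1r.
  have hJ' z : h z <> [::] -> z \in u :: J.
    by move=> /hJ zJ; rewrite inE zJ orbT.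
  move=> /(_ hJ' (mem_head _ _)); apply: le_trans.
  have mC K := measurable_cylinder mX K h.
  have mN : measurable [set x | X u 0%N x <> u].
    by apply: measurableC; exact: measurable_position.
  rewrite -[leRHS]adde0 -(start_as u).
  apply: (@le_trans _ _ (P ((cylinder X (u :: J) h `&` E) `|` [set x | X u 0%N x <> u]))).
    apply: le_measure; rewrite ?inE; [exact: measurableI|apply: measurableU => //; exact: measurableI|].
    move=> x [Cx Ex]; have [xu|xu] := pselect (X u 0%N x = u); [left|by right].
    split => // z; rewrite inE => /orP[/eqP ->|]; last exact: Cx.
    by rewrite hu /mkseq /= xu.
  by apply: measureU2 => //; exact: measurableI.
move=> uJ hJ iuJ.
have mC := measurable_cylinder mX J h.
set Y := X u (size (h u)).+1.
have mY w : measurable [set x | Y x = w] by exact: measurable_position.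
have mW := measurable_values W mY.
(* As the probabilities sum to 1 over W, steps outside W are negligible. *)
have null : P (cylinder X J h `\` [set x | Y x \in W]) = 0.
  have : P (cylinder X J h `&` [set x | Y x \in W]) = P (cylinder X J h).
    rewrite split_values//; under eq_big_seq => w wW.
      rewrite -cylinder_upd// probability_cylinder// weight_upd// Wpr//; over.
    by rewrite sumEFin -mulr_sumr pr1 mulr1 probability_cylinder.
  have fin : P (cylinder X J h) \is a fin_num by rewrite fin_num_measure.
  move=> H; rewrite measureD//; first by rewrite [X in _ - X]H subee.
  by rewrite ltey_eq fin.
apply: (@le_trans _ _ (P ((cylinder X J h `&` E) `&` [set x | Y x \in W]) +
    P (cylinder X J h `\` [set x | Y x \in W]))).
  apply: (@le_trans _ _ (P (((cylinder X J h `&` E) `&` [set x | Y x \in W]) `|`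
     (cylinder X J h `\` [set x | Y x \in W])))).
    apply: le_measure; rewrite ?inE; first exact: measurableI.
      by apply: measurableU; [do 2 apply: measurableI => //|exact: measurableD].
    move=> x [Cx Ex]; have [xW|xW] := boolP (Y x \in W).
      by left.
    by right; split => //=; apply/negP.
  by apply: measureU2; [do 2 apply: measurableI => //|exact: measurableD].
rewrite null adde0 split_values//; last exact: measurableI.
rewrite mulr_suml -sumEFin big_seq [leRHS]big_seq; apply: lee_sum => w wW.
rewrite setIAC -cylinder_upd//.
apply: le_trans (Hf w wW J uJ _) _.
  by move=> z; rewrite /upd; case: eqP => [->|_ /hJ].
by rewrite weight_upd// Wpr// lee_fin mulrCA mulrA mulrAC [(_ * weight _ _)%R]mulrC mulrA.
Qed.

End Probabilities.

(** * Exploring the frogs of a subtree *)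

Section Activation.
Variables (d : nat) (x : vertex d -> nat -> vertex d).
Implicit Types (u v z : vertex d).

Definition active v : Prop := exists t, age x t v = Some 0%N.

Lemma age_add t v a k : age x t v = Some a -> age x (k + t) v = Some (k + a)%N.
Proof. by move=> tv; elim: k => [|k IHk] //=; rewrite IHk. Qed.

Lemma age_active t v a : age x t v = Some a -> active v.
Proof.
elim: t a => [|t IHt] a /=.
  by case: ifP => [/eqP -> _|//]; exists 0%N.
case E: (age x t v) => [b|]; first by move=> _; exact: IHt E.
by case: ifP => // H _; exists t.+1; rewrite /= E H.
Qed.

Lemma active_root : active [::].
Proof. by exists 0%N. Qed.

Lemma active_visited u a : active u -> active (x u a.+1).
Proof.
move=> [t /(age_add a)]; rewrite addn0 => ua.
have H : `[< exists u' a', age x (a + t) u' = Some a' /\ x u' a'.+1 = x u a.+1 >].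
  by apply/asboolP; exists u, a.
case E: (age x (a + t) (x u a.+1)) => [b|]; first exact: age_active E.
by exists (a + t).+1; rewrite /= E H.
Qed.

Lemma active_root_move u a : active u -> x u a <> root_vertex ->
  x u a.+1 = root_vertex -> exists t, root_moves x (u, t).
Proof.
move=> [t /(age_add a)]; rewrite addn0 => ua xa xa1.
by exists (a + t)%N; exists a.
Qed.

End Activation.

Section Histories.
Variable d : nat.
Implicit Types (u v w z : vertex d) (h : vertex d -> seq (vertex d)).

Definition compatible (x : vertex d -> nat -> vertex d) h : Prop :=
  forall u, mkseq (x u) (size (h u)).+1 = u :: h u.

(** The steps in [h] force the frog of [v] to be activated at some time, whatever
the order in which they are taken.  The exploration can therefore ignore time. *)
Definition known_active h v : Prop := forall x, compatible x h -> active x v.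

Definition extends h h' : Prop := forall u, prefix (h u) (h' u).

Definition ends h z t u : Prop := exists r, z :: h z = rcons (rcons r t) u.

Lemma compatible_extends x h h' : extends h h' -> compatible x h' -> compatible x h.
Proof.
move=> hh' xh' u; have /prefixP[r E] := hh' u.
have := congr1 (take (size (h u)).+1) (xh' u); rewrite E -cat_cons take_size_cat// => <-.
rewrite /mkseq -map_take take_iota size_cat (minn_idPl _)//.
by rewrite ltnS leq_addr.
Qed.

Lemma known_active_extends h h' v : extends h h' -> known_active h v -> known_active h' v.
Proof. by move=> hh' hv x /(compatible_extends hh')/hv. Qed.

Lemma extends_refl h : extends h h.
Proof. by move=> u; exact: prefix_refl. Qed.

Lemma extends_trans h1 h2 h3 : extends h1 h2 -> extends h2 h3 -> extends h1 h3.
Proof. by move=> h12 h23 u; exact: prefix_trans (h12 u) (h23 u). Qed.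

Lemma extends_upd h u w : extends h (upd h u w).
Proof. by move=> z; rewrite /upd; case: eqP => _; [exact: prefix_rcons|exact: prefix_refl]. Qed.

Lemma compatible_nth x h u k : compatible x h -> (k <= size (h u))%N ->
  x u k = nth u (u :: h u) k.
Proof. by move=> xh ku; rewrite -(xh u) nth_mkseq. Qed.

Lemma known_active_visited h u v : known_active h u -> v \in h u -> known_active h v.
Proof.
move=> hu vu x xh; have uact := hu _ xh.
have := compatible_nth xh (_ : ((index v (h u)).+1 <= size (h u))%N).
rewrite index_mem vu => /(_ isT) /=; rewrite nth_index// => <-.
exact: active_visited.
Qed.

Lemma ends_upd h z t u w : ends h z t u -> ends (upd h z w) z u w.
Proof. by move=> [r E]; exists (rcons r t); rewrite /upd eqxx -rcons_cons E. Qed.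

Lemma ends_new h z w : h z = [::] -> ends (upd h z w) z z w.
Proof. by move=> hz; exists [::]; rewrite /upd eqxx hz. Qed.

Lemma ends_eq h h' z t u : h' z = h z -> ends h z t u -> ends h' z t u.
Proof. by move=> E; rewrite /ends E. Qed.

Lemma ends_nil h z t u : ends h z t u -> h z <> [::].
Proof. by move=> [r E] hz; move: E; rewrite hz; case: r => [|? [|? ?]]. Qed.

Lemma ends_mem h z t u : ends h z t u -> u \in h z.
Proof.
move=> E; have := ends_nil E; case: E => r; case: (lastP (h z)) => // s w.
by rewrite -rcons_cons => /rcons_inj[_ ->] _; rewrite mem_rcons mem_head.
Qed.

Lemma upd_neq h z u w : z != u -> upd h u w z = h z.
Proof. by rewrite /upd => /negbTE ->. Qed.

Definition arrivals v0 v h (A : seq (vertex d)) : Prop :=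
  uniq A /\ forall z, z \in A -> [/\ suffix v z, known_active h z & ends h z v v0].

End Histories.

Section Exploration.
Variables (R : realType) (d : nat) (p : R).
Variables (disp : measure_display) (Omega : measurableType disp).
Variables (P : probability Omega R) (X : vertex d -> nat -> Omega -> vertex d).
Hypothesis HX : is_nbFM p P X.
Hypothesis d2 : (2 <= d)%N.
Variable E : set Omega.
Hypothesis mE : measurable E.
Variable b0 : nat.
Implicit Types (u v w z : vertex d) (h : vertex d -> seq (vertex d)).

Let ret := returns (phat p) (pstar d p) (d%:R^-1) (fresh_rate R d) b0.

Let d0 : (d%:R : R) != 0. Proof. by rewrite pnatr_eq0; case: d d2. Qed.
Let d1 : (d%:R - 1 : R) != 0.
Proof. by rewrite subr_eq0 pnatr_eq1; case: d d2 => [|[]]. Qed.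

Let bnd h (b : R) := bounded_in p P X E h b.

Lemma bounded_child h z v b :
  (forall j : 'I_d, step_prob p z (h z) (j :: v) = d%:R^-1) ->
  (forall j, bnd (upd h z (j :: v)) b) -> bnd h b.
Proof.
move=> pr H.
have -> : b = \sum_(w <- children v) d%:R^-1 * b.
  by rewrite sum_children sumr_const card_ord -[RHS]mulr_natl mulrA divff// mul1r.
apply: (bounded_in_step HX mE (u := z) (children_uniq _) (pr := fun=> d%:R^-1)).
- by move=> w /childrenP[j ->].
- by rewrite sum_children sumr_const card_ord -[LHS]mulr_natl divff.
- by move=> w /childrenP[j ->]; exact: H.
Qed.

Lemma bounded_down h z i v b : ends h z v (i :: v) ->
  (forall j, bnd (upd h z (j :: i :: v)) b) -> bnd h b.
Proof.
move=> [r Ez]; apply: bounded_child => j.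
by rewrite (step_prob_ends _ _ Ez); exact: next_step_down.
Qed.

(** A particle that has come up from the child [i] chooses between the parent, the
other explored children (a lost particle) and the unexplored ones. *)
Lemma bounded_up h z i j v (J : seq 'I_d) b0' b1 b2 :
  ends h z (i :: j :: v) (j :: v) -> uniq J -> i \in J ->
  bnd (upd h z v) b0' ->
  (forall k, k \in J -> bnd (upd h z (k :: j :: v)) b1) ->
  (forall k, k \notin J -> bnd (upd h z (k :: j :: v)) b2) ->
  bnd h (phat p * b0' + (1 - phat p) *
    (fresh_rate R d (size J) * b2 + (1 - fresh_rate R d (size J)) * b1)).
Proof.
move=> [r Ez] uJ iJ Hup Hold Hnew.
pose rho := (1 - phat p) / (d%:R - 1).
pose pr w : R := if w == v then phat p else if w == i :: j :: v then 0 else rho.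
pose f w : R := if w == v then b0' else if head i w \in J then b1 else b2.
have vneq k : (k :: j :: v == v) = false.
  by apply/eqP => /(congr1 size)/=; lia.
have sumE (F : vertex d -> R) : \sum_(w <- v :: children (j :: v)) F w =
    F v + \sum_(k < d) F (k :: j :: v) by rewrite big_cons sum_children.
have prE k : pr (k :: j :: v) = if k == i then 0 else rho.
  by rewrite /pr vneq eqseq_cons eqxx andbT.
have fE k : f (k :: j :: v) = if k \in J then b1 else b2 by rewrite /f vneq.
have split_sum (c1 c2 : R) : \sum_(k < d) (if k == i then 0 else rho) * (if k \in J then c1 else c2)
    = rho * ((size J)%:R - 1) * c1 + rho * (d%:R - (size J)%:R) * c2.
  rewrite (bigID (mem J))/=.
  have -> : \sum_(k < d | k \in J) (if k == i then 0 else rho) * (if k \in J then c1 else c2)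
      = rho * ((size J)%:R - 1) * c1.
    rewrite (bigD1 i)//= eqxx mul0r add0r.
    rewrite (eq_bigr (fun=> rho * c1)); last by move=> k /andP[-> /negbTE ->].
    rewrite sumr_const -[LHS]mulr_natl.
    have -> : #|[pred k | (k \in J) && (k != i)]| = (size J).-1.
      rewrite -(card_uniqP uJ) (cardD1 i [in J]) iJ /=.
      by apply: eq_card => k; rewrite !inE andbC.
    have -> : ((size J).-1%:R : R) = (size J)%:R - 1.
      by case: (J) iJ => //= ? ? _; rewrite -natr1; ring.
    by ring.
  have -> : \sum_(k < d | k \notin J) (if k == i then 0 else rho) * (if k \in J then c1 else c2)
      = rho * (d%:R - (size J)%:R) * c2.
    rewrite (eq_bigr (fun=> rho * c2)); last first.
      move=> k kJ; rewrite (negbTE kJ); case: eqP => // ki.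
      by move: kJ; rewrite ki iJ.
    rewrite sumr_const -[LHS]mulr_natl.
    have -> : #|[pred k | k \notin J]| = (d - size J)%N.
      have := cardC [in J]; rewrite (card_uniqP uJ) card_ord => Jd.
      transitivity (size J + #|[predC [in J]]| - size J)%N; last by rewrite Jd.
      by rewrite addKn; apply: eq_card => k; rewrite !inE.
    have leJ : (size J <= d)%N.
      by rewrite -(card_uniqP uJ); apply: leq_trans (max_card _) _; rewrite card_ord.
    rewrite natrB//.
    by ring.
  by [].
have -> : phat p * b0' + (1 - phat p) *
    (fresh_rate R d (size J) * b2 + (1 - fresh_rate R d (size J)) * b1)
    = \sum_(w <- v :: children (j :: v)) pr w * f w.
  rewrite sumE {1}/pr {1}/f eqxx; congr (_ + _).
  under eq_bigr do rewrite prE fE.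
  by rewrite split_sum /rho /fresh_rate; field.
apply: (bounded_in_step HX mE (u := z)).
- by rewrite /= children_uniq andbT; exact: (behead_children (j :: v)).
- move=> w; rewrite inE => /orP[/eqP ->|/childrenP[k ->]].
    rewrite (step_prob_ends _ _ Ez) /pr eqxx; exact: next_step_up_parent.
  rewrite (step_prob_ends _ _ Ez) prE; exact: next_step_up_child.
- rewrite sumE {1}/pr eqxx.
  transitivity (phat p + \sum_(k < d) (if k == i then 0 else rho) * (if k \in J then 1 else 1)).
    by congr (_ + _); apply: eq_bigr => k _; rewrite prE; case: (k \in J); rewrite mulr1.
  by rewrite split_sum /rho; field.
- move=> w; rewrite inE => /orP[/eqP ->|/childrenP[k ->]].
    by rewrite /f eqxx.
  by rewrite fE; case: ifPn => kJ; [exact: Hold|exact: Hnew].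
Qed.

(** First step of the frog of a vertex whose child [i] has been explored. *)
Lemma bounded_new h j v i b1 b2 b3 : h (j :: v) = [::] ->
  bnd (upd h (j :: v) v) b1 -> bnd (upd h (j :: v) (i :: j :: v)) b2 ->
  (forall k, k != i -> bnd (upd h (j :: v) (k :: j :: v)) b3) ->
  bnd h (pstar d p * b1 + (1 - pstar d p) * (d%:R^-1 * b2 + (1 - d%:R^-1) * b3)).
Proof.
move=> hz H1 H2 H3.
pose pr w : R := if w == v then pstar d p else (1 - pstar d p) / d%:R.
pose f w : R := if w == v then b1 else if w == i :: j :: v then b2 else b3.
have vneq k : (k :: j :: v == v) = false.
  by apply/eqP => /(congr1 size)/=; lia.
have sumE (F : vertex d -> R) : \sum_(w <- v :: children (j :: v)) F w =
    F v + \sum_(k < d) F (k :: j :: v) by rewrite big_cons sum_children.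
have -> : pstar d p * b1 + (1 - pstar d p) * (d%:R^-1 * b2 + (1 - d%:R^-1) * b3)
    = \sum_(w <- v :: children (j :: v)) pr w * f w.
  rewrite sumE {1}/pr {1}/f eqxx; congr (_ + _).
  rewrite (bigD1 i)//= /pr /f vneq eqxx.
  rewrite (eq_bigr (fun=> (1 - pstar d p) / d%:R * b3)); last first.
    by move=> k /negbTE ki; rewrite vneq eqseq_cons ki.
  rewrite sumr_const cardC1 card_ord -[X in _ = _ + X]mulr_natl -subn1 natrB ?(ltnW d2)//.
  by field.
apply: (bounded_in_step HX mE (u := j :: v)).
- by rewrite /= children_uniq andbT; exact: (behead_children (j :: v)).
- move=> w; rewrite inE hz /= => /orP[/eqP ->|/childrenP[k ->]].
    by rewrite /pr eqxx first_step_parent.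
  by rewrite /pr vneq first_step_child.
- rewrite sumE {1}/pr eqxx; under eq_bigr do rewrite /pr vneq.
  by rewrite sumr_const card_ord -[X in _ + X]mulr_natl; field.
- move=> w; rewrite inE => /orP[/eqP ->|/childrenP[k ->]].
    by rewrite /f eqxx.
  rewrite /f vneq; case: ifPn => [/eqP ->//|]; rewrite eqseq_cons eqxx andbT.
  exact: H3.
Qed.

(** The continuation principle for the exploration of the subtree of [v], entered by
[u] from [v0]: to bound the probability of [E] it is enough to bound it by
[f (size A)] once the particles in [A] have come back to [v0], the frogs outside the
subtree being untouched.  The bound is then the mean of [f] under [returns]. *)
Definition explores n : Prop := forall i v0 u h (f : nat -> R),
  let v := i :: v0 in
  known_active h u -> ends h u v0 v -> (forall z, suffix v z -> h z = [::]) ->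
  (forall h' A, extends h h' ->
     (forall z, ~~ suffix v z -> z != u -> h' z = h z) ->
     arrivals v0 v h' A -> bnd h' (f (size A))) ->
  bnd h (ret n f).

(** The same principle in the middle of the exploration: [J] lists the explored
children of [v], [L] the particles waiting at [v] with the child they come from, and
[A] those that have already reached [v0]. *)
Definition processes n b : Prop :=
  forall i0 v0 u0 h0 (f : nat -> R) h J (L : seq (vertex d * 'I_d)) (A : seq (vertex d)),
  let v := i0 :: v0 in
  uniq J -> extends h0 h ->
  (forall z, ~~ suffix v z -> z != u0 -> h z = h0 z) ->
  (forall i, i \notin J -> forall z, suffix (i :: v) z -> h z = [::]) ->
  (forall zi, zi \in L -> [/\ zi.2 \in J, suffix v zi.1, known_active h zi.1
     & ends h zi.1 (zi.2 :: v) v]) ->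
  uniq (map fst L ++ A) ->
  (forall z, z \in A -> [/\ suffix v z, known_active h z & ends h z v v0]) ->
  (forall h' A', extends h0 h' ->
     (forall z, ~~ suffix v z -> z != u0 -> h' z = h0 z) ->
     arrivals v0 v h' A' -> bnd h' (f (size A'))) ->
  bnd h (process (phat p) (fresh_rate R d) (ret n) b (size J) f (size L) (size A)).

(** The first waiting particle makes one step.  If it enters an unexplored child
subtree, that subtree is explored by the hypothesis on [n] and its returned particles
join the waiting list. *)
Lemma process_rec n b : explores n ->
  (forall b', b = b'.+1 -> processes n b') -> processes n b.
Proof.
move=> IHn IHb i0 v0 u0 h0 f h J L; elim: L h => [|[z i] L IHL] h A v;
  move=> uJ h0h out fresh HL uLA HA fin.
  by rewrite process0; apply: fin => //; split => //; move: uLA.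
have [iJ vz zact zends] := HL _ (mem_head _ _).
rewrite /= in iJ vz zact zends.
have /= /andP[zLA uLA'] := uLA.
have zA : z \notin A by move: zLA; rewrite mem_cat negb_or => /andP[].
have zL : z \notin map fst L by move: zLA; rewrite mem_cat negb_or => /andP[].
have hz := ends_nil zends.
have ext w : extends h (upd h z w) by exact: extends_upd.
have ext0 w : extends h0 (upd h z w) by exact: extends_trans h0h (ext w).
have out' w z' : ~~ suffix v z' -> z' != u0 -> upd h z w z' = h0 z'.
  move=> vz' z'u0; rewrite upd_neq; first exact: out.
  by apply: contraNneq vz' => ->.
have fresh' w k : k \notin J -> forall z', suffix (k :: v) z' -> upd h z w z' = [::].
  move=> kJ z' kz'; rewrite upd_neq; first exact: fresh kJ _ kz'.
  by apply/eqP => zz'; apply: hz; rewrite -zz'; exact: fresh kJ _ kz'.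
have HL' w zi : zi \in L -> [/\ zi.2 \in J, suffix v zi.1, known_active (upd h z w) zi.1
     & ends (upd h z w) zi.1 (zi.2 :: v) v].
  move=> ziL; have [|h1 h2 h3 h4] := HL zi; first by rewrite inE ziL orbT.
  split => //; first exact: known_active_extends h3.
  apply: ends_eq h4; apply: upd_neq; apply: contraNneq zL => <-.
  exact: map_f.
have HA' w z' : z' \in A -> [/\ suffix v z', known_active (upd h z w) z'
     & ends (upd h z w) z' v v0].
  move=> z'A; have [h1 h2 h3] := HA z' z'A; split => //.
    exact: known_active_extends h2.
  by apply: ends_eq h3; apply: upd_neq; apply: contraNneq zA => <-.
have up : bnd (upd h z v0)
    (process (phat p) (fresh_rate R d) (ret n) b (size J) f (size L) (size A).+1).
  apply: (IHL (upd h z v0) (z :: A)) => //.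
  - exact: out'.
  - exact: fresh'.
  - exact: HL'.
  - by rewrite -[z :: A]cat1s uniq_catCA /= zLA.
  - move=> z'; rewrite inE => /orP[/eqP ->|]; last exact: HA'.
    by split => //; [exact: known_active_extends zact|exact: ends_upd zends].
have wasted k : bnd (upd h z (k :: v))
    (process (phat p) (fresh_rate R d) (ret n) b (size J) f (size L) (size A)).
  apply: (IHL (upd h z (k :: v)) A) => //.
  - exact: out'.
  - exact: fresh'.
  - exact: HL'.
  - exact: HA'.
case: b IHb IHL up wasted => [|b] IHb IHL up wasted.
  rewrite /process /=.
  set y := drain _ _ (size L) (size A).
  have -> : (1 - phat p) * y = (1 - phat p) *
    (fresh_rate R d (size J) * y + (1 - fresh_rate R d (size J)) * y) by ring.
  apply: (bounded_up zends uJ iJ) => // k _; exact: wasted.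
rewrite processS; apply: (bounded_up zends uJ iJ) => // k kJ.
apply: (IHn k v z).
- exact: known_active_extends zact.
- exact: ends_upd zends.
- exact: fresh' kJ.
move=> h2 B h12 out2 [uB HB].
rewrite -[(size L + size B)%N]addnC -(size_map (fun z' => (z', k)) B) -size_cat.
have zkv w : h w <> [::] -> ~~ suffix (k :: v) w.
  by move=> hw; apply/negP => /(fresh k kJ).
have same w : h w <> [::] -> w != z -> h2 w = h w.
  by move=> hw wz; rewrite out2// ?upd_neq// zkv.
have nil_z w : ~~ suffix (k :: v) w -> w != z -> h2 w = h w.
  by move=> hw wz; rewrite out2// upd_neq.
have hh2 : extends h h2 by exact: extends_trans (ext _) h12.
apply: (IHb b erefl i0 v0 u0 h0 f h2 (k :: J)).
- by rewrite /= kJ.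
- exact: extends_trans h0h hh2.
- move=> w vw wu0; rewrite out2; first exact: out'.
    by apply: contra vw; exact: suffix_behead.
  by apply: contraNneq vw => ->.
- move=> l; rewrite inE negb_or => /andP[lk lJ] w lw.
  rewrite nil_z; first exact: fresh lJ _ lw.
    by apply: contra lk => kw; rewrite (suffix_cons_inj kw lw).
  by apply/eqP => wz; apply: hz; rewrite -wz; exact: fresh lJ _ lw.
- move=> [w l]; rewrite mem_cat => /orP[/mapP[w' w'B [-> ->]]|wL] /=.
    have [h1' h2' h3'] := HB _ w'B; rewrite mem_head; split => //.
    exact: suffix_behead h1'.
  have [|h1' h2' h3' h4'] := HL (w, l); first by rewrite inE wL orbT.
  rewrite /= in h1' h2' h3' h4'; split => //; first by rewrite inE h1' orbT.
    exact: known_active_extends h3'.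
  apply: (ends_eq _ h4'); apply: same; first exact: ends_nil h4'.
  by apply: contraNneq zL => <-; apply/mapP; exists (w, l).
- rewrite map_cat -map_comp map_id -catA cat_uniq uB uLA' andbT /=.
  apply/hasPn => w; rewrite mem_cat => wLA; apply/negP => wB.
  have [wk _ _] := HB _ wB.
  move: wk; apply/negP; apply: zkv.
  move: wLA => /orP[/mapP[wl wlL ->]|wA].
    by have [|_ _ _ /ends_nil] := HL wl; first by rewrite inE wlL orbT.
  by have [_ _ /ends_nil] := HA w wA.
- move=> w wA; have [h1' h2' h3'] := HA w wA; split => //.
    exact: known_active_extends h2'.
  apply: (ends_eq _ h3'); apply: same; first exact: ends_nil h3'.
  by apply: contraNneq zA => <-.
- exact: fin.
Qed.

Lemma process_bounded n b : explores n -> processes n b.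
Proof.
by move=> IHn; elim: b => [|b IHb]; apply: process_rec => // b' [<-].
Qed.

Lemma explore n : explores n.
Proof.
elim: n => [|n IHn] i v0 u h f v uact uends fresh fin.
  rewrite /ret /=; apply: (fin h [::]) => //; first exact: extends_refl.
rewrite /ret /=.
apply: (bounded_down uends) => j; set h1 := upd h u (j :: v).
have hu := ends_nil uends.
have vu : ~~ suffix v u by apply/negP => /fresh.
have hv : h v = [::] by apply: fresh; exact: suffix_refl.
have hh1 : extends h h1 by exact: extends_upd.
apply: (IHn j v u) => //.
- exact: known_active_extends uact.
- exact: ends_upd uends.
- move=> z jz; have vz := suffix_behead jz.
  by rewrite /h1 upd_neq ?fresh//; apply: contraNneq vu => <-.
move=> h2 A1 h12 out2 [uA1 HA1].
have hh2 := extends_trans hh1 h12.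
have vneu : v != u by apply: contraNneq vu => <-; exact: suffix_refl.
have h2v : h2 v = [::].
  by rewrite out2 ?suffix_consN// /h1 upd_neq.
have vact : known_active h2 v.
  apply: known_active_extends hh2 _; apply: known_active_visited uact _.
  exact: ends_mem uends.
have out2' z : ~~ suffix v z -> z != u -> h2 z = h z.
  move=> vz zu; rewrite out2// ?/h1 ?upd_neq//.
  by apply: contra vz; exact: suffix_behead.
have fresh2 k : k \notin [:: j] -> forall z, suffix (k :: v) z -> h2 z = [::].
  rewrite inE => kj z kz.
  have zu : z != u by apply: contraNneq vu => <-; exact: suffix_behead kz.
  rewrite out2// ?/h1 ?upd_neq//; first by apply: fresh; exact: suffix_behead kz.
  by apply: contra kj => jz; rewrite (suffix_cons_inj kz jz).
have vA1 : v \notin A1.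
  by apply/negP => /HA1[/(fun H => H) sv _ _]; move: sv; rewrite (negbTE (suffix_consN _ _)).
have HL k z : z \in A1 -> [/\ suffix v z, known_active (upd h2 v (k : vertex d)) z &
    ends (upd h2 v k) z (j :: v) v].
  move=> zA; have [h1' h2' h3'] := HA1 z zA; split.
  - exact: suffix_behead h1'.
  - by apply: known_active_extends h2'; exact: extends_upd.
  - by apply: ends_eq h3'; apply: upd_neq; apply: contraNneq vA1 => <-.
have proc := process_bounded (n := n).
rewrite -(size_map (fun z => (z, j)) A1).
have mapA1 : map fst (map (fun z => (z, j)) A1) = A1 by rewrite -map_comp map_id.
have outk k z : ~~ suffix v z -> z != u -> upd h2 v k z = h z.
  move=> vz zu; rewrite upd_neq; first exact: out2'.
  by apply: contraNneq vz => ->; exact: suffix_refl.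
have extk k : extends h (upd h2 v k).
  by apply: extends_trans hh2 _; exact: extends_upd.
have freshk w k : k \notin [:: j] -> forall z, suffix (k :: v) z -> upd h2 v w z = [::].
  move=> kj z kz; rewrite upd_neq; first exact: fresh2 kj _ kz.
  by apply: contraTneq kz => ->; exact: suffix_consN.
apply: (@bounded_new h2 i v0 j) => //.
- apply: (proc b0.+1 IHn i v0 u h f (upd h2 v v0) [:: j] _ [:: v]) => //.
  + exact: outk.
  + exact: freshk.
  + by move=> _ /mapP[z zA ->] /=; rewrite mem_head; have [] := HL v0 z zA.
  + by rewrite mapA1 cat_uniq uA1 /= orbF andbT.
  + move=> z; rewrite inE => /eqP ->; split; first exact: suffix_refl.
      by apply: known_active_extends vact; exact: extends_upd.
    exact: ends_new.
- apply: (proc b0.+1 IHn i v0 u h f (upd h2 v (j :: v)) [:: j] _ [::]) => //.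
  + exact: outk.
  + exact: freshk.
  + by move=> _ /mapP[z zA ->] /=; rewrite mem_head; have [] := HL (j :: v) z zA.
  + by rewrite mapA1 cats0.
move=> k kj; set h3 := upd h2 v (k :: v).
have kj' : k \notin [:: j] by rewrite inE.
apply: (IHn k v v) => //.
- by apply: known_active_extends vact; exact: extends_upd.
- exact: ends_new.
- exact: freshk.
move=> h4 A2 h34 out4 [uA2 HA2].
rewrite -(size_map (fun z => (z, k)) A2) -size_cat.
have same z : ~~ suffix (k :: v) z -> z != v -> h4 z = h2 z.
  by move=> kz zv; rewrite out4// /h3 upd_neq.
have A1k z : z \in A1 -> ~~ suffix (k :: v) z.
  move=> /HA1[jz _ _]; apply/negP => kz; move: kj; rewrite (suffix_cons_inj kz jz).
  by rewrite eqxx.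
apply: (proc b0 IHn i v0 u h f h4 [:: k; j] _ [::]) => //.
- by rewrite /= kj'.
- exact: extends_trans (extk _) h34.
- move=> z vz zu; rewrite out4; first exact: outk.
    by apply: contra vz; exact: suffix_behead.
  by apply: contraNneq vz => ->; exact: suffix_refl.
- move=> l; rewrite !inE negb_or => /andP[lk lj] z lz.
  rewrite out4; first by apply: freshk lz; rewrite inE.
    by apply: contra lk => kz; rewrite (suffix_cons_inj kz lz).
  by apply: contraTneq lz => ->; exact: suffix_consN.
- move=> zi; rewrite mem_cat => /orP[] /mapP[z zA ->] /=.
    have [h1' h2' h3'] := HL (k :: v) z zA; rewrite !inE eqxx orbT; split => //.
      exact: known_active_extends h2'.
    apply: ends_eq h3'; rewrite out4//; first exact: A1k.
    by apply: contraNneq vA1 => <-.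
  have [h1' h2' h3'] := HA2 z zA; rewrite mem_head; split => //.
  exact: suffix_behead h1'.
- rewrite cats0 map_cat mapA1 -map_comp map_id cat_uniq uA1 uA2 andbT /=.
  apply/hasPn => z /HA2[kz _ _]; apply/negP => /A1k.
  by rewrite kz.
Qed.

Lemma explore_root n (f : nat -> R) :
  (forall h' A, uniq A -> (forall z, z \in A -> known_active h' z /\
      exists i, ends h' z [:: i] [::]) -> bnd h' (f (size A))) ->
  bnd (fun=> [::]) (ret n f).
Proof.
move=> fin.
apply: (@bounded_child _ [::] [::]) => j; first exact: first_step_root.
apply: (@explore n j [::] [::]) => //.
- by move=> x _; exact: active_root.
- exact: ends_new.
- by move=> [|k z] jz; [move/size_suffix: jz|rewrite upd_neq].
move=> h' A _ _ [uA HA]; apply: fin => // z /HA[_ h1 h2]; split => //.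
by exists j.
Qed.

End Exploration.

(** * Measurability of the root visits, and recurrence above 1/6 *)

Section Counting.
Import finmap.
Local Open Scope fset_scope.
Variables (T : choiceType) (R : realType).

Definition has_at_least (A : set T) k : Prop :=
  exists s : seq T, [/\ uniq s, size s = k & forall m, m \in s -> A m].

Lemma counting_infinite (A : set T) :
  counting A = +oo%E :> \bar R <-> forall k, has_at_least A k.
Proof.
rewrite /counting; split.
  case: ifPn => // /asboolP /infinite_set_fsetP Ainf _ k.
  have [B BA kB] := Ainf k.
  exists (take k (enum_fset B)); split.
  - by rewrite take_uniq// fset_uniq.
  - by rewrite size_takel.
  - by move=> m /mem_take mB; apply: BA.
move=> H; rewrite asboolF//; apply/infinite_set_fsetP => n.
have [s [us ss sA]] := H n; exists [fset m in s]%fset.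
  by move=> m /=; rewrite inE; exact: sA.
by rewrite card_fseq undup_id// ss.
Qed.

Lemma has_at_least_le A k k' : (k' <= k)%N -> has_at_least A k -> has_at_least A k'.
Proof.
move=> kk' [s [us ss sA]]; exists (take k' s); split.
- exact: take_uniq.
- by rewrite size_takel// ss.
- by move=> m /mem_take; exact: sA.
Qed.

End Counting.

Section NullSets.
Context d (Omega : measurableType d) (R : realType).
Variable P : {measure set Omega -> \bar R}.

Lemma measurable_countU (I : countType) (F : I -> set Omega) :
  (forall i, measurable (F i)) -> measurable [set w | exists i, F i w].
Proof.
move=> mF; rewrite (_ : [set w | _] = \bigcup_i F i).
  exact: countable_bigcupT_measurable.
by apply/seteqP; split => w /=; [move=> [i]; exists i|move=> [i]; exists i].
Qed.

Lemma measurable_countI (I : countType) (F : I -> set Omega) :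
  (forall i, measurable (F i)) -> measurable [set w | forall i, F i w].
Proof.
move=> mF; rewrite (_ : [set w | _] = ~` [set w | exists i, ~ F i w]).
  by apply: measurableC; apply: measurable_countU => i; exact: measurableC.
apply/seteqP; split => w /=; first by move=> H [i].
by move=> H i; apply: contrapT => Fi; apply: H; exists i.
Qed.

Lemma null_countU (I : countType) (F : I -> set Omega) :
  (forall i, measurable (F i)) -> (forall i, P (F i) = 0)%E ->
  P [set w | exists i, F i w] = 0%E.
Proof.
move=> mF F0.
pose G n := if unpickle n is Some i then F i else set0.
have mG n : measurable (G n) by rewrite /G; case: unpickle.
have -> : [set w | exists i, F i w] = \bigcup_n G n.
  apply/seteqP; split => w /=.
    by move=> [i Fi]; exists (pickle i) => //; rewrite /G pickleK.
  by move=> [n _]; rewrite /G; case: unpickle => // i; exists i.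
apply/negligibleP; first exact: bigcupT_measurable.
apply: negligible_bigcup => n; apply/negligibleP => //.
by rewrite /G; case: unpickle.
Qed.

Lemma null_subset (A B : set Omega) : measurable A -> measurable B ->
  A `<=` B -> P B = 0%E -> P A = 0%E.
Proof.
move=> mA mB AB PB; apply/eqP; rewrite eq_le measure_ge0 andbT -PB.
by apply: le_measure; rewrite ?inE.
Qed.

End NullSets.

Section RootVisits.
Variables (R : realType) (d : nat) (p : R).
Variables (disp : measure_display) (Omega : measurableType disp).
Variables (P : probability Omega R) (X : vertex d -> nat -> Omega -> vertex d).
Hypothesis HX : is_nbFM p P X.

Let x w : vertex d -> nat -> vertex d := fun v n => X v n w.
Let mX := measurable_position HX.

Lemma measurable_const (Q : Prop) : measurable [set _ : Omega | Q].
Proof.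
have [q|q] := pselect Q.
  by rewrite (_ : [set _ | _] = setT)//; apply/seteqP; split.
by rewrite (_ : [set _ | _] = set0)//; apply/seteqP; split.
Qed.

(** The state of a frog at time t + 1 depends on countably many positions and on the
states at time t. *)
Lemma measurable_age t v o : measurable [set w | age (x w) t v = o].
Proof.
elim: t v o => [|t IHt] v o /=; first exact: measurable_const.
pose A := [set w | exists ua : vertex d * nat,
  ([set w | age (x w) t ua.1 = Some ua.2] `&` [set w | X ua.1 ua.2.+1 w = v]) w].
have mA : measurable A.
  apply: measurable_countU => ua; apply: measurableI; first exact: IHt.
  exact: mX.
have AE w : (exists u a, age (x w) t u = Some a /\ x w u a.+1 = v) <-> A w.
  split; first by move=> [u [a [h1 h2]]]; exists (u, a).
  by move=> [[u a] [h1 h2]]; exists u, a.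
rewrite (_ : [set w | _] =
  [set w | exists a, ([set w | age (x w) t v = Some a] `&` [set _ | o = Some a.+1]) w]
  `|` (([set w | age (x w) t v = None] `&` A `&` [set _ | o = Some 0%N])
  `|` ([set w | age (x w) t v = None] `&` ~` A `&` [set _ | o = None]))).
  apply: measurableU.
    by apply: measurable_countU => a; apply: measurableI => //; exact: measurable_const.
  have mN : measurable [set w | age (x w) t v = None] by exact: IHt.
  apply: measurableU; apply: measurableI; try exact: measurable_const.
    exact: measurableI.
  by apply: measurableI => //; exact: measurableC.
apply/seteqP; split => w /=.
  case E: (age (x w) t v) => [a|]; first by move=> <-; left; exists a.
  case: ifPn => [/asboolP/AE h <-|/asboolP h <-]; right; [left|right] => //.
  by split => //; split => // /AE.
move=> [[a [-> ->]]//|[[[-> /AE h] ->]|[[-> h] ->]]].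
  by rewrite asboolT.
by rewrite asboolF// => /AE.
Qed.

Lemma measurable_root_move m : measurable [set w | root_moves (x w) m].
Proof.
rewrite /root_moves /=.
rewrite (_ : [set w | _] = [set w | exists a, ([set w | age (x w) m.2 m.1 = Some a]
  `&` (~` [set w | X m.1 a w = root_vertex]) `&` [set w | X m.1 a.+1 w = root_vertex]) w]).
  apply: measurable_countU => a; apply: measurableI; last exact: mX.
  apply: measurableI; first exact: measurable_age.
  by apply: measurableC; exact: mX.
apply/seteqP; split => w /=; first by move=> [a [h1 h2 h3]]; exists a.
by move=> [a [[h1 h2] h3]]; exists a.
Qed.

Definition many_moves k : set Omega := [set w | has_at_least (root_moves (x w)) k].

Lemma measurable_many_moves k : measurable (many_moves k).
Proof.
rewrite /many_moves (_ : [set w | _] = [set w | exists s : seq (vertex d * nat),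
    ([set _ | uniq s /\ size s = k] `&` [set w | forall m : vertex d * nat,
       ([set _ | m \notin s] `|` [set w | root_moves (x w) m]) w]) w]).
  apply: measurable_countU => s; apply: measurableI; first exact: measurable_const.
  apply: measurable_countI => m; apply: measurableU; first exact: measurable_const.
  exact: measurable_root_move.
apply/seteqP; split => w /= [s].
  move=> [us ss H]; exists s; split => // m; have [ms|ms] := boolP (m \in s).
    by right; exact: H.
  by left.
move=> [[us ss] H]; exists s; split => // m ms.
by have [|//] := H m; rewrite ms.
Qed.

Definition infinite_visits : set Omega :=
  [set w | root_visits R (fun v n => X v n w) = +oo%E].

Lemma infinite_visitsE : infinite_visits = [set w | forall k, many_moves k w].
Proof.
apply/seteqP; split => w; rewrite /infinite_visits /root_visits /=.
  by move=> /counting_infinite H k; exact: H.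
by move=> H; apply/counting_infinite.
Qed.

Lemma measurable_infinite_visits : measurable infinite_visits.
Proof. by rewrite infinite_visitsE; apply: measurable_countI => k; exact: measurable_many_moves. Qed.

Definition good_start : set Omega := [set w | forall v, X v 0%N w = v].

Lemma measurable_good_start : measurable good_start.
Proof. by apply: measurable_countI => v; exact: mX. Qed.

Lemma bad_start_null : P (~` good_start) = 0%E.
Proof.
rewrite (_ : ~` _ = [set w | exists v, (~` [set w | X v 0%N w = v]) w]); last first.
  apply/seteqP; split => w /=; last by move=> [v h] H; exact: h.
  by move=> h; apply: contrapT => H; apply: h => v; apply: contrapT => h; apply: H; exists v.
apply: null_countU => v; first by apply: measurableC; exact: mX.
exact: start_as HX v.
Qed.

Section FewMoves.
Variables (b0 M : nat).
Hypothesis d2 : (2 <= d)%N.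

Let E := good_start `&` ~` many_moves M.+1.

Let mE : measurable E.
Proof.
apply: measurableI; first exact: measurable_good_start.
by apply: measurableC; exact: measurable_many_moves.
Qed.

(** Particles that come back from the subtree entered by the initial frog are
distinct visits to the root, so at most [M] visits allow at most [M] returns. *)
Lemma few_moves_le n : (P E <=
  (returns (phat p) (pstar d p) d%:R^-1 (fresh_rate R d) b0 n
     (fun r => (r <= M)%N%:R))%:E)%E.
Proof.
apply: (@bounded_in_nil _ _ p _ _ P X).
apply: (explore_root HX d2 mE) => h A uA HA /=.
have [AM|AM] := leqP (size A) M; first by rewrite mulr1n; exact: (bounded_in1 HX mE).
move=> J uJ hJ; rewrite mul0r.
rewrite (_ : _ `&` _ = set0) ?measure0// -subset0 => w [Cw [sw mw]].
apply: mw.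
have xh : compatible (x w) h.
  move=> u; have [hu|hu] := pselect (h u = [::]); last exact: Cw (hJ _ hu).
  by rewrite hu /mkseq /= /x sw.
have H z : z \in A -> exists t, root_moves (x w) (z, t).
  move=> zA; have [zact [i [r Ez]]] := HA z zA.
  have sz : (size (h z)).+1 = (size r).+2 by rewrite -/(size (z :: h z)) Ez !size_rcons.
  have nthE k : (k <= (size r).+1)%N -> x w z k = nth z (rcons (rcons r [:: i]) [::]) k.
    by rewrite -Ez => kr; apply: compatible_nth xh _; case: sz => ->.
  apply: (@active_root_move _ _ _ (size r)); first exact: zact xh.
    by rewrite nthE// !nth_rcons size_rcons ltnSn ltnn eqxx.
  by rewrite nthE// nth_rcons size_rcons ltnn eqxx.
apply: (has_at_least_le AM).
pose t z := xget 0%N [set t | root_moves (x w) (z, t)].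
have tP z : z \in A -> root_moves (x w) (z, t z).
  by move=> /H e; exact: (@xgetPex _ 0%N [set t | root_moves (x w) (z, t)]).
exists [seq (z, t z) | z <- A]; split.
- by rewrite map_inj_uniq// => z z' [].
- by rewrite size_map.
- by move=> m /mapP[z zA ->]; exact: tP.
Qed.

End FewMoves.

End RootVisits.

(** Markov's inequality for (1/2) to the number of returns: the probability of at most
[M] visits is bounded by 2 ^ M times the generating function at 1/2, at any depth. *)
Lemma recurrent_above (R : realType) (p : R) : 1 / 6 < p < 1 / 2 ->
  \forall d \near \oo, nbFM_recurrent d p.
Proof.
move=> p01; have [b0 [N _ HN]] := returns_pgf_vanish p01.
exists N.+2 => // d /= Nd disp Omega P X HX.
have d2 : (2 <= d)%N by exact: leq_trans Nd.
have /HN[eret van] : [set n | (N <= n)%N] d by rewrite /= (leq_trans _ Nd)// leqW.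
have null M : P (good_start X `&` ~` many_moves X M.+1) = 0%E.
  apply/eqP; rewrite eq_le measure_ge0 andbT.
  apply/lee_addgt0Pr => e e0; rewrite add0e.
  have e0' : 0 < e / 2 ^+ M by rewrite divr_gt0// exprn_gt0.
  have [|n Hn] := van (1 / 2) _ _ e0'; first by apply/andP; split; lra.
  apply: le_trans (few_moves_le HX b0 M d2 n) _; rewrite lee_fin.
  apply: (@le_trans _ _ (2 ^+ M * (e / 2 ^+ M))); last first.
    by rewrite mulrC divfK// expf_neq0.
  apply: le_trans (_ : _ <= 2 ^+ M * pgf (phat p) (pstar d p) d%:R^-1 (fresh_rate R d) b0 n (1 / 2)) _; last first.
    by rewrite ler_wpM2l// exprn_ge0.
  have [m _ _] := eret n; rewrite /pgf -(expectationM _ _ (eret n)); apply: (m) => r.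
  have [rM|rM] /= := leqP r M; last by rewrite mulr_ge0 ?exprn_ge0//; lra.
  rewrite mulr1n div1r exprVn ler_pdivlMr ?exprn_gt0// mul1r.
  by apply: ler_weXn2l => //; lra.
have mI := measurable_infinite_visits HX.
have mB : measurable (~` good_start X) by apply: measurableC; exact: measurable_good_start HX.
have mF M : measurable (good_start X `&` ~` many_moves X M.+1).
  apply: measurableI; first exact: measurable_good_start HX.
  by apply: measurableC; exact: measurable_many_moves HX _.
have mU := measurable_countU mF.
have : P (~` infinite_visits R X) = 0%E.
  apply: (null_subset _ (measurableU _ _ mB mU)); first exact: measurableC.
    move=> w /=; rewrite infinite_visitsE /= => Hw.
    have [gw|gw] := pselect (good_start X w); [right|by left].
    apply: contrapT => H; apply: Hw => k.
    apply: (@has_at_least_le _ _ k.+1) => //.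
    by apply: contrapT => h; apply: H; exists k.
  by rewrite measureU0//; [exact: bad_start_null HX|exact: null_countU mF null].
by have := probability_setC P (measurableC mI); rewrite setCK => -> ->; rewrite sube0.
Qed.

(** * Discrete random histories on the unit interval *)

Section UnitInterval.
Variable R : realType.

Definition unit_itv : set (measurableTypeR R) := `[0, 1[%classic.

Lemma measurable_unit_itv : measurable unit_itv.
Proof. exact: measurable_itv. Qed.

Definition unit_measure : set (measurableTypeR R) -> \bar R :=
  mrestr (@lebesgue_measure R) measurable_unit_itv.

HB.instance Definition _ := Measure.on unit_measure.

Let unit_measure_setT : unit_measure setT = 1%E.
Proof.
rewrite /unit_measure /mrestr setTI /unit_itv lebesgue_measure_itv/=.
by rewrite lte_fin ltr01 oppr0 adde0.
Qed.

HB.instance Definition _ :=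
  Measure_isProbability.Build _ _ R unit_measure unit_measure_setT.

Lemma unit_measure_itv (l e : R) : 0 <= e ->
  `[l, l + e[%classic `<=` unit_itv ->
  unit_measure `[l, l + e[%classic = e%:E.
Proof.
move=> e0 sub; rewrite /unit_measure /mrestr setIidl// lebesgue_measure_itv/=.
rewrite lte_fin ltrDl; case: ltP => [e1|e1]; first by rewrite -EFinB addrAC subrr add0r.
by congr EFin; apply/eqP; rewrite eq_le e0 e1.
Qed.

End UnitInterval.

Lemma measurable_bigcup_count d (Omega : measurableType d) (I : countType)
    (D : set I) (F : I -> set Omega) :
  (forall i, measurable (F i)) -> measurable (\bigcup_(i in D) F i).
Proof.
move=> mF; rewrite bigcup_mkcond; apply: countable_bigcupT_measurable => // i.
by case: ifP.
Qed.

(** A history lists the outcomes so far, latest first; [cand s] are the possible next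
outcomes and [pr s] their probabilities.  The interval of length [len s] starting at
[low s] is cut into consecutive intervals for the possible next outcomes, and a point
of [0, 1[ follows the intervals that contain it. *)
Section Histories.
Variables (R : realType) (T : countType) (x0 : T).
Variables (cand : seq T -> seq T) (pr : seq T -> T -> R).
Hypothesis cand_uniq : forall s, uniq (cand s).
Hypothesis pr_ge0 : forall s w, 0 <= pr s w.
Hypothesis pr_sum : forall s, \sum_(w <- cand s) pr s w = 1.

Fixpoint len (s : seq T) : R := if s is w :: s' then len s' * pr s' w else 1.

Definition before (s : seq T) (w : T) : R :=
  \sum_(v <- take (index w (cand s)) (cand s)) pr s v.

Fixpoint low (s : seq T) : R :=
  if s is w :: s' then low s' + len s' * before s' w else 0.

Definition within (s : seq T) (t : R) : bool := low s <= t < low s + len s.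

Lemma len_ge0 s : 0 <= len s.
Proof. by elim: s => //= w s IHs; rewrite mulr_ge0. Qed.

Lemma sum_take_le (c : seq T) (f : T -> R) i j : (forall w, 0 <= f w) -> (i <= j)%N ->
  \sum_(v <- take i c) f v <= \sum_(v <- take j c) f v.
Proof.
move=> f0 ij; rewrite -(subnKC ij) takeD big_cat /= lerDl.
by apply: sumr_ge0.
Qed.

Lemma sum_take_all (c : seq T) (f : T -> R) i : (forall w, 0 <= f w) ->
  \sum_(v <- take i c) f v <= \sum_(v <- c) f v.
Proof.
move=> f0; rewrite -[in leRHS](cat_take_drop i c) big_cat /= lerDl.
by apply: sumr_ge0.
Qed.

Lemma sum_take_index (c : seq T) (f : T -> R) w : w \in c ->
  \sum_(v <- take (index w c).+1 c) f v = \sum_(v <- take (index w c) c) f v + f w.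
Proof.
move=> wc; rewrite (take_nth w) ?index_mem// big_rcons/= nth_index//.
Qed.

Lemma find_value (c : seq T) (f : T -> R) t : uniq c -> 0 <= t -> t < \sum_(v <- c) f v ->
  exists2 w, w \in c & \sum_(v <- take (index w c) c) f v <= t <
     \sum_(v <- take (index w c) c) f v + f w.
Proof.
elim: c t => [|w c IHc] t /=; first by rewrite big_nil => _ t0 /(le_lt_trans t0); rewrite ltxx.
move=> /andP[wc uc] t0; rewrite big_cons => tw.
have [tfw|fwt] := ltP t (f w).
  by exists w; rewrite ?mem_head// eqxx take0 big_nil t0 add0r.
have [||v vc /andP[v1 v2]] := IHc (t - f w) uc; [lra|lra|].
have wv : (w == v) = false by apply: contraNF wc => /eqP ->.
exists v; first by rewrite inE vc orbT.
by rewrite wv /= big_cons; apply/andP; split; lra.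
Qed.

Lemma within_sub s w t : w \in cand s -> within (w :: s) t -> within s t.
Proof.
rewrite /within /= => wc /andP[h1 h2].
have b0 : 0 <= before s w by apply: sumr_ge0.
have b1 : before s w + pr s w <= 1.
  rewrite -sum_take_index// -(pr_sum s); exact: sum_take_all.
have l0 := len_ge0 s.
have h3 : 0 <= len s * before s w by rewrite mulr_ge0.
have h4 : len s * (before s w + pr s w) <= len s * 1 by rewrite ler_wpM2l.
by apply/andP; split; lra.
Qed.

Lemma within_step s t : within s t -> exists2 w, w \in cand s & within (w :: s) t.
Proof.
rewrite /within => /andP[h1 h2].
have l0 : 0 < len s by lra.
have [||w wc /andP[w1 w2]] := @find_value (cand s) (pr s) ((t - low s) / len s) (cand_uniq s).
- by rewrite divr_ge0 ?(ltW l0)// subr_ge0.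
- by rewrite pr_sum ltr_pdivrMr// mul1r; lra.
exists w => //=; move: w1 w2; rewrite -/(before s w) ler_pdivlMr// ltr_pdivrMr// => w1 w2.
by apply/andP; split; lra.
Qed.

Lemma within_inj s t w w' : w \in cand s -> w' \in cand s ->
  within (w :: s) t -> within (w' :: s) t -> w = w'.
Proof.
move=> wc w'c.
wlog ww' : w w' wc w'c / (index w (cand s) <= index w' (cand s))%N.
  move=> H h h'; have [/H|/ltnW/H] := leqP (index w (cand s)) (index w' (cand s)).
    exact.
  by move=> H'; apply/esym; exact: H'.
rewrite /within /= => /andP[h1 h2] /andP[h3 h4].
move: ww'; rewrite leq_eqVlt => /orP[/eqP E|lt].
  by rewrite -(nth_index x0 wc) E nth_index.
have := sum_take_le (cand s) (pr_ge0 s) lt; rewrite sum_take_index//.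
rewrite -/(before s w) -/(before s w') => H.
have H' := ler_wpM2l (len_ge0 s) H; exfalso; lra.
Qed.

Definition next (s : seq T) (t : R) : T :=
  head x0 [seq w <- cand s | within (w :: s) t].

Fixpoint hist (m : nat) (t : R) : seq T :=
  if m is m'.+1 then next (hist m' t) t :: hist m' t else [::].

Lemma size_hist m t : size (hist m t) = m.
Proof. by elim: m => //= m ->. Qed.

Lemma nextP s t w : w \in cand s -> within (w :: s) t -> next s t = w.
Proof.
move=> wc wt; rewrite /next.
have : w \in [seq w <- cand s | within (w :: s) t] by rewrite mem_filter wt.
case E: [seq _ <- _ | _] => [|w' l] //= _.
have : w' \in [seq w <- cand s | within (w :: s) t] by rewrite E mem_head.
rewrite mem_filter => /andP[w't w'c]; exact: (within_inj w'c wc w't wt).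
Qed.

Lemma within_hist m t : 0 <= t < 1 -> within (hist m t) t.
Proof.
move=> t01; elim: m => [|m IHm]; first by rewrite /within /= add0r.
by have [w wc wt] := within_step IHm; rewrite /= (nextP wc wt).
Qed.

Lemma next_cand m t : 0 <= t < 1 -> next (hist m t) t \in cand (hist m t).
Proof.
move=> /(within_hist m) wm; have [w wc wt] := within_step wm.
by rewrite (nextP wc wt).
Qed.

Fixpoint admissible (s : seq T) : bool :=
  if s is w :: s' then (w \in cand s') && admissible s' else true.

Lemma admissible_hist m t : 0 <= t < 1 -> admissible (hist m t).
Proof. by move=> t01; elim: m => //= m ->; rewrite next_cand. Qed.

Lemma hist_within s t : admissible s -> within s t -> 0 <= t < 1 /\ hist (size s) t = s.
Proof.
elim: s => [|w s IHs] /=; first by rewrite /within /= add0r.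
move=> /andP[wc sa] wt; have [t01 E] := IHs sa (within_sub wc wt).
by split => //; rewrite E (nextP wc wt).
Qed.

Local Notation P := (@unit_measure R).

Lemma histE s : admissible s ->
  [set t | hist (size s) t = s] `&` @unit_itv R = `[low s, low s + len s[%classic.
Proof.
move=> sa; apply/seteqP; split => t /=; rewrite /unit_itv /= !in_itv/=.
  by move=> [E t01]; have := within_hist (size s) t01; rewrite E.
by move=> wt; have [t01 E] := hist_within sa wt.
Qed.

Lemma hist_not_admissible m s : ~~ admissible s ->
  [set t | hist m t = s] `&` @unit_itv R = set0.
Proof.
move=> sa; rewrite -subset0 => t /=; rewrite /unit_itv /= in_itv/= => -[E t01].
by move: sa; rewrite -E admissible_hist.
Qed.

Lemma measurable_within s : measurable ([set t | within s t] : set (measurableTypeR R)).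
Proof.
rewrite (_ : [set t | _] = `[low s, low s + len s[%classic); first exact: measurable_itv.
by apply/seteqP; split => t /=; rewrite in_itv.
Qed.

Lemma measurable_next s w : measurable ([set t | next s t = w] : set (measurableTypeR R)).
Proof.
rewrite /next; elim: (cand s) => [|v c IHc] /=.
  have [E|E] := pselect (x0 = w).
    by rewrite (_ : [set t | _] = setT)//; apply/seteqP; split.
  by rewrite (_ : [set t | _] = set0)//; apply/seteqP; split.
rewrite (_ : [set t | _] = ([set t | within (v :: s) t] `&` [set _ | v = w]) `|`
  (~` [set t | within (v :: s) t] `&` [set t | head x0 [seq w <- c | within (w :: s) t] = w])).
  apply: measurableU; apply: measurableI => //; try exact: measurable_within.
    have [E|E] := pselect (v = w).
      by rewrite (_ : [set _ | _] = setT)//; apply/seteqP; split.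
    by rewrite (_ : [set _ | _] = set0)//; apply/seteqP; split.
  by apply: measurableC; exact: measurable_within.
apply/seteqP; split => t /=.
  by case: ifPn => wt /= H; [left|right; split => //; apply/negP].
by move=> [[-> //]|[/negP/negbTE -> //]].
Qed.

Lemma measurable_hist m s : measurable ([set t | hist m t = s] : set (measurableTypeR R)).
Proof.
elim: m s => [|m IHm] [|w s] /=.
- by rewrite (_ : [set t | _] = setT)//; apply/seteqP; split.
- by rewrite (_ : [set t | _] = set0)//; apply/seteqP; split.
- by rewrite (_ : [set t | _] = set0)//; apply/seteqP; split.
rewrite (_ : [set t | _] = [set t | hist m t = s] `&` [set t | next s t = w]).
  by apply: measurableI; [exact: IHm|exact: measurable_next].
apply/seteqP; split => t /= [h1 h2]; first by split => //; rewrite -h2.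
by rewrite h1 h2.
Qed.

Lemma probability_hist s :
  P [set t | hist (size s) t = s] = (if admissible s then len s else 0)%:E.
Proof.
rewrite /unit_measure /mrestr; case: ifPn => sa; last first.
  by rewrite hist_not_admissible// measure0.
rewrite -(@unit_measure_itv R (low s)) ?len_ge0//; last first.
  by rewrite -histE//; exact: subIsetr.
by rewrite -histE// /unit_measure /mrestr -setIA setIid.
Qed.

Hypothesis pr_cand : forall s w, w \notin cand s -> pr s w = 0.

Lemma probability_next m s w : P ([set t | hist m t = s] `&` [set t | next (hist m t) t = w])
  = ((pr s w)%:E * P [set t | hist m t = s])%E.
Proof.
have [<-|ms] := eqVneq (size s) m; last first.
  rewrite (_ : [set t | hist m t = s] = set0) ?set0I ?measure0 ?mule0//.
  by rewrite -subset0 => t /= E; move: ms; rewrite -E size_hist eqxx.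
rewrite (_ : _ `&` _ = [set t | hist (size (w :: s)) t = w :: s]); last first.
  by apply/seteqP; split => t /= [h1 h2]; [rewrite h2 h1|].
rewrite !probability_hist /= -EFinM; congr EFin.
have [wc|wc] := boolP (w \in cand s); last by rewrite pr_cand// mul0r.
by case: (admissible s) => /=; [rewrite mulrC|rewrite mulr0].
Qed.

Fixpoint histories (m : nat) : seq (seq T) :=
  if m is m'.+1 then [seq w :: s | s <- histories m', w <- cand s] else [:: [::]].

Lemma hist_histories m t : 0 <= t < 1 -> hist m t \in histories m.
Proof.
move=> t01; elim: m => [|m IHm] /=; first exact: mem_head.
by apply/allpairsPdep; exists (hist m t), (next (hist m t) t); rewrite IHm next_cand.
Qed.

(** The Markov property for an event [S] about the past on which the probability of the
outcome [w] is constant; histories of probability zero are exempted, since there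
[pr] carries no information. *)
Lemma probability_next_event m (S : pred (seq T)) w c :
  (forall s, S s -> pr s w = c \/ P [set t | hist m t = s] = 0%E) ->
  P ([set t | S (hist m t)] `&` [set t | next (hist m t) t = w])
  = (c%:E * P [set t | S (hist m t)])%E.
Proof.
move=> Sc.
have mS (S' : pred (seq T)) : measurable ([set t | S' (hist m t)] : set (measurableTypeR R)).
  rewrite (_ : [set t | _] = \bigcup_(s in [set s | S' s]) [set t | hist m t = s]).
    apply: measurable_bigcup_count => s; exact: measurable_hist.
  apply/seteqP; split => t /=; first by move=> h; exists (hist m t).
  by move=> [s Ss ->].
have mN : measurable ([set t | next (hist m t) t = w] : set (measurableTypeR R)).
  rewrite (_ : [set t | _] = \bigcup_(s in setT) ([set t | hist m t = s] `&` [set t | next s t = w])).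
    apply: measurable_bigcup_count => s.
    by apply: measurableI; [exact: measurable_hist|exact: measurable_next].
  apply/seteqP; split => t /=; first by move=> h; exists (hist m t).
  by move=> [s _ [-> ->]].
have H0 : P (~` [set t | hist m t \in undup (histories m)]) = 0%E.
  rewrite /unit_measure /mrestr (_ : _ `&` _ = set0) ?measure0// -subset0 => t /=.
  by rewrite /unit_itv /= in_itv/= => -[+ t01]; rewrite mem_undup hist_histories.
have mH s := measurable_hist m s.
rewrite (split_almost_all _ mH (undup_uniq _) H0); last exact: measurableI.
rewrite [in RHS](split_almost_all _ mH (undup_uniq _) H0)//.
rewrite ge0_sume_distrr//; apply: eq_bigr => s _.
have [Ss|Ss] := boolP (S s); last first.
  rewrite (_ : _ `&` _ `&` _ = set0); last first.
    by rewrite -subset0 => t [[/= + _] E]; rewrite E; exact/negP.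
  rewrite (_ : _ `&` _ = set0) ?measure0 ?mule0//.
  by rewrite -subset0 => t [/= + E]; rewrite E; exact/negP.
rewrite (_ : [set t | S (hist m t)] `&` [set t | hist m t = s] = [set t | hist m t = s]); last first.
  by apply/seteqP; split => t /= => [[]//|E]; rewrite E.
rewrite (_ : _ `&` _ `&` _ = [set t | hist m t = s] `&` [set t | next (hist m t) t = w]); last first.
  by apply/seteqP; split => t /= => [[[_ ?] ?]//|[E ?]]; split => //; split => //; rewrite E.
apply: (etrans (probability_next m s w)); have [->//|E0] := Sc _ Ss.
apply: (etrans (congr1 (mule _) E0)); apply/esym.
by apply: (etrans (congr1 (mule _) E0)); rewrite !mule0.
Qed.

End Histories.

(** * Independence from the law of the cylinders *)

Section CylinderIndependence.
Variables (R : realType) (d : nat) (p : R).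
Variables (disp : measure_display) (Omega : measurableType disp).
Variables (P : probability Omega R) (X : vertex d -> nat -> Omega -> vertex d).
Hypothesis mX : forall v n u, measurable (X v n @^-1` [set u]).
Hypothesis X0 : forall v w, X v 0%N w = v.
Hypothesis cyl : forall J h, uniq J -> P (cylinder X J h) =
  (\prod_(u <- J) path_prob p u (h u))%:E.
Implicit Types (u v w : vertex d).

Definition prefix_event v s : set Omega :=
  [set x | mkseq (fun k => X v k x) (size s).+1 = v :: s].

(** The events fixing an initial segment of a path form a pi-system, as two initial
segments are either nested or incompatible; independence extends from it to the
generated sigma-algebra. *)
Definition prefix_system v : set (set Omega) :=
  [set A | A = set0 \/ exists s, A = prefix_event v s].

Lemma measurable_prefix_event v s : measurable (prefix_event v s).
Proof. exact: measurable_prefix mX _ _ _. Qed.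

Lemma probability_prefix_event v s : P (prefix_event v s) = (path_prob p v s)%:E.
Proof.
have := cyl (J := [:: v]) (fun=> s) isT; rewrite big_seq1 => <-.
congr (P _); apply/seteqP; split => x /=.
  by move=> H u; rewrite inE => /eqP ->.
by move=> /(_ v (mem_head _ _)).
Qed.

Lemma prefix_event_nil v : prefix_event v [::] = setT.
Proof. by apply/seteqP; split => // x _; rewrite /prefix_event /= /mkseq /= X0. Qed.

Lemma prefix_system_measurable v : prefix_system v `<=` measurable.
Proof. by move=> A [->//|[s ->]]; exact: measurable_prefix_event. Qed.

Lemma prefix_event_take v s n x : prefix_event v s x -> prefix_event v (take n s) x.
Proof.
rewrite /prefix_event /= => H.
have := congr1 (take (size (take n s)).+1) H.
rewrite /mkseq -map_take take_iota (minn_idPl _); last first.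
  by rewrite ltnS size_take; case: ltnP => // /ltnW.
by move=> -> /=; rewrite size_take; case: ltnP => // ns; rewrite take_size take_oversize.
Qed.

Lemma prefix_system_setI v : setI_closed (prefix_system v).
Proof.
have main s1 s2 : (size s1 <= size s2)%N -> prefix_system v (prefix_event v s1 `&` prefix_event v s2).
  move=> s12; have [E|E] := eqVneq (take (size s1) s2) s1.
    right; exists s2; apply/seteqP; split => x; first by move=> [].
    by move=> H; split => //; rewrite -E; exact: prefix_event_take.
  left; rewrite -subset0 => x [H1 /(prefix_event_take (size s1))].
  move: H1; rewrite /prefix_event /= size_takel// => -> [].
  by move/esym/eqP; rewrite (negbTE E).
move=> A B [->|[s1 ->]]; first by rewrite set0I; left.
move=> [->|[s2 ->]]; first by rewrite setI0; left.
have [/main//|/ltnW/main] := leqP (size s1) (size s2).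
by rewrite setIC.
Qed.

Lemma path_sigma_prefix v : path_sigma X v `<=` <<s prefix_system v >>.
Proof.
apply: smallest_sub; first exact: smallest_sigma_algebra.
move=> A [n [u ->]].
rewrite (_ : _ @^-1` _ = \bigcup_(s in [set s | size s = n /\ last v s = u]) prefix_event v s).
  rewrite bigcup_mkcond.
  apply: (@countable_bigcupT_measurable _ (g_sigma_algebraType (prefix_system v))) => // s.
  case: ifP => _; last exact: (@measurable0 _ (g_sigma_algebraType (prefix_system v))).
  by apply: sub_sigma_algebra; right; exists s.
apply/seteqP; split => x /=.
  move=> Xu; pose s := behead (mkseq (fun k => X v k x) n.+1).
  have Es : mkseq (fun k => X v k x) n.+1 = v :: s by rewrite /s /mkseq /= X0.
  have ss : size s = n by rewrite /s size_behead size_mkseq.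
  exists s; last by rewrite /prefix_event /= ss.
  split => //; have := congr1 (last v) Es; rewrite mkseqS last_rcons /= => <-.
  exact: Xu.
move=> [s [<- <-]]; rewrite /prefix_event => /= /(congr1 (last v)).
by rewrite mkseqS last_rcons.
Qed.

(** The frogs in [J1] have arbitrary events and those in [J2] initial segments.  Moving
a frog from [J2] to [J1] compares two finite measures that agree on a pi-system: the
probability restricted to the other events, and the product. *)
Lemma independent_prefix (J1 J2 : seq (vertex d)) (A : vertex d -> set Omega) :
  uniq (J1 ++ J2) -> (forall v, v \in J1 -> path_sigma X v (A v)) ->
  (forall v, v \in J2 -> prefix_system v (A v)) ->
  P (\bigcap_(v in [set` J1 ++ J2]) A v) = (\prod_(v <- J1 ++ J2) P (A v))%E.
Proof.
elim: J1 J2 A => [|v J1 IHJ1] J2 A /=.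
  move=> uJ _ HA.
  have [H0|H0] := pselect (exists2 v, v \in J2 & A v = set0).
    have [v vJ Av] := H0; rewrite (_ : \bigcap_(_ in _) _ = set0); last first.
      by rewrite -subset0 -Av => x; apply.
    rewrite measure0 big_seq; apply/esym; rewrite -big_seq.
    rewrite (perm_big _ (perm_to_rem vJ)) big_cons /=.
    by rewrite [X in (P X * _)%E]Av measure0 mul0e.
  have Hs v : exists s, v \in J2 -> A v = prefix_event v s.
    have [vJ|_] := boolP (v \in J2); last by exists [::].
    have [Av|[s Av]] := HA v vJ; last by exists s.
    by exfalso; apply: H0; exists v.
  have [h hP] := choice Hs.
  have := cyl h uJ; rewrite (_ : cylinder X J2 h = \bigcap_(v in [set` J2]) A v).
    move=> ->; rewrite -prodEFin [RHS]big_seq big_seq; apply: eq_bigr => v vJ.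
    by rewrite hP// probability_prefix_event.
  by apply/seteqP; split => x H v vJ; have := H v vJ; rewrite hP.
move=> /andP[vJ uJ] H1 H2.
pose B := \bigcap_(w in [set` J1 ++ J2]) A w.
have mA w : w \in J1 ++ J2 -> measurable (A w).
  rewrite mem_cat => /orP[wJ|wJ].
    have := H1 w; rewrite inE wJ orbT => /(_ isT); exact: (path_sigma_measurable mX).
  by apply: (@prefix_system_measurable w); exact: H2.
have mB : measurable B.
  by apply: fin_bigcap_measurable => // w; exact: mA.
have IHB : P B = (\prod_(w <- J1 ++ J2) P (A w))%E.
  by apply: IHJ1 => // w wJ; apply: H1; rewrite inE wJ orbT.
have PB : P B \is a fin_num by rewrite fin_num_measure.
have PB0 : 0 <= fine (P B) by rewrite fine_ge0.
have capE C : \bigcap_(w in [set` v :: J1 ++ J2]) (if w == v then C else A w) = C `&` B.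
  apply/seteqP; split => x /=.
    move=> H; split; first by have := H v (mem_head _ _); rewrite eqxx.
    move=> w wJ; have := H w; rewrite /= inE wJ orbT => /(_ isT).
    by case: eqP => // wv; move: vJ; rewrite -wv wJ.
  by move=> [Cx Bx] w /=; rewrite inE; case: eqP => //= _ wJ; exact: Bx.
suff main C : <<s prefix_system v >> C -> P (C `&` B) = (P C * P B)%E.
  rewrite big_cons -IHB -main; last by apply: path_sigma_prefix; apply: H1; exact: mem_head.
  rewrite -capE; congr (P _); apply: eq_bigcapr => w _; by case: eqP => // ->.
move=> sC.
have := @g_sigma_algebra_measure_unique _ R Omega (prefix_system v)
  (@prefix_system_measurable v) (fun=> setT) _ _
  (mrestr P mB) (mscale (NngNum PB0) P) (@prefix_system_setI v) _ _ C sC.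
rewrite /mrestr /mscale => H.
have -> : P (C `&` B) = ((NngNum PB0)%:num%:E * P C)%E; last first.
  by rewrite /= fineK// muleC.
apply: H.
- by move=> _; right; exists [::]; rewrite prefix_event_nil.
- by rewrite bigcup_const.
- move=> D GD; transitivity (P D * P B)%E; last first.
    by rewrite -[RHS]/((fine (P B))%:E * P D)%E fineK// muleC.
  rewrite -[LHS]/(P (D `&` B)) -capE.
  have := IHJ1 (v :: J2) (fun w => if w == v then D else A w).
  have perm : perm_eq (J1 ++ v :: J2) (v :: J1 ++ J2) by rewrite -cat1s perm_catCA.
  rewrite (perm_big _ perm) (perm_uniq perm)/= vJ uJ => /(_ isT).
  have -> : [set` J1 ++ v :: J2] = [set` v :: J1 ++ J2].
    by apply/seteqP; split => x /=; rewrite (perm_mem perm).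
  move=> ->.
  + rewrite big_cons eqxx IHB; congr (_ * _)%E.
    rewrite big_seq [RHS]big_seq; apply: eq_bigr => w wJ.
    by case: eqP => // wv; move: vJ; rewrite -wv wJ.
  + move=> w wJ; case: eqP => [wv|_]; last by apply: H1; rewrite inE wJ orbT.
    by move: vJ; rewrite -wv mem_cat wJ.
  + move=> w; rewrite inE; case: eqP => [->//|_ /= wJ]; exact: H2.
- by move=> _; rewrite -[X in (X < _)%E]/(P (setT `&` B)) setTI (le_lt_trans (probability_le1 _ _))// ltry.
Qed.

Lemma is_nbFM_of_cylinders : is_nbFM p P X.
Proof.
split; [exact: mX| |].
  by move=> v s; exact: probability_prefix_event.
move=> J A uJ HA.
by have := @independent_prefix J [::] A; rewrite cats0; apply.
Qed.

End CylinderIndependence.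

(** * Existence of the frog paths *)

Section StepDistribution.
Variables (R : realType) (d : nat) (p : R).
Hypothesis d2 : (2 <= d)%N.
Hypothesis p01 : 0 < p < 1 / 2.
Implicit Types (u v w t : vertex d) (q : seq (vertex d)).

Let d0 : (d%:R : R) != 0. Proof. by rewrite pnatr_eq0; case: d d2. Qed.
Let d1 : (d%:R - 1 : R) != 0.
Proof. by rewrite subr_eq0 pnatr_eq1; case: d d2 => [|[]]. Qed.
Let d1' : 0 <= (d%:R - 1 : R).
Proof. by rewrite subr_ge0 ler1n ltnW. Qed.
Let phat01 : 0 <= phat p <= 1.
Proof. by have /andP[h1 h2] := phat_bounds p01; rewrite !ltW. Qed.
Let pstar01 : 0 <= pstar d p <= 1.
Proof.
have /andP[h1 h2] := pstar_bounds d2 p01; have /andP[_ h3] := phat01.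
by rewrite (ltW h1) (le_trans h2).
Qed.

Definition neighbours u : seq (vertex d) :=
  if u == root_vertex then [:: root_vertex] else behead u :: children u.

Definition moves v q : seq (vertex d) :=
  if q is [::] then
    if v == root_vertex then children v else behead v :: children v
  else neighbours (last v q).

Lemma neighbours_uniq u : uniq (neighbours u).
Proof.
by rewrite /neighbours; case: ifP => //= _; rewrite behead_children children_uniq.
Qed.

Lemma moves_uniq v q : uniq (moves v q).
Proof.
rewrite /moves; case: q => [|*]; last exact: neighbours_uniq.
by case: ifP => _; rewrite /= ?behead_children children_uniq.
Qed.

Lemma not_child i u w : w \notin children (i :: u) -> is_parent (i :: u) w = false.
Proof.
by move=> wu; apply/negP => /is_parent_consE[j E]; move: wu; rewrite E;
  apply/negP; rewrite negbK; apply/childrenP; exists j.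
Qed.

Lemma not_parent i u w : w != u -> is_parent w (i :: u) = false.
Proof. by move=> /negbTE wu; rewrite /is_parent /= wu. Qed.

Lemma next_step_ge0 t u w : 0 <= next_step p t u w.
Proof.
have /andP[h0 h1] := phat01; rewrite /next_step.
case: ifP => _; first exact: ler0n.
case: ifP => _.
  case: ifP => // _; case: ifP => // _.
  by rewrite divr_ge0// subr_ge0.
by case: ifP => // _; case: ifP => // _; rewrite invr_ge0.
Qed.

Lemma step_prob_ge0 v q w : 0 <= step_prob p v q w.
Proof.
case: q => [|*]; last exact: next_step_ge0.
have /andP[h0 h1] := pstar01; rewrite /= /first_step.
case: ifP => _; first by case: ifP => // _; rewrite invr_ge0.
case: ifP => // _; case: ifP => // _.
by rewrite divr_ge0// subr_ge0.
Qed.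

Lemma next_step_out t u w : w \notin neighbours u -> next_step p t u w = 0.
Proof.
rewrite /neighbours /next_step; case: u => [|i u] /=.
  by rewrite inE => /negbTE ->.
rewrite inE negb_or => /andP[wu wc].
by rewrite !(not_child wc) !(not_parent i wu) !if_same.
Qed.

Lemma next_step_adjacent t u w : next_step p t u w != 0 ->
  [|| w == root_vertex, is_parent u w | is_parent w u].
Proof.
move=> H; have : w \in neighbours u.
  by apply: contraNT H => /(next_step_out t) ->.
rewrite /neighbours; case: u {H} => [|i u] /=; first by rewrite inE => ->.
rewrite inE => /orP[/eqP ->|/childrenP[j ->]]; rewrite is_parent_cons ?orbT//.
Qed.

(** Without adjacency of [t] and [u] all the probabilities [next_step p t u w] are
zero, so the sum is 1 only along paths that can occur. *)
Lemma next_step_sum t u : [|| u == root_vertex, is_parent t u | is_parent u t] ->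
  \sum_(w <- neighbours u) next_step p t u w = 1.
Proof.
case: u => [|i u] /=; first by move=> _; rewrite big_seq1 /next_step eqxx.
rewrite /neighbours /= big_cons sum_children => /orP[H|/is_parent_consE[j ->]].
  have -> : t = u by move: H => /andP[_ /eqP].
  rewrite {1}/next_step /= is_parent_consF is_parent_cons.
  under eq_bigr do rewrite next_step_down.
  by rewrite add0r sumr_const card_ord -[LHS]mulr_natl divff.
rewrite next_step_up_parent.
under eq_bigr do rewrite next_step_up_child.
rewrite (bigD1 j)//= eqxx add0r.
rewrite (eq_bigr (fun=> (1 - phat p) / (d%:R - 1))); last by move=> k /negbTE ->.
rewrite sumr_const cardC1 card_ord -[X in _ + X]mulr_natl.
rewrite (_ : d.-1%:R = d%:R - 1 :> R); last first.
  by case: (d) d2 => // n _; rewrite /= -natr1 addrK.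
by field.
Qed.

Lemma first_step_sum v : \sum_(w <- moves v [::]) first_step p v w = 1.
Proof.
case: v => [|i v] /=.
  rewrite sum_children; under eq_bigr do rewrite first_step_root.
  by rewrite sumr_const card_ord -[LHS]mulr_natl divff.
rewrite big_cons sum_children first_step_parent.
under eq_bigr do rewrite first_step_child.
by rewrite sumr_const card_ord -[X in _ + X]mulr_natl; field.
Qed.

Lemma first_step_out v w : w \notin moves v [::] -> first_step p v w = 0.
Proof.
rewrite /first_step; case: v => [|i v] /=.
  move=> wc; have -> // : is_parent [::] w = false.
  apply/negP => /is_parent_consE[j E]; move: wc; rewrite E; apply/negP.
  by rewrite negbK; apply/childrenP; exists j.
by rewrite inE negb_or => /andP[wu wc]; rewrite (not_child wc) (not_parent i wu).
Qed.

Lemma step_prob_rcons v q u w :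
  step_prob p v (rcons q u) w = next_step p (last v q) u w.
Proof.
rewrite (@step_prob_ends _ _ p v (rcons q u) (belast v q) (last v q) u)//.
by rewrite -rcons_cons lastI.
Qed.

Lemma moves_rcons v q u : moves v (rcons q u) = neighbours u.
Proof. by case: q => [|x q] //=; rewrite last_rcons. Qed.

Lemma step_prob_sum v q : path_prob p v q != 0 ->
  \sum_(w <- moves v q) step_prob p v q w = 1.
Proof.
case: (lastP q) => [|q' u]; first by move=> _; exact: first_step_sum.
rewrite path_prob_rcons mulf_eq0 negb_or => /andP[_ H].
rewrite moves_rcons; under eq_bigr do rewrite step_prob_rcons.
apply: next_step_sum; move: H; case: (lastP q') => [|q'' t]; last first.
  by rewrite step_prob_rcons last_rcons; exact: next_step_adjacent.
rewrite /= => H; have : u \in moves v [::].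
  by apply: contraNT H => /first_step_out ->.
rewrite /moves; case: v {H} => [|i v] /=; last first.
  by rewrite inE => /orP[/eqP ->|/childrenP[j ->]]; rewrite is_parent_cons ?orbT.
by move=> /childrenP[j ->]; rewrite is_parent_cons.
Qed.

Lemma step_prob_out v q w : w \notin moves v q -> step_prob p v q w = 0.
Proof.
case: (lastP q) => [|q' u]; first exact: first_step_out.
by rewrite moves_rcons step_prob_rcons; exact: next_step_out.
Qed.

End StepDistribution.

Section Construction.
Variables (R : realType) (d : nat) (p : R).
Hypothesis d2 : (2 <= d)%N.
Hypothesis p01 : 0 < p < 1 / 2.
Implicit Types (u v w t : vertex d) (q s : seq (vertex d)).

(** The frog whose next step is revealed at time [m]; through [pickle] every frog has
infinitely many turns. *)
Definition frog (m : nat) : vertex d :=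
  if (unpickle m : option (vertex d * nat)) is Some vn then vn.1 else [::].

Definition count_steps v m : nat := count (fun k => frog k == v) (iota 0 m).

Lemma count_stepsS v m : count_steps v m.+1 = (count_steps v m + (frog m == v))%N.
Proof. by rewrite /count_steps -addn1 iotaD count_cat /= addn0. Qed.

Lemma count_steps_le v m m' : (m <= m')%N -> (count_steps v m <= count_steps v m')%N.
Proof. by move=> mm'; rewrite -(subnKC mm') /count_steps iotaD count_cat leq_addr. Qed.

Lemma count_steps_unbounded v n : exists m, (n <= count_steps v m)%N.
Proof.
pose l := [seq pickle (v, k) | k <- iota 0 n].
have ul : uniq l by rewrite map_inj_uniq ?iota_uniq// => i j /(pcan_inj pickleK)[].
exists (\max_(m <- l) m).+1.
rewrite -[X in (X <= _)%N](_ : size l = n); last by rewrite size_map size_iota.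
rewrite /count_steps -size_filter; apply: uniq_leq_size => // m ml.
rewrite mem_filter mem_iota /= add0n ltnS (leq_bigmax_seq _ ml)// andbT.
by move: ml => /mapP[k _ ->]; rewrite /frog pickleK.
Qed.

Fixpoint revealed v (s : seq (vertex d)) : seq (vertex d) :=
  if s is w :: s' then
    if frog (size s') == v then rcons (revealed v s') w else revealed v s'
  else [::].

Lemma size_revealed v s : size (revealed v s) = count_steps v (size s).
Proof.
elim: s => [|w s IHs] //=; rewrite count_stepsS -IHs.
by case: ifP => _; rewrite ?size_rcons ?addn1 ?addn0.
Qed.

Let fr s := frog (size s).
Let past s := revealed (fr s) s.

(** After a past of probability zero any choice will do; the root is taken. *)
Definition candidates s : seq (vertex d) :=
  if path_prob p (fr s) (past s) != 0 then moves (fr s) (past s) else [:: [::]].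

Definition reveal_prob s w : R :=
  if path_prob p (fr s) (past s) != 0 then step_prob p (fr s) (past s) w
  else (w == [::])%:R.

Lemma candidates_uniq s : uniq (candidates s).
Proof. by rewrite /candidates; case: ifP => // _; exact: moves_uniq. Qed.

Lemma reveal_prob_ge0 s w : 0 <= reveal_prob s w.
Proof. by rewrite /reveal_prob; case: ifP => // _; exact: step_prob_ge0. Qed.

Lemma reveal_prob_sum s : \sum_(w <- candidates s) reveal_prob s w = 1.
Proof.
rewrite /candidates /reveal_prob; case: ifP => H; first exact: step_prob_sum.
by rewrite big_seq1 eqxx.
Qed.

Lemma reveal_prob_out s w : w \notin candidates s -> reveal_prob s w = 0.
Proof.
rewrite /candidates /reveal_prob; case: ifP => H; first exact: step_prob_out.
by rewrite inE => /negbTE ->.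
Qed.

Let Omega := measurableTypeR R.
Let P : probability Omega R := @unit_measure R.
Let hist := hist ([::] : vertex d) candidates reveal_prob.

Definition enough v n : nat := ex_minn (count_steps_unbounded v n).

Lemma enoughP v n : (n <= count_steps v (enough v n))%N.
Proof. by rewrite /enough; case: ex_minnP. Qed.

Definition position v n (x : Omega) : vertex d :=
  nth [::] (v :: revealed v (hist (enough v n) x)) n.

Lemma revealed_prefix v m m' x : (m <= m')%N ->
  prefix (revealed v (hist m x)) (revealed v (hist m' x)).
Proof.
move=> /subnKC <-; elim: (m' - m)%N => [|k IHk]; first by rewrite addn0 prefix_refl.
rewrite addnS /=; case: ifP => _ //.
by apply: prefix_trans IHk _; exact: prefix_rcons.
Qed.

Lemma size_revealed_hist v m x : size (revealed v (hist m x)) = count_steps v m.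
Proof. by rewrite size_revealed size_hist. Qed.

Lemma positionE v n m x : (n <= count_steps v m)%N ->
  position v n x = nth [::] (v :: revealed v (hist m x)) n.
Proof.
move=> nm; rewrite /position; case: n nm => // n nm /=.
have h m1 m2 : (n < count_steps v m1)%N -> (m1 <= m2)%N ->
    nth [::] (revealed v (hist m1 x)) n = nth [::] (revealed v (hist m2 x)) n.
  move=> n1 /(revealed_prefix v x)/prefixP[r ->].
  by rewrite nth_cat size_revealed_hist n1.
have [le|lt] := leqP (enough v n.+1) m; first by apply: h le; exact: enoughP.
by apply/esym; apply: h => //; exact: ltnW.
Qed.

Lemma mkseq_position v n m x : (n <= count_steps v m)%N ->
  mkseq (fun k => position v k x) n.+1 = v :: take n (revealed v (hist m x)).
Proof.
move=> nm; apply: (@eq_from_nth _ [::]).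
  by rewrite size_mkseq /= size_takel// size_revealed_hist.
move=> k; rewrite size_mkseq => kn.
rewrite nth_mkseq// (@positionE _ _ m); last by rewrite (leq_trans _ nm).
by case: k kn => //= k kn; rewrite nth_take.
Qed.

(** One of the two sequences is an initial segment of the other. *)
Definition agree (a b : seq (vertex d)) : bool :=
  take (size b) a == take (size a) b.

Lemma agree_rcons_long a b w : (size b <= size a)%N -> agree (rcons a w) b = agree a b.
Proof.
move=> ba; rewrite /agree -cats1 takel_cat//.
have -> : take (size (a ++ [:: w])) b = b.
  by apply: take_oversize; rewrite size_cat (leq_trans ba)// leq_addr.
by have -> : take (size a) b = b by exact: take_oversize.
Qed.

Lemma agree_rcons_short a b w : (size a < size b)%N ->
  agree (rcons a w) b = agree a b && (w == nth [::] b (size a)).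
Proof.
move=> ab; rewrite /agree size_rcons (take_nth [::] ab).
have -> : take (size b) (rcons a w) = rcons a w.
  by apply: take_oversize; rewrite size_rcons.
have -> : take (size b) a = a by apply: take_oversize; exact: ltnW.
exact: eqseq_rcons.
Qed.

Definition matches J (h : vertex d -> seq (vertex d)) s : bool :=
  all (fun v => agree (revealed v s) (h v)) J.

Lemma matches_skip J h w s : fr s \notin J \/ (size (h (fr s)) <= size (past s))%N ->
  matches J h (w :: s) = matches J h s.
Proof.
move=> H; apply: eq_in_all => v vJ /=; case: eqP => // E.
case: H => [|H]; first by rewrite /fr E vJ.
by rewrite agree_rcons_long// -E.
Qed.

Lemma matches_step J h w s : fr s \in J -> (size (past s) < size (h (fr s)))%N ->
  matches J h (w :: s) = matches J h s && (w == nth [::] (h (fr s)) (size (past s))).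
Proof.
move=> fJ H; apply/idP/andP.
  move=> /allP HJ; split; last first.
    by have := HJ _ fJ; rewrite /= eqxx agree_rcons_short// => /andP[].
  apply/allP => v vJ; have := HJ _ vJ; rewrite /=; case: eqP => // E.
  by rewrite agree_rcons_short -?E// => /andP[].
move=> [/allP HJ Hw]; apply/allP => v vJ /=; case: eqP => [E|_]; last exact: HJ.
by rewrite agree_rcons_short -?E// Hw HJ.
Qed.

(** Revealing one more step multiplies both sides by the same step probability if the
frog is in [J] and its prescribed path is not exhausted, and changes neither side
otherwise. *)
Lemma probability_matches J h m : uniq J ->
  P [set x | matches J h (hist m x)] =
  (\prod_(v <- J) path_prob p v (take (count_steps v m) (h v)))%:E.
Proof.
move=> uJ; elim: m => [|m IHm].
  rewrite (_ : [set x | _] = setT); last first.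
    by apply/seteqP; split => // x _ /=; apply/allP => v _; rewrite /= /agree take0.
  rewrite probability_setT; congr EFin; apply/esym/big1_seq => v _.
  by rewrite /count_steps /= take0.
have frE x : fr (hist m x) = frog m by rewrite /fr size_hist.
have pastE x : past (hist m x) = revealed (frog m) (hist m x) by rewrite /past frE.
have [skip|] := boolP ((frog m \notin J) || (size (h (frog m)) <= count_steps (frog m) m)%N).
  rewrite (_ : [set x | _] = [set x | matches J h (hist m x)]); last first.
    apply/seteqP; split => x /=; rewrite matches_skip ?frE ?pastE ?size_revealed_hist//;
    by case/orP : skip; [left|right].
  rewrite IHm; congr EFin; apply: eq_big_seq => v vJ; rewrite count_stepsS.
  case: eqP => [E|_]; last by rewrite addn0.
  move: skip; rewrite E vJ /= => sz.
  by rewrite !take_oversize// (leq_trans sz) ?leq_addr.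
rewrite negb_or negbK -ltnNge => /andP[fJ lt].
set f := frog m in fJ lt frE pastE *; set w := nth [::] (h f) (count_steps f m).
set q := take (count_steps f m) (h f).
have qE s : size s = m -> matches J h s -> past s = q.
  move=> sm /allP/(_ f fJ); rewrite /agree -/f.
  have -> : past s = revealed f s by rewrite /past /fr sm.
  have -> : size (revealed f s) = count_steps f m by rewrite size_revealed sm.
  have -> : take (size (h f)) (revealed f s) = revealed f s.
    by apply: take_oversize; rewrite size_revealed sm; exact: ltnW.
  by move=> /eqP.
have next_hist x : hist m.+1 x = next [::] candidates reveal_prob (hist m x) x :: hist m x by [].
have E1 : [set x | matches J h (hist m.+1 x)] = [set x | matches J h (hist m x)] `&`
    [set x | next [::] candidates reveal_prob (hist m x) x = w].
  apply/seteqP; split => x /=; rewrite matches_step ?frE ?pastE ?size_revealed_hist//.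
    by move=> /andP[-> /eqP].
  by move=> [-> ->]; rewrite eqxx.
pose c := step_prob p f q w.
have prodE k : (\prod_(v <- J) path_prob p v (take (count_steps v k) (h v))) =
    path_prob p f (take (count_steps f k) (h f)) *
    \prod_(v <- J | v != f) path_prob p v (take (count_steps v k) (h v)).
  by rewrite (bigD1_seq f).
have rest : \prod_(v <- J | v != f) path_prob p v (take (count_steps v m.+1) (h v)) =
    \prod_(v <- J | v != f) path_prob p v (take (count_steps v m) (h v)).
  apply: eq_bigr => v /negbTE vf; rewrite count_stepsS -/f eq_sym vf addn0 //.
have key : take (count_steps f m.+1) (h f) = rcons q w.
  by rewrite count_stepsS -/f eqxx addn1 (take_nth [::]).
rewrite E1 [LHS](@probability_next_event R _ [::] candidates reveal_prob candidates_uniq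
  reveal_prob_ge0 reveal_prob_sum reveal_prob_out m (matches J h) w c).
  rewrite [X in (_ * X)%E]IHm -EFinM; congr EFin.
  by rewrite !prodE rest key path_prob_rcons -/q -/c; ring.
move=> s ms; have [sm|sm] := eqVneq (size s) m; last first.
  right; rewrite (_ : [set x | _] = set0) ?measure0// -subset0 => x /= E.
  by move: sm; rewrite -E size_hist eqxx.
have frs : fr s = f by rewrite /fr sm.
have [q0|q0] := eqVneq (path_prob p f q) 0; last first.
  by left; rewrite /reveal_prob (qE s sm ms) frs q0.
right; apply/eqP; rewrite eq_le measure_ge0 andbT.
have -> : 0%E = P [set x | matches J h (hist m x)] by rewrite IHm prodE -/q q0 mul0r.
have mh s' : measurable [set x | hist m x = s'] by exact: measurable_hist.
apply: le_measure; rewrite ?inE; first exact: mh.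
  rewrite (_ : [set x | _] = \bigcup_(s in [set s | matches J h s]) [set x | hist m x = s]).
    exact: measurable_bigcup_count.
  apply/seteqP; split => x /=; first by move=> H; exists (hist m x).
  by move=> [s' Hs' ->].
move=> x E; rewrite -[X in X x]/[set x | matches J h (hist m x)] /=.
by rewrite (E : hist m x = s).
Qed.

Lemma measurable_position_itv v n u : measurable (position v n @^-1` [set u]).
Proof.
rewrite (_ : _ @^-1` _ = \bigcup_(s in [set s | nth [::] (v :: revealed v s) n = u])
    [set x | hist (enough v n) x = s]).
  by apply: measurable_bigcup_count => s; exact: measurable_hist.
apply/seteqP; split => x /=; last by move=> [s Hs E]; rewrite /position E.
by move=> <-; exists (hist (enough v n) x).
Qed.

Lemma probability_position_cylinder J h : uniq J ->
  P (cylinder position J h) = (\prod_(u <- J) path_prob p u (h u))%:E.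
Proof.
move=> uJ; pose m := \max_(v <- J) enough v (size (h v)).
have hm v : v \in J -> (size (h v) <= count_steps v m)%N.
  move=> vJ; apply: leq_trans (enoughP v _) _; apply: count_steps_le.
  by rewrite /m; apply: leq_bigmax_seq.
have := probability_matches h m uJ.
rewrite (_ : [set x | _] = cylinder position J h).
  move=> ->; congr EFin; apply: eq_big_seq => v vJ.
  by rewrite take_oversize// hm.
apply/seteqP; split => x /=.
  move=> /allP H v vJ; rewrite (mkseq_position _ (hm v vJ)).
  have := H v vJ; rewrite /agree size_revealed_hist => /eqP ->.
  by rewrite take_oversize// hm.
move=> H; apply/allP => v vJ; have := H v vJ; rewrite (mkseq_position _ (hm v vJ)) => -[E].
by rewrite /agree size_revealed_hist E take_oversize// hm.
Qed.

Theorem nbFM_exists : is_nbFM p P position.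
Proof.
apply: is_nbFM_of_cylinders.
- exact: measurable_position_itv.
- by [].
- exact: probability_position_cylinder.
Qed.

End Construction.

(** * Activation chains *)

Section LegalPaths.
Variables (R : realType) (d : nat) (p : R).
Implicit Types (u v w : vertex d) (z : nat -> vertex d).

Definition legal_path u z : Prop :=
  [/\ z 0%N = u, first_step p u (z 1%N) != 0
    & forall n, next_step p (z n) (z n.+1) (z n.+2) != 0].

(** A path without forbidden steps first climbs, then descends for ever unless it has
reached the root, where it stays.  The bound on [n] in the second case limits the time
at which a given vertex can be entered by a descending step. *)
Definition phase u z n : Prop :=
  [\/ (n <= size u)%N /\ forall k, (k <= n)%N -> z k = drop k u,
      exists m, [/\ n = m.+1, is_parent (z m) (z n) & (n <= size u + size (z n))%N]
    | exists m, [/\ n = m.+1, z m = [::] & z n = [::]]].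

Lemma legal_phase u z n : legal_path u z -> phase u z n.
Proof.
move=> [z0 zfirst znext]; elim: n => [|n IHn].
  by constructor 1; split => // -[|k]//; rewrite drop0.
case: n IHn => [|m] IHm.
  have : z 1%N \in moves u [::].
    by apply: contraNT zfirst => /(first_step_out p) ->.
  rewrite /moves; case: u z0 {zfirst IHm} => [|i u] z0 /=.
    move=> /childrenP[j E]; constructor 2; exists 0%N; rewrite E z0.
    by rewrite is_parent_cons.
  rewrite inE => /orP[/eqP E|/childrenP[j E]].
    by constructor 1; split => // -[|[|k]] // _; rewrite /= E /= drop0.
  constructor 2; exists 0%N; rewrite E z0 is_parent_cons; split => //=.
have nn := znext m.
have nbr : z m.+2 \in neighbours (z m.+1).
  by apply: contraNT nn => /(next_step_out p (z m)) ->.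
have dead : z m.+1 = [::] -> phase u z m.+2.
  move=> zm; constructor 3; exists m.+1; split => //.
  by move: nbr; rewrite zm /neighbours /= inE => /eqP.
case: IHm => [[mu zup]|[k [[mk] par le]]|[k [_ _ /dead//]]]; last first.
  have [i E] := is_parent_consE par; rewrite -mk in E par.
  move: nbr; rewrite E /neighbours /= inE => /orP[/eqP zz|/childrenP[j zz]].
    by move: nn; rewrite E zz /next_step /= is_parent_consF is_parent_cons eqxx.
  constructor 2; exists m.+1; rewrite zz -E is_parent_cons; split => //=.
  by rewrite addnS ltnS; move: le; rewrite E.
have zm1 : z m.+1 = drop m.+1 u by apply: zup.
case E : (z m.+1) => [|j v]; first exact: dead.
have lt : (m.+1 < size u)%N.
  by rewrite ltn_neqAle mu andbT; apply/eqP => mE; move: zm1; rewrite E mE drop_size.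
move: nbr; rewrite E /neighbours /= inE => /orP[/eqP zz|/childrenP[i zz]].
  constructor 1; split => // k; rewrite leq_eqVlt => /orP[/eqP ->|]; last exact: zup.
  by rewrite zz -[m.+2]addn1 addnC -drop_drop -zm1 E /= drop0.
constructor 2; exists m.+1; rewrite zz -E is_parent_cons; split => //=.
by rewrite addnS ltnS (leq_trans (ltnW lt))// leq_addr.
Qed.

Lemma legal_step u z n : legal_path u z ->
  is_parent (z n) (z n.+1) /\ (n < size u + size (z n.+1))%N \/ suffix (z n.+1) u.
Proof.
move=> /(legal_phase n.+1)[[nu zup]|[m [[<-] par le]]|[m [_ _ ->]]].
- by right; rewrite zup//; apply/suffixP; exists (take n.+1 u); rewrite cat_take_drop.
- by left.
- by right; exact: suffix0s.
Qed.

Fixpoint climb u : seq (vertex d) := if u is _ :: u' then u' :: climb u' else [::].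

Lemma size_climb u : size (climb u) = size u.
Proof. by elim: u => //= i u ->. Qed.

Lemma nth_climb u k : nth [::] (u :: climb u) k = drop k u.
Proof.
by elim: u k => [|i u IHu] [|k] //=; rewrite nth_nil.
Qed.

Lemma legal_root_hit u z a : legal_path u z -> z a <> root_vertex ->
  z a.+1 = root_vertex -> a.+1 = size u /\ mkseq z (size u).+1 = u :: climb u.
Proof.
move=> lz za za1; case: (legal_phase a.+1 lz) => [[nu zup]|[m [_]]|[m [[<-] /za]]]//.
  have E : a.+1 = size u.
    apply/eqP; rewrite eqn_leq nu/=.
    by have := congr1 size (zup _ (leqnn a.+1)); rewrite za1 size_drop /= => /esym/eqP; rewrite subn_eq0.
  split => //; apply: (@eq_from_nth _ [::]); first by rewrite size_mkseq /= size_climb.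
  move=> k; rewrite size_mkseq ltnS => ku; rewrite nth_mkseq// nth_climb.
  by apply: zup; rewrite E.
by rewrite za1 => /is_parent_consE[].
Qed.

End LegalPaths.

Section ActivationChains.
Variables (R : realType) (d : nat) (p : R).
Variable x : vertex d -> nat -> vertex d.
Hypothesis legal : forall u, legal_path p u (x u).
Implicit Types (u v w : vertex d).

Definition awake t v : bool := age x t v.

Lemma awakeS t v : awake t v -> awake t.+1 v.
Proof. by rewrite /awake /=; case: (age x t v). Qed.

Lemma awake_root t : awake t [::].
Proof. by elim: t => [|t /awakeS]. Qed.

Lemma awake_visited t u a : age x t u = Some a -> awake t.+1 (x u a.+1).
Proof.
move=> ua; rewrite /awake /=; case: (age x t _) => //; rewrite ifT//.
by apply/asboolP; exists u, a.
Qed.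

Lemma awakeSP t v : awake t.+1 v ->
  awake t v \/ ~~ awake t v /\ exists u a, age x t u = Some a /\ x u a.+1 = v.
Proof.
rewrite /awake /=; case: (age x t v) => [b|]; first by left.
by case: ifP => // /asboolP H _; right.
Qed.

Lemma awake_position t u a : age x t u = Some a -> awake t (x u a).
Proof.
have x0 v : x v 0%N = v by have [] := legal v.
elim: t u a => [|t IHt] u a /=.
  by case: ifP => // /eqP -> [<-]; rewrite x0.
case E : (age x t u) => [b|].
  move=> [<-]; rewrite /awake /=; case F : (age x t (x u b.+1)) => [c|] //.
  by rewrite ifT//; apply/asboolP; exists u, b.
case: ifP => // /asboolP H [<-]; rewrite x0 /awake /= E ifT//; exact/asboolP.
Qed.

(** Awake frogs sit at a set of vertices closed under ancestors.  Hence a climbing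
particle, which only meets ancestors of its starting point, never wakes a frog. *)
Lemma awake_suffix t v w : awake t v -> suffix w v -> awake t w.
Proof.
elim: t v w => [|t IHt] v w.
  by rewrite /awake /=; case: ifP => // /eqP -> _; rewrite suffixs0 => ->.
move=> /awakeSP[vt wv|[vt [u [a [ua xv]]]] wv]; first exact: awakeS (IHt _ _ vt wv).
have [[]|] := legal_step a (legal u); rewrite xv; last first.
  by move=> vu; move: vt; rewrite (IHt u v)// /awake ua.
move=> /is_parent_consE[i E] _; move: wv; rewrite E => /suffixP[[|j r] /=].
  by move=> <-; rewrite -E -xv; exact: awake_visited.
move=> [_ Er]; apply: awakeS; apply: (IHt (x u a)); first exact: awake_position ua.
by apply/suffixP; exists r.
Qed.

Definition descends u v : Prop :=
  exists2 n, (n < size u + size v)%N & x u n.+1 = v /\ is_parent (x u n) v.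

Fixpoint chain u (s : seq (vertex d)) : Prop :=
  if s is w :: s' then descends u w /\ chain w s' else True.

Lemma chain_rcons u s v : chain u (rcons s v) <-> chain u s /\ descends (last u s) v.
Proof.
elim: s u => [|w s IHs] u /=; first by tauto.
by split; [move=> [h /IHs[]]|move=> [[h1 h2] h3]; split => //; apply/IHs].
Qed.

(** The frog that wakes [v] was awake strictly earlier, which makes the frogs of the
chain distinct. *)
Lemma awake_chain t v : awake t v -> exists s,
  [/\ uniq ([::] :: s), last [::] s = v, chain [::] s & forall w, w \in s -> awake t w].
Proof.
elim: t v => [|t IHt] v.
  by rewrite /awake /=; case: ifP => // /eqP -> _; exists [::].
move=> /awakeSP[/IHt[s [h1 h2 h3 h4]]|[vt [u [a [ua xv]]]]].
  by exists s; split => // w /h4/awakeS.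
have [s [h1 h2 h3 h4]] : exists s, [/\ uniq ([::] :: s), last [::] s = u, chain [::] s
  & forall w, w \in s -> awake t w] by apply: IHt; rewrite /awake ua.
have := legal_step a (legal u); rewrite xv => -[[par lt]|]; last first.
  by move=> vu; move: vt; rewrite (@awake_suffix _ u)// /awake ua.
exists (rcons s v); split.
- move: h1; rewrite /= mem_rcons inE rcons_uniq negb_or => /andP[-> ->].
  have -> : v \notin s by apply: contra vt; exact: h4.
  rewrite !andbT; apply: contraNneq vt => <-; exact: awake_root.
- by rewrite last_rcons.
- by apply/chain_rcons; split => //; rewrite h2; exists a.
- move=> w; rewrite mem_rcons inE => /orP[/eqP ->|/h4/awakeS//].
  by rewrite -xv; exact: awake_visited.
Qed.

Lemma age_unique t t' v a : age x t v = Some a -> age x t' v = Some a -> t = t'.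
Proof.
wlog tt' : t t' / (t <= t')%N.
  by move=> H h h'; have [/H|/ltnW/H] := leqP t t'; [exact|move=> H'; apply/esym; exact: H'].
move=> h; rewrite -(subnK tt') (age_add (t' - t) h) => -[] /eqP.
by rewrite -[X in _ == X]add0n eqn_add2r => /eqP ->.
Qed.

(** Distinct root moves belong to distinct frogs, because a frog can only reach the
root by climbing straight from its starting point; their chains end at these frogs and
so are distinct as well. *)
Lemma root_moves_chains k : has_at_least (root_moves x) k ->
  has_at_least [set s : seq (vertex d) | [/\ uniq ([::] :: s), chain [::] s
    & mkseq (x (last [::] s)) (size (last [::] s)).+1 = last [::] s :: climb (last [::] s)]] k.
Proof.
move=> [ms [ums sms Hms]].
have H m : exists s, m \in ms -> [/\ uniq ([::] :: s), chain [::] s, last [::] s = m.1 &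
    mkseq (x m.1) (size m.1).+1 = m.1 :: climb m.1].
  have [/Hms [a [ua xa xa1]]|_] := boolP (m \in ms); last by exists [::].
  have [|s [h1 h2 h3 _]] := @awake_chain m.2 m.1; first by rewrite /awake ua.
  by exists s; split => //; have [] := legal_root_hit (legal _) xa xa1.
have [f fP] := choice H.
exists (map f ms); split; last 1 first.
- by move=> s /mapP[m /fP[h1 h2 h3 h4] ->]; split => //; rewrite h3.
- rewrite map_inj_in_uniq// => m m' mms m'ms E.
  have [_ _ l1 _] := fP _ mms; have [_ _ l2 _] := fP _ m'ms.
  have E1 : m.1 = m'.1 by rewrite -l1 -l2 E.
  have [a [ua xa xa1]] := Hms _ mms; have [b [ub xb xb1]] := Hms _ m'ms.
  have [aE _] := legal_root_hit (legal _) xa xa1.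
  have [bE _] := legal_root_hit (legal _) xb xb1.
  have ab : a = b by apply/eqP; rewrite -eqSS aE bE E1.
  rewrite -ab -E1 in ub.
  have := age_unique ua ub; case: (m) E1 => m1 m2 /=; case: (m') => m1' m2' /= -> ->.
  by [].
- by rewrite size_map.
Qed.

End ActivationChains.

(** * Weights of activation chains *)

(** A vertex of level h weighs [discount ^+ h].  The discount minimises the weight of
the frogs woken by a frog relative to its own weight, and [growth] is that minimum. *)
Section Potential.
Variables (R : realType) (d : nat) (p : R).
Hypothesis d2 : (2 <= d)%N.
Hypothesis p01 : 0 < p < 1 / 2.
Implicit Types (u v w t : vertex d) (s : seq (vertex d)).

Let a := phat p.
Definition discount : R := 2 * a / (1 + a).
Definition growth : R := 4 * a / (1 - a).
Local Notation y := discount.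
Local Notation C := growth.

Let a01 : 0 < a < 1. Proof. exact: phat_bounds. Qed.

Lemma discount_bounds : a < y /\ y < 1.
Proof.
have /andP[a0 a1] := a01; rewrite /discount; split.
  by rewrite ltr_pdivlMr; [nra|lra].
by rewrite ltr_pdivrMr; lra.
Qed.

Let y0 : 0 < y. Proof. by have [h _] := discount_bounds; have /andP[a0 _] := a01; lra. Qed.
Let y1 : 0 < 1 - y. Proof. by have [_ h] := discount_bounds; lra. Qed.

Lemma growth_ge0 : 0 <= C.
Proof. by have /andP[a0 a1] := a01; rewrite /growth divr_ge0//; lra. Qed.

(** The equation of the potential of a climbing frog: it climbs on with probability a
and otherwise descends for ever. *)
Lemma growthE : a * C + (1 - a) * (y ^+ 2 / (1 - y)) = C * y.
Proof.
have /andP[a0 a1] := a01; rewrite /growth /discount.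
by field; rewrite !gt_eqF//; lra.
Qed.

(** Turning back is worth less than climbing, which makes the first step harmless: its
chance [pstar] of climbing is at most [a]. *)
Lemma descent_le_growth : y ^+ 2 / (1 - y) <= C.
Proof.
have /andP[a0 a1] := a01.
have -> : y ^+ 2 / (1 - y) = 4 * a / (1 - a) * (a / (1 + a)).
  by rewrite /discount; field; rewrite !gt_eqF//; lra.
rewrite ler_piMr//; first exact: growth_ge0.
by rewrite ler_pdivrMr; lra.
Qed.

(** Expected total weight of the vertices that will be entered by descending steps,
for a frog that has just stepped from [t] to [u]: exact when it is descending, and an
upper bound when it is climbing, since the climb is stopped at the root. *)
Definition potential t u : R :=
  if u == root_vertex then 0 else if is_parent u t then C * y ^+ size u
  else if is_parent t u then y ^+ (size u).+1 / (1 - y) else 0.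

Definition start_potential u : R :=
  if u == root_vertex then y / (1 - y) else C * y ^+ size u.

Let gain u w : R := (is_parent u w)%:R * y ^+ size w + potential u w.

Lemma potential_ge0 t u : 0 <= potential t u.
Proof.
rewrite /potential; case: ifP => // _; case: ifP => _.
  by rewrite mulr_ge0 ?growth_ge0// exprn_ge0// ltW.
by case: ifP => // _; rewrite divr_ge0 ?exprn_ge0// ltW.
Qed.

Let gain_child u j : gain u (j :: u) = y ^+ (size u).+1 / (1 - y).
Proof.
rewrite /gain /potential is_parent_cons is_parent_consF /= mul1r.
by rewrite [y ^+ (size u).+2]exprS; field; rewrite gt_eqF.
Qed.

Let gain_parent j u : gain (j :: u) u <= C * y ^+ size u.
Proof.
rewrite /gain /potential is_parent_consF mul0r add0r is_parent_cons.
by case: ifP => // _; rewrite mulr_ge0 ?growth_ge0// exprn_ge0// ltW.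
Qed.

Lemma potential_next t u :
  \sum_(w <- neighbours u) next_step p t u w * gain u w <= potential t u.
Proof.
have dn0 : (d%:R : R) != 0 by rewrite pnatr_eq0; case: d d2.
have dn1 : (d%:R - 1 : R) != 0 by rewrite subr_eq0 pnatr_eq1; case: d d2 => [|[]].
case: u => [|i u]; first by rewrite /neighbours /= big_seq1 /gain /potential /= mul0r addr0 mulr0.
rewrite /neighbours /= big_cons sum_children.
have [/is_parent_consE[k ->]|nk] := boolP (is_parent (i :: u) t).
  rewrite next_step_up_parent.
  under eq_bigr do rewrite next_step_up_child gain_child.
  rewrite (bigD1 k)//= eqxx mul0r add0r.
  rewrite (eq_bigr (fun=> (1 - phat p) / (d%:R - 1) * (y ^+ (size u).+2 / (1 - y)))); last first.
    by move=> j /negbTE ->.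
  rewrite sumr_const cardC1 card_ord -[X in _ + X]mulr_natl.
  rewrite (_ : d.-1%:R = d%:R - 1 :> R); last first.
    by case: (d) d2 => // n _; rewrite /= -natr1 addrK.
  rewrite /potential /= is_parent_cons.
  have -> : C * y ^+ (size u).+1 = y ^+ size u * (C * y) by rewrite exprS; ring.
  rewrite -growthE.
  have h : a * gain (i :: u) u <= a * (C * y ^+ size u).
    by apply: ler_wpM2l (gain_parent i u); case/andP: a01 => /ltW.
  apply: le_trans (lerD h (lexx _)) _; rewrite le_eqVlt; apply/orP; left; apply/eqP.
  have -> : y ^+ (size u).+2 = y ^+ size u * y ^+ 2 by rewrite -exprD addn2.
  by rewrite /a; field; rewrite dn1 gt_eqF.
have [/andP[_ /eqP/= ->]|nk'] := boolP (is_parent t (i :: u)).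
  have -> : next_step p u (i :: u) u = 0.
    by rewrite /next_step /= is_parent_consF is_parent_cons.
  under eq_bigr do rewrite next_step_down gain_child.
  rewrite mul0r add0r sumr_const card_ord -[X in X <= _]mulr_natl.
  rewrite /potential /= is_parent_consF is_parent_cons mulrA divff// mul1r.
  exact: lexx.
have z w : next_step p t (i :: u) w = 0.
  by rewrite /next_step /= (negbTE nk) (negbTE nk').
rewrite z mul0r add0r big1 ?potential_ge0// => j _.
by rewrite z mul0r.
Qed.

Lemma potential_first u :
  \sum_(w <- moves u [::]) first_step p u w * gain u w <= start_potential u.
Proof.
have dn0 : (d%:R : R) != 0 by rewrite pnatr_eq0; case: d d2.
case: u => [|i u]; rewrite /moves /=.
  rewrite sum_children; under eq_bigr do rewrite first_step_root gain_child.
  by rewrite sumr_const card_ord -[X in X <= _]mulr_natl mulrA divff// mul1r.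
rewrite big_cons sum_children first_step_parent.
under eq_bigr do rewrite first_step_child gain_child.
rewrite sumr_const card_ord -[X in _ + X]mulr_natl.
have /andP[s0 sa] := pstar_bounds d2 p01; have /andP[a0 a1] := a01.
have h : pstar d p * gain (i :: u) u <= pstar d p * (C * y ^+ size u).
  by apply: ler_wpM2l (gain_parent i u); exact: ltW.
apply: le_trans (lerD h (lexx _)) _.
have -> : d%:R * ((1 - pstar d p) / d%:R * (y ^+ (size (i :: u)).+1 / (1 - y))) =
  y ^+ size u * ((1 - pstar d p) * (y ^+ 2 / (1 - y))).
  have -> : y ^+ (size (i :: u)).+1 = y ^+ size u * y ^+ 2 by rewrite -exprD addn2.
  by field; rewrite dn0 gt_eqF.
rewrite /start_potential /=.
have -> : C * y ^+ (size u).+1 = y ^+ size u * (C * y) by rewrite exprS; ring.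
have -> : pstar d p * (C * y ^+ size u) = y ^+ size u * (pstar d p * C) by ring.
rewrite -mulrDr; apply: ler_wpM2l; first exact: (exprn_ge0 _ (ltW y0)).
rewrite -growthE -/a.
have := descent_le_growth; set q := y ^+ 2 / (1 - y) => qC.
have : (a - pstar d p) * q <= (a - pstar d p) * C.
  by apply: ler_wpM2l => //; rewrite /a; lra.
rewrite /a; lra.
Qed.

(** Expected number, among the next [k] steps, of those that descend into [v]. *)
Fixpoint descent_sum v k u s : R :=
  if k is k'.+1 then \sum_(w <- moves u s) step_prob p u s w *
    ((is_parent (last u s) w && (w == v))%:R + descent_sum v k' u (rcons s w))
  else 0.

Definition path_potential u s : R :=
  if s is [::] then start_potential u else potential (last u (belast u s)) (last u s).

Lemma path_potential_ge0 u s : 0 <= path_potential u s.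
Proof.
case: s => [|w s]; last exact: potential_ge0.
rewrite /= /start_potential; case: ifP => _; first by rewrite divr_ge0 ?ltW.
by rewrite mulr_ge0 ?growth_ge0// exprn_ge0// ltW.
Qed.

Lemma path_potential_rcons u s w : path_potential u (rcons s w) = potential (last u s) w.
Proof.
rewrite /path_potential; case E : (rcons s w) => [|x s']; first by case: (s) E.
by rewrite -E belast_rcons last_rcons.
Qed.

Lemma path_potential_step u s :
  \sum_(w <- moves u s) step_prob p u s w * gain (last u s) w <= path_potential u s.
Proof.
case: (lastP s) => [|s' w]; first exact: potential_first.
rewrite moves_rcons last_rcons path_potential_rcons.
under eq_bigr do rewrite step_prob_rcons.
exact: potential_next.
Qed.

Lemma descent_sum_ge0 v k u s : 0 <= descent_sum v k u s.
Proof.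
elim: k s => //= k IHk s; apply: sumr_ge0 => w _; rewrite mulr_ge0//.
  exact: step_prob_ge0.
by rewrite addr_ge0.
Qed.

Lemma descent_sum_le (F : seq (vertex d)) k u s : uniq F ->
  \sum_(v <- F) y ^+ size v * descent_sum v k u s <= path_potential u s.
Proof.
move=> uF; elim: k s => [|k IHk] s /=.
  by rewrite big1 ?path_potential_ge0// => v _; rewrite mulr0.
apply: le_trans (path_potential_step u s).
under eq_bigr do rewrite mulr_sumr.
rewrite exchange_big /=; apply: ler_sum => w _.
rewrite (eq_bigr (fun v => step_prob p u s w * (y ^+ size v *
   ((is_parent (last u s) w && (w == v))%:R + descent_sum v k u (rcons s w))))); last first.
  by move=> v _; ring.
rewrite -mulr_sumr; apply: ler_wpM2l; first exact: step_prob_ge0.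
under eq_bigr do rewrite mulrDr.
rewrite big_split /= /gain; apply: lerD; last by rewrite -path_potential_rcons.
case: (is_parent _ w) => /=; last by rewrite big1 ?mul0r// => v _; rewrite mulr0.
rewrite mul1r; have [wF|wF] := boolP (w \in F).
  rewrite (bigD1_seq w)//= eqxx mulr1 big1 ?addr0// => v /negbTE vw.
  by rewrite eq_sym vw mulr0.
rewrite big_seq big1 ?exprn_ge0// ?ltW// => v vF.
by case: eqP => [E|_]; [move: wF; rewrite E vF|rewrite mulr0].
Qed.

Lemma path_prob_climb u : path_prob p u (climb u) <= y ^+ size u.
Proof.
have [ay _] := discount_bounds; have /andP[a0 a1] := a01.
have cont i v : continuation_prob p (i :: v) v (climb v) = a ^+ size v.
  elim: v i => [|j v IHv] i //=.
  by rewrite next_step_up_parent IHv exprS.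
case: u => [|i u] //=; rewrite first_step_parent cont exprS.
have /andP[s0 sa] := pstar_bounds d2 p01.
apply: ler_pM; rewrite ?exprn_ge0//; [exact: ltW|exact: ltW|by apply: ltW; exact: le_lt_trans ay|].
by apply: lerXn2r; rewrite ?nnegrE; exact: ltW.
Qed.

End Potential.

Section HittingBounds.
Variables (R : realType) (d : nat) (p : R).
Hypothesis d2 : (2 <= d)%N.
Hypothesis p01 : 0 < p < 1 / 2.
Variables (disp : measure_display) (Omega : measurableType disp).
Variables (P : probability Omega R) (X : vertex d -> nat -> Omega -> vertex d).
Hypothesis HX : is_nbFM p P X.
Implicit Types (u v w : vertex d) (s : seq (vertex d)).

Definition descent_event v u n0 N : set Omega :=
  [set x | exists n, (n0 <= n < N)%N /\ X u n.+1 x = v /\ is_parent (X u n x) v].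

Lemma descent_event_sigma v u n0 N : path_sigma X u (descent_event v u n0 N).
Proof.
rewrite /descent_event (_ : [set x | _] = \bigcup_(nt in [set nt : nat * vertex d |
   (n0 <= nt.1 < N)%N /\ is_parent nt.2 v])
   ([set x | X u nt.1.+1 x = v] `&` [set x | X u nt.1 x = nt.2])).
  rewrite bigcup_mkcond.
  apply: (@countable_bigcupT_measurable _ (g_sigma_algebraType _)) => // nt.
  case: ifP => _; last exact: (@measurable0 _ (g_sigma_algebraType _)).
  apply: (@measurableI _ (g_sigma_algebraType _)); apply: sub_sigma_algebra.
    by exists nt.1.+1, v.
  by exists nt.1, nt.2.
apply/seteqP; split => x /=.
  by move=> [n [h1 [h2 h3]]]; exists (n, X u n x).
by move=> [[n t] /= [h1 h2] [h3 h4]]; exists n; rewrite h3 h4.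
Qed.

Lemma measurable_descent_event v u n0 N : measurable (descent_event v u n0 N).
Proof.
have [mX _ _] := HX.
by apply: (path_sigma_measurable mX (v := u)); exact: descent_event_sigma.
Qed.

Let only u s : vertex d -> seq (vertex d) := fun z => if z == u then s else [::].

(** The paths are revealed one step at a time as in the exploration of the frogs; the
event only concerns steps from time [size s] on. *)
Lemma descent_bounded v u N k s : (size s + k = N)%N ->
  bounded_in p P X (descent_event v u (size s) N) (only u s) (descent_sum p v k u s).
Proof.
elim: k s => [|k IHk] s sN J uJ hJ.
  rewrite /= mul0r (_ : _ `&` _ = set0) ?measure0// -subset0 => x [_ [n [/andP[h1 h2] _]]].
  by move: h2; rewrite -sN addn0 ltnNge h1.
have mE n := measurable_descent_event v u n N.
(* After a past of probability zero the step probabilities need not sum to 1, but then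
   both sides vanish. *)
have [s0|s0] := eqVneq (path_prob p u s) 0.
  have uJ' : u \in J.
    apply: hJ; rewrite /only eqxx => E; move: s0; rewrite E /=.
    by move/eqP; rewrite oner_eq0.
  have w0 : weight p J (only u s) = 0.
    by rewrite /weight (bigD1_seq u)//= /only eqxx s0 mul0r.
  rewrite w0 mulr0; apply: (@le_trans _ _ (P (cylinder X J (only u s)))).
    have [mX _ _] := HX; have mC := measurable_cylinder mX J (only u s).
    by apply: le_measure; rewrite ?inE//; exact: measurableI.
  by rewrite (probability_cylinder HX)// w0.
have onlyE w : upd (only u s) u w = only u (rcons s w).
  by apply/funext => z; rewrite /upd /only; case: eqP.
apply: (bounded_in_step HX (mE _) (u := u) (moves_uniq u s) (pr := step_prob p u s)
  (f := fun w => (is_parent (last u s) w && (w == v))%:R + descent_sum p v k u (rcons s w))) uJ hJ.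
- by move=> w _; rewrite /only eqxx.
- exact: step_prob_sum.
move=> w _; rewrite onlyE => J' uJ' hJ'.
have uinJ : u \in J'.
  by apply: hJ'; rewrite /only eqxx; case: (s).
have mX : forall v n u, measurable (X v n @^-1` [set u]) by have [] := HX.
have mC := measurable_cylinder mX J' (only u (rcons s w)).
have wge := weight_ge0 HX (only u (rcons s w)) uJ'.
have [/andP[hpar /eqP wv]|nhit] := boolP (is_parent (last u s) w && (w == v)).
  apply: (@le_trans _ _ (P (cylinder X J' (only u (rcons s w))))).
    by apply: le_measure; rewrite ?inE//; exact: measurableI.
  rewrite (probability_cylinder HX)// lee_fin ler_peMl// lerDl.
  exact: descent_sum_ge0.
rewrite add0r.
have IH := IHk (rcons s w) _ J' uJ' hJ'.
apply: le_trans (IH _); last by rewrite size_rcons addSnnS.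
apply: le_measure; rewrite ?inE; [exact: measurableI|exact: measurableI|].
move=> x [Cx [n [/andP[h1 h2] [h3 h4]]]]; split => //.
exists n; rewrite size_rcons h2 andbT; split => //.
rewrite ltn_neqAle h1 andbT; apply: contraNneq nhit => sn.
have := Cx u uinJ; rewrite /only eqxx size_rcons => E.
have last1 : X u (size s).+1 x = w.
  have := congr1 (last u) E; rewrite mkseqS last_rcons => ->.
  by rewrite /= last_rcons.
have last0 : X u (size s) x = last u s.
  move: E; rewrite mkseqS -rcons_cons => /rcons_inj/(congr1 fst) /=.
  by move=> /(congr1 (last u)); rewrite mkseqS last_rcons.
by rewrite -last0 -last1 sn h3 h4 eqxx.
Qed.

Lemma descent_event_le v u N :
  (P (descent_event v u 0 N) <= (descent_sum p v N u [::])%:E)%E.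
Proof.
apply: (@bounded_in_nil _ _ p _ _ P X).
have := @descent_bounded v u N N [::] erefl.
by have -> : only u [::] = fun=> [::] by apply/funext => z; rewrite /only; case: eqP.
Qed.

(** The horizon is harmless: by [legal_step] a vertex [v] is entered by a descending
step within the first [size u + size v] steps or not at all. *)
Definition reaches u v : set Omega := descent_event v u 0 (size u + size v).

Definition reach_prob u v : R := fine (P (reaches u v)).

Lemma reach_probE u v : P (reaches u v) = (reach_prob u v)%:E.
Proof. by rewrite /reach_prob fineK// fin_num_measure//; exact: measurable_descent_event. Qed.

Lemma reach_prob_ge0 u v : 0 <= reach_prob u v.
Proof. by rewrite /reach_prob fine_ge0. Qed.

Lemma reach_prob_sum (F : seq (vertex d)) u : uniq F ->
  \sum_(v <- F) discount p ^+ size v * reach_prob u v <= path_potential p u [::].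
Proof.
move=> uF; pose N := \max_(v <- F) (size u + size v).
apply: le_trans (descent_sum_le d2 p01 N u [::] uF).
have y0 : 0 <= discount p.
  have [h _] := discount_bounds p01; have /andP[h' _] := phat_bounds p01.
  by apply: ltW; exact: lt_trans h.
rewrite big_seq [leRHS]big_seq; apply: ler_sum => v vF.
apply: ler_wpM2l; first exact: exprn_ge0.
rewrite -lee_fin -reach_probE; apply: le_trans (descent_event_le v u N).
apply: le_measure; rewrite ?inE; [exact: measurable_descent_event|exact: measurable_descent_event|].
move=> x [n [/andP[_ nN] h]]; exists n; split => //=.
by apply: (leq_trans nN); exact: leq_bigmax_seq.
Qed.

Lemma reach_prob_root u : reach_prob u [::] = 0.
Proof.
by rewrite /reach_prob (_ : reaches u [::] = set0) ?measure0// -subset0 => x [n [_ [_ ]]].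
Qed.

Definition climbs u : set Omega :=
  [set x | mkseq (fun k => X u k x) (size u).+1 = u :: climb u].

Lemma climbs_le u : (P (climbs u) <= (discount p ^+ size u)%:E)%E.
Proof.
have [_ cyl _] := HX.
by rewrite /climbs -{1}(size_climb u) cyl lee_fin; exact: path_prob_climb.
Qed.

(** The event required of the frog [v] in the chain [u :: s], as a function of the frog
so that it can be fed to [independent_paths]. *)
Fixpoint chain_event u s v : set Omega :=
  if s is w :: s' then if v == u then reaches u w else chain_event w s' v
  else climbs u.

Fixpoint chain_weight u s : R :=
  if s is w :: s' then reach_prob u w * chain_weight w s' else fine (P (climbs u)).

Lemma measurable_climbs u : measurable (climbs u).
Proof. by have [mX _ _] := HX; exact: measurable_prefix. Qed.

Lemma climbs_fin u : P (climbs u) = (fine (P (climbs u)))%:E.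
Proof. by rewrite fineK// fin_num_measure//; exact: measurable_climbs. Qed.

Lemma chain_weight_ge0 u s : 0 <= chain_weight u s.
Proof.
elim: s u => [|w s IHs] u /=; first by rewrite fine_ge0.
by rewrite mulr_ge0// reach_prob_ge0.
Qed.

Lemma chain_event_sigma u s v : uniq (u :: s) -> v \in u :: s ->
  path_sigma X v (chain_event u s v).
Proof.
elim: s u => [|w s IHs] u.
  by move=> _; rewrite inE => /eqP -> /=; exact: prefix_sigma.
move=> uu; rewrite inE /=; case: eqP => [-> _|_ /= vs]; first exact: descent_event_sigma.
by apply: IHs => //; case/andP: uu.
Qed.

Definition full_chain s : set Omega :=
  [set x | uniq ([::] :: s) /\ forall v, v \in [::] :: s -> chain_event [::] s v x].

Lemma measurable_full_chain s : measurable (full_chain s).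
Proof.
rewrite (_ : full_chain s = [set _ | uniq ([::] :: s)] `&`
   [set x | forall v, ([set _ | v \notin [::] :: s] `|` chain_event [::] s v) x]).
  apply: measurableI; first exact: measurable_const.
  apply: measurable_countI => v; apply: measurableU; first exact: measurable_const.
  elim: s [::] => [|w s IHs] u /=; first exact: measurable_climbs.
  by case: ifP => _ //; exact: measurable_descent_event.
apply/seteqP; split => x /= [h1 h2]; split => // v.
  by have [vs|] := boolP (v \in [::] :: s); [right; exact: h2|left].
by move=> vs; have [] := h2 v => //; rewrite vs.
Qed.

Lemma full_chain_le s : (P (full_chain s) <= (chain_weight [::] s)%:E)%E.
Proof.
have [us|us] := boolP (uniq ([::] :: s)); last first.
  rewrite (_ : full_chain s = set0) ?measure0 ?lee_fin ?chain_weight_ge0//.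
  by rewrite -subset0 => x []; rewrite (negbTE us).
have [_ _ ind] := HX.
rewrite (_ : full_chain s = \bigcap_(v in [set` [::] :: s]) chain_event [::] s v); last first.
  by apply/seteqP; split => x; [move=> []|move=> H; split].
rewrite ind//; last by move=> v; exact: chain_event_sigma.
suff -> : (\prod_(v <- [::] :: s) P (chain_event [::] s v) = (chain_weight [::] s)%:E)%E by [].
elim: s [::] us => [|w s IHs] u us /=.
  by rewrite big_seq1 /= climbs_fin.
rewrite big_cons /= eqxx reach_probE EFinM; congr (_ * _)%E.
rewrite -IHs; last by case/andP: us.
apply: eq_big_seq => v vs; case: eqP => // vu; move: us; rewrite /= -vu.
by rewrite vs.
Qed.

End HittingBounds.

(** * Transience below 1/6, and the limit *)

Lemma sum_subset_le (R : numDomainType) (T : eqType) (l W : seq T) (f : T -> R) :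
  uniq l -> {subset l <= W} -> (forall s, 0 <= f s) ->
  \sum_(s <- l) f s <= \sum_(s <- W) f s.
Proof.
move=> + + f0; elim: l W => [|x l IHl] W /=; first by rewrite big_nil sumr_ge0.
move=> /andP[xl ul] lW; have xW : x \in W by apply: lW; exact: mem_head.
rewrite big_cons (perm_big _ (perm_to_rem xW)) big_cons lerD2l.
apply: IHl => // y yl; have := lW y; rewrite inE yl orbT => /(_ isT).
rewrite (perm_mem (perm_to_rem xW)) inE => /orP[/eqP yx|//].
by move: xl; rewrite -yx yl.
Qed.

Section Words.
Variables (T : eqType) (F : seq T).

Fixpoint words k : seq (seq T) :=
  if k is k'.+1 then [seq v :: s | v <- F, s <- words k'] else [:: [::]].

Lemma mem_words s : {subset s <= F} -> s \in words (size s).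
Proof.
elim: s => [|v s IHs] sF //=; apply/allpairsP; exists (v, s); split => //=.
  by apply: sF; exact: mem_head.
by apply: IHs => w ws; apply: sF; rewrite inE ws orbT.
Qed.

End Words.

Section BorelCantelliCount.
Context d (Omega : measurableType d) (R : realType).
Variables (P : probability Omega R) (I : countType) (F : I -> set Omega) (f : I -> R).
Variable M : R.
Hypothesis mF : forall i, measurable (F i).
Hypothesis Ff : forall i, (P (F i) <= (f i)%:E)%E.
Hypothesis fM : forall l : seq I, uniq l -> \sum_(i <- l) f i <= M.

(** The events are numbered through [pickle_inv]; as [pickle] is injective, a point in
infinitely many of them lies in infinitely many terms of the resulting sequence. *)
Lemma borel_cantelli_count (B : set Omega) : measurable B ->
  (forall w, B w -> forall k, has_at_least [set i | F i w] k) -> P B = 0%E.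
Proof.
move=> mB HB; pose G n := if (pickle_inv n : option I) is Some i then F i else set0.
have mG n : measurable (G n) by rewrite /G; case: pickle_inv.
have G0 : P (lim_sup_set G) = 0%E.
  apply: lim_sup_set_cvg0 => //; apply: (@le_lt_trans _ _ M%:E); last exact: ltry.
  apply: lime_le; first by apply: is_cvg_nneseries => n _ _; exact: measure_ge0.
  apply: nearW => n; rewrite /eseries/=.
  have ul : uniq (pmap (@pickle_inv I) (index_iota 0 n)).
    exact: (pmap_uniq pickle_invK (iota_uniq _ _)).
  apply: (@le_trans _ _ (\sum_(i <- pmap (@pickle_inv I) (index_iota 0 n)) f i)%:E).
    elim: (index_iota 0 n) => [|k s IHs]; first by rewrite !big_nil.
    rewrite big_cons /= {1}/G; case: pickle_inv => [i|] /=; last by rewrite measure0 add0e.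
    by rewrite big_cons EFinD leeD.
  by rewrite lee_fin; exact: fM.
have mL : measurable (lim_sup_set G).
  by apply: bigcapT_measurable => n; apply: bigcup_measurable.
apply: (null_subset mB mL _ G0) => w /HB H N _.
have [s [us ss sF]] := H N.+1.
have [n nN Gn] : exists2 n, (N <= n)%N & G n w.
  apply: contrapT => HN.
  have sub : {subset map pickle s <= iota 0 N}.
    move=> _ /mapP[i is_ ->]; rewrite mem_iota /= add0n ltnNge; apply/negP => Ni.
    by apply: HN; exists (pickle i) => //; rewrite /G pickleK_inv; exact: sF.
  have := uniq_leq_size _ sub; rewrite size_map size_iota ss.
  rewrite map_inj_uniq ?us; last exact: (pcan_inj pickleK_inv).
  by move=> /(_ isT); rewrite ltnn.
by exists n.
Qed.

End BorelCantelliCount.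

Section Transience.
Variables (R : realType) (d : nat) (p : R).
Hypothesis d2 : (2 <= d)%N.
Hypothesis p06 : 0 < p < 1 / 6.
Variables (disp : measure_display) (Omega : measurableType disp).
Variables (P : probability Omega R) (X : vertex d -> nat -> Omega -> vertex d).
Hypothesis HX : is_nbFM p P X.
Implicit Types (u v w : vertex d) (s : seq (vertex d)).

Let p01 : 0 < p < 1 / 2. Proof. by have /andP[? ?] := p06; apply/andP; split; lra. Qed.

Let y : R := discount p.
Let C : R := growth p.
Let wt := @chain_weight R d disp Omega P X.
Let rp := @reach_prob R d disp Omega P X.

Lemma growth_lt1 : growth p < 1.
Proof.
have /andP[a0 a1] := phat_bounds p01; have /andP[p0 p6] := p06.
have h : phat p < 1 / 5 by rewrite /phat ltr_pdivrMr; lra.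
by rewrite /growth ltr_pdivrMr; lra.
Qed.

Let C0 : 0 <= C. Proof. exact: growth_ge0. Qed.
Let C1 : C < 1. Proof. exact: growth_lt1. Qed.
Let y0 : 0 < y.
Proof.
have [h _] := discount_bounds p01; have /andP[h' _] := phat_bounds p01.
exact: lt_trans h.
Qed.
Let y1 : y < 1. Proof. by have [_] := discount_bounds p01. Qed.

Section FixedVertices.
Variable F : seq (vertex d).
Hypothesis uF : uniq F.

Lemma words_sumS k u : \sum_(s <- words F k.+1) wt u s =
  \sum_(v <- F) rp u v * \sum_(s <- words F k) wt v s.
Proof.
rewrite /= big_flatten big_map; apply: eq_bigr => v _.
by rewrite big_map mulr_sumr.
Qed.

(** A chain is its first link followed by a chain.  The probability of a link, summed
over its end with the weights, is at most the potential of its first frog. *)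
Lemma words_sum_step k u : (forall v, v != [::] ->
    \sum_(s <- words F k) wt v s <= C ^+ k * y ^+ size v) ->
  \sum_(s <- words F k.+1) wt u s <= C ^+ k * path_potential p u [::].
Proof.
move=> H; rewrite words_sumS.
apply: (@le_trans _ _ (C ^+ k * \sum_(v <- F) y ^+ size v * rp u v)); last first.
  rewrite ler_wpM2l ?exprn_ge0//; exact: (reach_prob_sum d2 p01 HX u uF).
rewrite mulr_sumr; apply: ler_sum => v _.
have [->|v0] := eqVneq v [::].
  by rewrite /rp (reach_prob_root P X u) !(mul0r, mulr0).
rewrite mulrA [leRHS]mulrC; apply: ler_wpM2l; last exact: H.
exact: reach_prob_ge0.
Qed.

Lemma words_sum_le k u : u != [::] -> \sum_(s <- words F k) wt u s <= C ^+ k * y ^+ size u.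
Proof.
elim: k u => [|k IHk] u u0.
  rewrite big_seq1 expr0 mul1r /wt /= -lee_fin -(climbs_fin HX); exact: climbs_le.
apply: le_trans (words_sum_step u IHk) _.
by rewrite /= /start_potential (negbTE u0) exprSr mulrA.
Qed.

Lemma words_sum_root k : \sum_(s <- words F k.+1) wt [::] s <= C ^+ k * (y / (1 - y)).
Proof. by apply: le_trans (words_sum_step [::] (@words_sum_le k)) _; rewrite /= /start_potential eqxx. Qed.

End FixedVertices.

(* The 1 accounts for the empty chain, the root frog alone. *)
Let M : R := 1 + y / (1 - y) / (1 - C).

(** A finite set of chains uses finitely many vertices and lengths, so it is covered by
the words over a finite alphabet, whose weights sum to a geometric series. *)
Lemma chains_sum_le (l : seq (seq (vertex d))) : uniq l -> \sum_(s <- l) wt [::] s <= M.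
Proof.
move=> ul; pose F := undup (flatten l); pose m := \max_(s <- l) size s.
have uF : uniq F by exact: undup_uniq.
pose W := flatten [seq words F k | k <- iota 0 m.+1].
apply: (@le_trans _ _ (\sum_(s <- W) wt [::] s)).
  apply: sum_subset_le => //; last by move=> s; exact: chain_weight_ge0.
  move=> s sl; apply/flatten_mapP; exists (size s).
    by rewrite mem_iota /= add0n ltnS; exact: leq_bigmax_seq.
  apply: mem_words => v vs; rewrite mem_undup; apply/flattenP; by exists s.
rewrite big_flatten big_map /= big_cons big_seq1 -/(words F) lerD//.
  by rewrite /wt /= -lee_fin -(climbs_fin HX) probability_le1//; exact: (measurable_climbs HX).
have -> : \sum_(j <- iota 1 m) \sum_(s <- words F j) wt [::] s =
   \sum_(j <- iota 0 m) \sum_(s <- words F j.+1) wt [::] s.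
  by rewrite -[1%N]/(1 + 0)%N iotaDl big_map.
apply: (@le_trans _ _ (\sum_(j <- iota 0 m) C ^+ j * (y / (1 - y)))).
  by apply: ler_sum => j _; exact: words_sum_root.
have yy : 0 <= y / (1 - y) by rewrite divr_ge0 ?subr_ge0 ?ltW.
rewrite -mulr_suml mulrC ler_wpM2l// -div1r ler_pdivlMr ?subr_gt0//.
have : 0 <= C ^+ m by exact: exprn_ge0.
have := subrX1 C m; rewrite -(big_mkord xpredT (GRing.exp C)) /index_iota subn0.
lra.
Qed.

Definition legal_event : set Omega :=
  [set x | forall us : vertex d * seq (vertex d), path_prob p us.1 us.2 = 0 ->
     ~ mkseq (fun k => X us.1 k x) (size us.2).+1 = us.1 :: us.2].

Let mX : forall v n u, measurable (X v n @^-1` [set u]).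
Proof. by have [] := HX. Qed.

Lemma legal_eventP x : good_start X x -> legal_event x ->
  forall u, legal_path p u (fun n => X u n x).
Proof.
move=> gx lx u.
pose s n := behead (mkseq (fun k => X u k x) n.+1).
have sE n : mkseq (fun k => X u k x) n.+1 = u :: s n by rewrite /s /mkseq /= gx.
have ss n : size (s n) = n by rewrite /s size_behead size_mkseq.
have sS n : s n.+1 = rcons (s n) (X u n.+1 x).
  by have := sE n.+1; rewrite mkseqS sE => -[].
have pos n : path_prob p u (s n) != 0.
  by apply/eqP => h; apply: (lx (u, s n) h); rewrite /= ss sE.
split.
- exact: gx.
- by have := pos 1%N; rewrite sS path_prob_rcons mulf_eq0 negb_or => /andP[_].
- move=> n; have := pos n.+2; rewrite sS path_prob_rcons mulf_eq0 negb_or => /andP[_].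
  by rewrite (@step_prob_ends _ _ p u (s n.+1) (mkseq (fun k => X u k x) n) (X u n x) (X u n.+1 x))// -sE !mkseqS.
Qed.

Lemma measurable_legal_event : measurable legal_event.
Proof.
rewrite (_ : legal_event = [set x | forall us : vertex d * seq (vertex d),
   ([set _ | path_prob p us.1 us.2 <> 0] `|`
   ~` [set x | mkseq (fun k => X us.1 k x) (size us.2).+1 = us.1 :: us.2]) x]).
  apply: measurable_countI => us; apply: measurableU; first exact: measurable_const.
  by apply: measurableC; exact: measurable_prefix.
apply/seteqP; split => x /= H us; last by have [] := H us.
by have [h|h] := pselect (path_prob p us.1 us.2 = 0); [right; exact: H|left].
Qed.

Lemma illegal_null : P (~` legal_event) = 0%E.
Proof.
rewrite (_ : ~` _ = [set x | exists us : vertex d * seq (vertex d),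
   ([set _ | path_prob p us.1 us.2 = 0] `&`
    [set x | mkseq (fun k => X us.1 k x) (size us.2).+1 = us.1 :: us.2]) x]).
  have mp us : measurable ([set _ : Omega | path_prob p us.1 us.2 = 0] `&`
    [set x | mkseq (fun k => X us.1 k x) (size us.2).+1 = us.1 :: us.2]).
    by apply: measurableI; [exact: measurable_const|exact: measurable_prefix].
  apply: null_countU => // -[u s]; have [_ cyl _] := HX.
  have [h|h] := pselect (path_prob p u s = 0); last first.
    by rewrite (_ : _ `&` _ = set0) ?measure0// -subset0 => x [/h].
  apply: (null_subset (mp (u, s)) _ (@subIsetr _ _ _)); first exact: measurable_prefix.
  by apply: (etrans (cyl u s)); rewrite h.
apply/seteqP; split => x /=.
  move=> H; apply: contrapT => H'; apply: H => us h h'; apply: H'; by exists us.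
by move=> [us [h h']] H; exact: (H us).
Qed.

Lemma chain_full x s : uniq ([::] :: s) -> chain (fun v n => X v n x) [::] s ->
  mkseq (fun n => X (last [::] s) n x) (size (last [::] s)).+1
    = last [::] s :: climb (last [::] s) -> full_chain X s x.
Proof.
move=> us cs ls; split => //.
elim: s [::] us cs ls => [|w s IHs] u us /= cs ls v.
  by move=> _; exact: ls.
case: cs => [[n lt [h1 h2]] cs]; rewrite inE; case: eqP => [_ _|_ /= vs].
  by exists n.
by apply: (IHs w) => //; case/andP: us.
Qed.

(** Infinitely many visits would produce infinitely many full chains, and the sum of
their probabilities is finite. *)
Theorem transient : P (infinite_visits R X) = 0%E.
Proof.
have mI := measurable_infinite_visits HX.
have mg := measurable_good_start HX.
have ml := measurable_legal_event.
pose B := infinite_visits R X `&` good_start X `&` legal_event.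
have mB : measurable B by apply: measurableI => //; exact: measurableI.
have B0 : P B = 0%E.
  apply: (@borel_cantelli_count _ Omega R P (seq (vertex d)) (full_chain X) (wt [::]) M).
  - by move=> s; exact: (measurable_full_chain HX).
  - by move=> s; exact: (full_chain_le HX).
  - exact: chains_sum_le.
  - exact: mB.
  move=> x [[]]; rewrite infinite_visitsE /= => Ix gx lx k.
  have legal := legal_eventP gx lx.
  have [s [us ss H]] := root_moves_chains legal (Ix k).
  exists s; split => // c /H[h1 h2 h3]; exact: chain_full.
have mN : measurable (~` good_start X `|` ~` legal_event) by apply: measurableU; exact: measurableC.
apply: (null_subset mI (measurableU _ _ mB mN)).
- move=> x Ix; have [gx|gx] := pselect (good_start X x); last by right; left.
  by have [lx|lx] := pselect (legal_event x); [left|right; right].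
- rewrite measureU0//.
  rewrite measureU0; [exact: bad_start_null HX|exact: measurableC|exact: measurableC|].
  exact: illegal_null.
Qed.

End Transience.

(** Recurrence is a statement about all realisations of the model, so [nbFM_exists] is
what turns [transient] into a contradiction. *)
Lemma not_recurrent_below (R : realType) (d : nat) (p : R) : (2 <= d)%N ->
  0 < p < 1 / 6 -> ~ nbFM_recurrent d p.
Proof.
move=> d2 p06 rec.
have p01 : 0 < p < 1 / 2 by have /andP[? ?] := p06; apply/andP; split; lra.
have HX := @nbFM_exists R d p d2 p01.
have := rec _ _ _ _ HX.
rewrite -[[set w | _]]/(infinite_visits R _) (transient d2 p06 HX).
by move=> [] /eqP; rewrite eq_sym oner_eq0.
Qed.

Theorem theorem4 (R : realType) :
  critical_drift R d @[d --> \oo] --> (1 / 6 : R).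
Proof.
apply/cvgrPdist_le => e e0.
pose e' := Num.min e (1 / 4).
have e'0 : 0 < e' by rewrite lt_min e0/=; lra.
have e'e : e' <= e by rewrite ge_min lexx.
have e'4 : e' <= 1 / 4 by rewrite ge_min lexx orbT.
have p01 : 1 / 6 < 1 / 6 + e' < 1 / 2 by apply/andP; split; lra.
have [N _ HN] := recurrent_above p01.
exists N.+2 => // d /= Nd; have d2 : (2 <= d)%N by exact: leq_trans Nd.
pose A := [set p : R | 0 < p < 1 / 2 /\ nbFM_recurrent d p].
have Ae : A (1 / 6 + e').
  split; first by apply/andP; split; lra.
  by apply: HN; rewrite /= (leq_trans _ Nd)// leqW.
have lbA : lbound A (1 / 6).
  move=> p [/andP[p0 p2] rec]; rewrite leNgt; apply/negP => p6.
  by apply: (not_recurrent_below d2 _ rec); rewrite p0.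
have h1 : 1 / 6 <= critical_drift R d.
  by apply: lb_le_inf => //; exists (1 / 6 + e').
have h2 : critical_drift R d <= 1 / 6 + e'.
  by apply: ge_inf => //; exists (1 / 6).
by rewrite ler_norml; apply/andP; split; lra.
Qed.
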